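(* Let $d$ be a positive integer, let $F_0$ be an arbitrary number field, and let $F_1,F_2,F_3,\ldots$ be a sequence of finite extensions of $F_0$ with $[F_i:F_0]\leq d$ for all $i$. Moreover suppose there exists a sequence $p_1,p_2,p_3,\ldots$ of positive prime numbers such that, for every $i\ge 1$, $p_i$ ramifies totally in $F_i$ but does not ramify in $F_j$ for $1\leq j<i$. Then the compositum of $F_0,F_1,F_2,F_3,\ldots$ has the Northcott property.
   Context: All fields lie in a fixed algebraic closure $\overline{\mathbb{Q}}$ of $\mathbb{Q}$. $H(\cdot)$ denotes the non-logarithmic absolute Weil height on $\overline{\mathbb{Q}}$: for $\alpha$ in a number field $F$, $H(\alpha)=\prod_v \max\{1,|\alpha|_v\}^{[F_v:\mathbb{Q}_v]/[F:\mathbb{Q}]}$, the product over all places $v$ of $F$, with $|\cdot|_v$ extending the usual absolute values of $\mathbb{Q}$. A subset $\mathcal{A}\subseteq\overline{\mathbb{Q}}$ has the Northcott property (property $(N)$) if for each positive real $X$ there are only finitely many $\alpha\in\mathcal{A}$ with $H(\alpha)\le X$. Ramification of a prime number $p$ in a number field $F$ refers to the extension $F/\mathbb{Q}$; $p$ ramifies totally in $F$ if $p\mathcal{O}_F=\mathfrak{P}^{[F:\mathbb{Q}]}$ for a prime ideal $\mathfrak{P}$ of the ring of integers $\mathcal{O}_F$. *)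

(* Defs.v *)
From HB Require Import structures.
From mathcomp Require Import all_boot all_order all_algebra all_field.
From mathcomp Require Import all_classical all_reals all_analysis.
Set Implicit Arguments.
Unset Strict Implicit.
Unset Printing Implicit Defensive.
Import Order.TTheory GRing.Theory Num.Theory.
Local Open Scope classical_set_scope.
Local Open Scope ring_scope.

(* The fixed algebraic closure of Q is algC;
   a field is a subset of algC which is a subfield, so that inclusions and
   composita are literal.  Real numbers (absolute values, heights) live in an
   arbitrary R : realType. *)

Definition subfield (E : set algC) : Prop :=
  GRing.divring_closed [pred x | x \in E].

Definition rationals : set algC := [set x | x \in Crat].

Definition compositum (F : nat -> set algC) : set algC :=
  smallest subfield (\bigcup_i F i).

Definition is_basis (K E : set algC) (n : nat) (b : 'I_n -> algC) : Prop :=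
  [/\ forall i, E (b i),
      forall x, E x ->
        exists2 c : 'I_n -> algC,
          forall i, K (c i) & x = \sum_(i < n) c i * b i &
      forall c : 'I_n -> algC, (forall i, K (c i)) ->
        \sum_(i < n) c i * b i = 0 -> forall i, c i = 0].

Definition has_degree (K E : set algC) (n : nat) : Prop :=
  exists b : 'I_n -> algC, is_basis K E b.

(* [E : K], with the junk value 0 when E / K is not finite. *)
Definition degree (K E : set algC) : nat := xget 0%N [set n | has_degree K E n].

Definition finite_extension (K E : set algC) : Prop :=
  [/\ subfield K, subfield E, K `<=` E & exists n, has_degree K E n].

Definition number_field (F : set algC) : Prop := finite_extension rationals F.

Definition ring_of_integers (F : set algC) : set algC :=
  [set x | F x /\ x \in Aint].

Definition is_ideal (O I : set algC) : Prop :=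
  [/\ I `<=` O, I 0, forall x y, I x -> I y -> I (x + y) &
      forall a x, O a -> I x -> I (a * x)].

Definition prime_ideal (O P : set algC) : Prop :=
  [/\ is_ideal O P, ~ P 1 &
      forall x y, O x -> O y -> P (x * y) -> P x \/ P y].

Definition principal_ideal (O : set algC) (a : algC) : set algC :=
  [set a * x | x in O].

Definition ideal_mul (I J : set algC) : set algC :=
  [set x | exists (n : nat) (a b : 'I_n -> algC),
    [/\ forall i, I (a i), forall i, J (b i) & x = \sum_(i < n) a i * b i]].

Definition ideal_exp (O I : set algC) (n : nat) : set algC :=
  iter n (ideal_mul I) O.

Definition ideal_dvd (O I J : set algC) : Prop :=
  exists2 J' : set algC, is_ideal O J' & J = ideal_mul I J'.

(* Some prime ideal occurs in the factorization of p O_F with exponent at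
   least 2. *)
Definition ramifies (p : nat) (F : set algC) : Prop :=
  let O := ring_of_integers F in
  exists2 P : set algC, prime_ideal O P &
    ideal_dvd O (ideal_exp O P 2) (principal_ideal O p%:R).

Definition ramifies_totally (p : nat) (F : set algC) : Prop :=
  let O := ring_of_integers F in
  exists2 P : set algC, prime_ideal O P &
    principal_ideal O p%:R = ideal_exp O P (degree rationals F).

Definition padic_abs (R : realType) (p : nat) (q : rat) : R :=
  if q == 0 then 0
  else p%:R ^+ logn p `|denq q|%N / p%:R ^+ logn p `|numq q|%N.

Definition usual_abs (R : realType) (w : rat -> R) : Prop :=
  w = (fun q => ratr `|q|) \/ exists2 p : nat, prime p & w = padic_abs R p.

(* A place of F is represented by its unique absolute value |.|_v extending one
   of the usual absolute values of Q.  It is a function on algC which is set to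
   0 outside F, so that distinct functions are distinct places. *)
Definition place (R : realType) (F : set algC) : set (algC -> R) :=
  [set v | [/\ forall x, ~ F x -> v x = 0,
               forall x, F x -> 0 <= v x /\ (v x = 0 <-> x = 0),
               forall x y, F x -> F y -> v (x * y) = v x * v y,
               forall x y, F x -> F y -> v (x + y) <= v x + v y &
               usual_abs (fun q : rat => v (ratr q))]].
Arguments place : clear implicits.

Definition cauchy_in (R : realType) (v : algC -> R) (A : set algC)
    (u : nat -> algC) : Prop :=
  (forall n, A (u n)) /\
  forall e : R, 0 < e -> exists N : nat,
    forall m n, (N <= m)%N -> (N <= n)%N -> v (u m - u n) < e.

Definition null_seq (R : realType) (v : algC -> R) (u : nat -> algC) : Prop :=
  forall e : R, 0 < e -> exists N : nat, forall n, (N <= n)%N -> v (u n) < e.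

(* The completion F_v is the field of v-Cauchy sequences in F modulo null
   sequences, and Q_v is its subfield of classes of Cauchy sequences in Q.
   The next definition says that the classes of b_0, ..., b_(n-1) form a basis
   of F_v over Q_v, unfolding the quotient. *)
Definition is_local_basis (R : realType) (F : set algC) (v : algC -> R)
    (n : nat) (b : 'I_n -> nat -> algC) : Prop :=
  [/\ forall i, cauchy_in v F (b i),
      forall u, cauchy_in v F u ->
        exists2 c : 'I_n -> nat -> algC,
          forall i, cauchy_in v rationals (c i) &
          null_seq v (fun k => u k - \sum_(i < n) c i k * b i k) &
      forall c : 'I_n -> nat -> algC, (forall i, cauchy_in v rationals (c i)) ->
        null_seq v (fun k => \sum_(i < n) c i k * b i k) ->
        forall i, null_seq v (c i)].

(* [F_v : Q_v], with the junk value 0 when the dimension is not finite. *)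
Definition local_degree (R : realType) (F : set algC) (v : algC -> R) : nat :=
  xget 0%N [set n | exists b : 'I_n -> nat -> algC, is_local_basis F v b].

(* The product over all places of F; all but finitely many factors are 1 when
   F is a number field, and \big[_/_]_(_ \in _) ranges over the others. *)
Definition height_in (R : realType) (F : set algC) (x : algC) : R :=
  \big[*%R/1]_(v \in place R F)
    (Num.max 1 (v x) `^ ((local_degree F v)%:R / (degree rationals F)%:R)).

Arguments height_in : clear implicits.

(* The product does not depend on the number field containing x; it is taken
   in Q(x). *)
Definition height (R : realType) (x : algC) : R :=
  height_in R (smallest subfield [set x]) x.
Arguments height : clear implicits.

Definition northcott (R : realType) (A : set algC) : Prop :=
  forall X : R, 0 < X -> finite_set [set x | A x /\ height R x <= X].
Arguments northcott : clear implicits.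

(* Main.v *)
(* Let K_i be the compositum of F_0, ..., F_i.  An x in K_i outside K_(i-1) is
   moved by some sigma fixing K_(i-1).  Absolute values above p_i take on K_(i-1)
   only integral powers of p_i as values, because the F_j with j < i are
   unramified at p_i, whereas F_i contains a pi of absolute value p_i^(-1/n) with
   n = [F_i : Q].  Expanding x in powers of pi over K_(i-1) shows that x - sigma x
   is divisible by pi at all places above p_i, up to the contribution of the
   denominators of x and sigma x.  The product formula then gives
   p_i <= (2 H(x)^2)^n.  As n is bounded and the p_i are distinct for the i that
   enlarge K_(i-1), the elements of bounded height lie in a single number field
   K_i, where Northcott's theorem applies. *)
Require Import Defs.
From HB Require Import structures.
From mathcomp Require Import all_boot all_order all_fingroup all_algebra all_field.
From mathcomp Require Import zify ring lra.
From mathcomp Require Import all_classical all_reals all_analysis.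
Set Implicit Arguments.
Unset Strict Implicit.
Unset Printing Implicit Defensive.
Import Order.TTheory GRing.Theory Num.Theory.
Local Open Scope classical_set_scope.
Local Open Scope ring_scope.

(** Each rational place is extended once to an absolute value on all of [algC]; the further
    extensions that the estimates need are its compositions with automorphisms. About the height,
    only one inequality is needed: the product of max(1, |r|) over all places and all conjugates r
    of x is at most a power of H(x). Hence local degrees only have to be bounded below, by numbers
    of conjugates. The delicate point is that a compositum of fields unramified at p still takes
    only powers of p as values. For each extension [w] one field, [teich_field], is exhibited that
    has this property and contains every field that has it. In the final bound, 2 is the archimedean
    triangle inequality and the square of H(x) accounts for x and sigma x. If p_i = p_j with i < j,
    then p_i is both totally ramified and unramified in F_i, so that [F_i : Q] = 1 and F_i enlarges
    nothing: this is why the p_i are distinct where it matters. Unramifiedness is assumed from F_1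
    on, and F_0 is controlled as a subfield of F_1, so the argument starts at i = 2. *)

Definition absval (R : realType) (w : algC -> R) : Prop :=
  [/\ forall x, 0 <= w x, forall x, w x = 0 <-> x = 0,
      forall x y, w (x * y) = w x * w y &
      forall x y, w (x + y) <= w x + w y].

(** * Elementary properties of absolute values on [algC] *)

Section Absval.
Variables (R : realType) (w : algC -> R).
Hypothesis wA : absval w.

Lemma absval_ge0 x : 0 <= w x. Proof. by case: wA. Qed.
Lemma absval0 : w 0 = 0. Proof. by case: wA => _ /(_ 0) [_ ->]. Qed.
Lemma absval_eq0 x : (w x == 0) = (x == 0).
Proof. by case: wA => _ /(_ x) [h1 h2] _ _; apply/eqP/eqP. Qed.
Lemma absval_gt0 x : (0 < w x) = (x != 0).
Proof. by rewrite lt_def absval_eq0 absval_ge0 andbT. Qed.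
Lemma absvalM x y : w (x * y) = w x * w y. Proof. by case: wA. Qed.
Lemma absvalD x y : w (x + y) <= w x + w y. Proof. by case: wA. Qed.
Lemma absval1 : w 1 = 1.
Proof.
have h : w 1 != 0 by rewrite absval_eq0 oner_eq0.
by apply: (mulfI h); rewrite -absvalM !mulr1.
Qed.
Lemma absvalX x n : w (x ^+ n) = w x ^+ n.
Proof. by elim: n => [|n IH]; rewrite ?expr0 ?absval1 // !exprS absvalM IH. Qed.
Lemma absvalN x : w (- x) = w x.
Proof.
have h : w (-1) = 1.
  have : w (-1) ^+ 2 = 1 by rewrite -absvalX sqrrN expr1n absval1.
  move/eqP; rewrite sqrf_eq1 => /orP[/eqP//|/eqP h].
  by have := absval_ge0 (-1); rewrite h oppr_ge0 ler10.
by rewrite -mulN1r absvalM h mul1r.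
Qed.
Lemma absvalB x y : w (x - y) = w (y - x).
Proof. by rewrite -absvalN opprB. Qed.
Lemma absvalV x : w x^-1 = (w x)^-1.
Proof.
have [->|x0] := eqVneq x 0; first by rewrite invr0 absval0 invr0.
have h : w x != 0 by rewrite absval_eq0.
by apply: (mulfI h); rewrite -absvalM !divff ?absval1.
Qed.
Lemma absval_prod I (r : seq I) (P : pred I) (f : I -> algC) :
  w (\prod_(i <- r | P i) f i) = \prod_(i <- r | P i) w (f i).
Proof. by apply: (big_morph w absvalM absval1). Qed.

Lemma absval_comp (nu : {rmorphism algC -> algC}) : absval (w \o nu).
Proof.
split=> [x|x|x y|x y] /=; rewrite ?absval_ge0 ?rmorphM ?absvalM ?rmorphD ?absvalD //.
split=> [/eqP|->]; last by rewrite rmorph0 absval0.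
by rewrite absval_eq0 fmorph_eq0 => /eqP.
Qed.
End Absval.

(* The places of the rationals are indexed by [0] (the archimedean one) and the
   prime numbers, and [valof q] describes an extension to [algC] of the place
   of index [q]. *)
Definition uabs (R : realType) (q : nat) : rat -> R :=
  if q == 0%N then fun x => ratr `|x| else padic_abs R q.

(** Constant of the inequality w (x + y) <= kappa max (w x, w y), which treats archimedean and
    ultrametric places alike. Its product over all places is 2. *)
Definition kappa (R : realType) (q : nat) : R := if q == 0%N then 2 else 1.

Definition is_pl (q : nat) : bool := (q == 0%N) || prime q.

Definition valof (R : realType) (q : nat) (w : algC -> R) : Prop :=
  [/\ absval w, forall x y, w (x + y) <= kappa R q * Num.max (w x) (w y) &
      forall c : rat, w (ratr c) = uabs R q c].

(** * Absolute values of the rational numbers and their product formula *)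

Section PadicRat.
Variables (R : realType) (p : nat).
Hypothesis pp : prime p.

Let p0 : (p%:R : R) != 0. Proof. by rewrite pnatr_eq0 -lt0n prime_gt0. Qed.
Let p_gt0 : 0 < (p%:R : R). Proof. by rewrite ltr0n prime_gt0. Qed.
Let p_gt1 : 1 < (p%:R : R). Proof. by rewrite ltr1n prime_gt1. Qed.

Lemma padic_abs_int (z : int) : z != 0 ->
  padic_abs R p z%:~R = (p%:R ^+ logn p `|z|%N)^-1.
Proof.
move=> z0; rewrite /padic_abs intr_eq0 (negbTE z0).
by rewrite denq_int numq_int absz1 logn1 expr0 div1r.
Qed.

Lemma padic_abs_nat (n : nat) : (0 < n)%N ->
  padic_abs R p n%:R = (p%:R ^+ logn p n)^-1.
Proof.
move=> n0; rewrite (_ : n%:R = (n%:Z)%:~R); last by rewrite -pmulrn.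
by rewrite padic_abs_int // ?absz_nat // eqz_nat -lt0n.
Qed.

Lemma padic_abs_p : padic_abs R p p%:R = p%:R^-1.
Proof. by rewrite padic_abs_nat ?prime_gt0 // logn_prime // eqxx expr1. Qed.

Lemma padic_abs_int_le1 (z : int) : padic_abs R p z%:~R <= 1.
Proof.
have [->|z0] := eqVneq z 0; first by rewrite /padic_abs eqxx.
by rewrite padic_abs_int // invf_le1 ?exprn_gt0 // exprn_ege1 // ltW.
Qed.

Lemma padic_abs_int_lt1 (z : int) : (padic_abs R p z%:~R < 1) = (p %| `|z|)%N.
Proof.
have [->|z0] := eqVneq z 0; first by rewrite /padic_abs eqxx ltr01 dvdn0.
rewrite padic_abs_int // invf_lt1 ?exprn_gt0 //.
have := pfactor_dvdn 1 pp; rewrite expn1 => ->; last by rewrite absz_gt0.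
case: (logn p `|z|%N) => [|k]; first by rewrite expr0 ltxx.
by rewrite exprn_egt1.
Qed.

Lemma padic_abs_pow (c : rat) : c != 0 -> exists z : int, padic_abs R p c = p%:R ^ z.
Proof.
move=> c0; exists ((logn p `|denq c|%N)%:Z - (logn p `|numq c|%N)%:Z).
by rewrite expfzDr ?p0 // -invr_expz -!exprnP /padic_abs (negbTE c0).
Qed.
End PadicRat.

Lemma nat_prod_primes (n B : nat) : (0 < n)%N -> (n < B)%N ->
  n = (\prod_(0 <= q < B | prime q) q ^ logn q n)%N.
Proof.
move=> n0 nB; rewrite -{1}(partnT n0) /partn.
have h q : (n < q)%N -> (q ^ logn q n = 1)%N.
  move=> nq; rewrite lognE; case: ifP => // /and3P[_ _ /dvdn_leq].
  by move=> /(_ n0); rewrite leqNgt nq.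
rewrite [in RHS](big_cat_nat (n := n.+1)) //=.
rewrite [X in (_ * X)%N]big1_seq ?muln1; last first.
  by move=> q; rewrite mem_index_iota => /andP[_ /andP[/h]].
rewrite big_mkcond [in RHS]big_mkcond /=; apply: eq_bigr => q _.
by case: ifP => // /negbT pq; rewrite lognE (negbTE pq).
Qed.

(** The cut-off [B] makes the product finite: primes from [B] on divide neither the numerator nor
    the denominator of [c]. *)
Lemma product_formula (R : realType) (c : rat) (B : nat) : c != 0 ->
  (`|numq c| < B)%N -> (`|denq c| < B)%N ->
  uabs R 0 c * \prod_(0 <= q < B | prime q) uabs R q c = 1.
Proof.
move=> c0 nB dB.
have n0 : (0 < `|numq c|)%N by rewrite absz_gt0 numq_eq0.
have d0 : (0 < `|denq c|)%N by rewrite absz_gt0 denq_eq0.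
have -> : \prod_(0 <= q < B | prime q) uabs R q c =
   `|denq c|%N%:R / `|numq c|%N%:R.
  rewrite {1}(nat_prod_primes d0 dB) {1}(nat_prod_primes n0 nB) !natr_prod.
  rewrite -prodf_div; apply: eq_bigr => q qp.
  by rewrite /uabs -[q == 0%N]negbK -lt0n prime_gt0 //= /padic_abs (negbTE c0) !natrX.
rewrite /uabs eqxx -[in ratr _](divq_num_den c) normrM normfV -!intr_norm.
rewrite -!abszE fmorph_div /= !ratr_int -!pmulrn.
rewrite mulrA mulfVK ?pnatr_eq0 -?lt0n // divff // pnatr_eq0 -lt0n //.
Qed.

(** * Extension of the archimedean absolute value to [algC] *)

Section ArchAbs.
Variable R : realType.

(** The norm of [algC] takes its values in [algC], whereas [R] is an arbitrary real field. Both
    contain the rationals, so a nonnegative [a] is transported to [R] by its rational cut. *)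
Let below (a : algC) : set R := [set ratr q | q in [set q : rat | ratr q <= a]].
Let s (a : algC) : R := sup (below a).

Let s_ge (a : algC) (q : rat) : 0 <= a -> ratr q <= a -> ratr q <= s a.
Proof.
move=> a0 qa; apply: ub_le_sup; last by exists q.
exists (ratr (Num.bound a)%:R) => _ [r /= ra <-].
rewrite ler_rat -(ler_rat algC) ratr_nat (le_trans ra) // ltW //.
by apply: le_lt_trans (archi_boundP a0).
Qed.

Let s_le (a : algC) (q : rat) : 0 <= a -> a <= ratr q -> s a <= ratr q.
Proof.
move=> a0 aq; apply: ge_sup; first by exists (ratr 0), 0 => //=; rewrite rmorph0.
by move=> _ [r /= ra <-]; rewrite ler_rat -(ler_rat algC) (le_trans ra).
Qed.

Let lt_s (a : algC) (q : rat) : 0 <= a -> ratr q < s a -> ratr q <= a.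
Proof.
move=> a0 h; have : (ratr q : algC) \is Num.real by rewrite realE ler0q lerq0 le_total.
move/real_leP => /(_ _ (ger0_real a0)) [//|/ltW/(s_le a0)].
by rewrite leNgt h.
Qed.

Let s_lt (a : algC) (q : rat) : 0 <= a -> s a < ratr q -> a <= ratr q.
Proof.
move=> a0 h; have : (ratr q : algC) \is Num.real by rewrite realE ler0q lerq0 le_total.
move/real_leP => /(_ _ (ger0_real a0)) [/(s_ge a0)|/ltW//].
by rewrite leNgt h.
Qed.

Let s_ge0 (a : algC) : 0 <= a -> 0 <= s a.
Proof. by move=> a0; rewrite -(rmorph0 (@ratr R)); apply: s_ge => //; rewrite rmorph0. Qed.

Let s_uniq (a : algC) (t : R) : 0 <= a ->
  (forall q, ratr q < t -> ratr q <= a) -> (forall q, t < ratr q -> a <= ratr q) ->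
  s a = t.
Proof.
move=> a0 h1 h2; apply/eqP; rewrite eq_le !leNgt; apply/andP; split; apply/negP.
  move=> /rat_in_itvoo[q]; rewrite in_itv /= => /andP[/h2/(s_le a0) h].
  by rewrite ltNge h.
move=> /rat_in_itvoo[q]; rewrite in_itv /= => /andP[h /h1/(s_ge a0)].
by rewrite leNgt h.
Qed.

Let sM (a b : algC) : 0 <= a -> 0 <= b -> s (a * b) = s a * s b.
Proof.
move=> a0 b0; have ab0 : 0 <= a * b by rewrite mulr_ge0.
apply: s_uniq => // q h.
  have [q0|q0] := leP q 0; first by rewrite (le_trans _ ab0) // lerq0.
  have sb0 : 0 < s b.
    rewrite lt_def s_ge0 // andbT; apply: contraTneq h => ->.
    by rewrite mulr0 -leNgt ler0q ltW.
  move: h; rewrite -ltr_pdivrMr // => /rat_in_itvoo[r]; rewrite in_itv /= => /andP[r1 r2].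
  have r0 : 0 < r.
    by rewrite -(ltr0q R); apply: le_lt_trans r1; rewrite divr_ge0 ?ler0q ?ltW.
  have -> : q = r * (q / r) by rewrite mulrCA divff ?mulr1 // gt_eqF.
  have qr0 : 0 <= q / r by rewrite divr_ge0 // ltW.
  rewrite rmorphM ler_pM ?ler0q ?(ltW r0) //; first exact: lt_s.
  apply: lt_s => //.
  by rewrite fmorph_div /= ltr_pdivrMr ?ltr0q // mulrC -ltr_pdivrMr.
(* The gap between [ratr q] and [s a * s b], divided by [s b + 1], leaves room for a rational [r]
   above [s a] with [q / r] still above [s b]. The summand 1 allows [s b = 0]. *)
have sb1 : 0 < s b + 1 by rewrite ltr_wpDl ?s_ge0.
have : s a < s a + (ratr q - s a * s b) / (s b + 1).
  by rewrite ltrDl divr_gt0 // subr_gt0.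
move=> /rat_in_itvoo[r]; rewrite in_itv /= => /andP[r1 r2].
have r0 : 0 < r by rewrite -(ltr0q R) (le_lt_trans _ r1) // s_ge0.
have -> : q = r * (q / r) by rewrite mulrCA divff ?mulr1 // gt_eqF.
rewrite rmorphM ler_pM //; apply: s_lt => //.
rewrite fmorph_div /= ltr_pdivlMr ?ltr0q // mulrC.
have [sb0|sb0] := eqVneq (s b) 0; first by move: h; rewrite sb0 !mulr0.
have {}sb0 : 0 < s b by rewrite lt_def sb0 s_ge0.
have := ltr_pM2r sb0 (ratr r) (s a + (ratr q - s a * s b) / (s b + 1)).
rewrite r2 => /lt_le_trans; apply; rewrite mulrDl -lerBrDl -mulrA ler_piMr //.
  by rewrite subr_ge0 ltW.
by rewrite mulrC ler_pdivrMr // mul1r lerDl.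
Qed.

Let sD (a b c : algC) : 0 <= a -> 0 <= b -> 0 <= c -> c <= a + b -> s c <= s a + s b.
Proof.
move=> a0 b0 c0 cab; rewrite leNgt; apply/negP => /rat_in_itvoo[q].
rewrite in_itv /= => /andP[q1 q2].
have : s a < ratr q - s b by rewrite ltrBrDr.
move=> /rat_in_itvoo[r]; rewrite in_itv /= => /andP[r1 r2].
have h : a + b <= ratr q.
  rewrite -[q](subrK r) addrC rmorphD lerD //=; apply: s_lt => //.
  by rewrite rmorphB /= ltrBrDr addrC -ltrBrDr.
by move: q2; rewrite ltNge s_le // (le_trans cab).
Qed.

Lemma arch_abs_exists : exists w, valof (R := R) 0 w.
Proof.
exists (fun x => s `|x|).
have wD (x y : algC) : s `|x + y| <= s `|x| + s `|y| by rewrite sD ?ler_normD.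
split=> [|x y|c]; first split=> [x|x|x y|//].
- exact: s_ge0.
- split=> [h|->]; last first.
    apply/eqP; rewrite normr0 eq_le s_ge0 // andbT -(rmorph0 (@ratr R)).
    by apply: s_le => //; rewrite rmorph0.
  apply/eqP; apply: contraTT isT => x0.
  have : 0 <= `|x|^-1 by rewrite invr_ge0.
  move=> /archi_boundP h1; set n := Num.bound _ in h1.
  have n0 : 0 < (n%:R : algC) by apply: le_lt_trans h1; rewrite invr_ge0.
  have : (ratr (n%:R^-1) : R) <= s `|x|.
    apply: s_ge => //; rewrite fmorphV /= ratr_nat ltW //.
    by rewrite -[X in _ < X]invrK ltf_pV2 // posrE // invr_gt0 normr_gt0.
  by rewrite h fmorphV /= ratr_nat leNgt invr_gt0 ltr0n -(ltr0n algC) n0.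
- by rewrite normrM sM.
- rewrite /kappa eqxx (le_trans (wD x y)) // mulr_natl mulr2n.
  by rewrite lerD // le_max lexx ?orbT.
- rewrite /uabs eqxx (_ : `|ratr c| = ratr `|c|); last by rewrite -ratr_norm.
  apply/eqP; rewrite eq_le s_le ?s_ge ?ler0q //.
Qed.
End ArchAbs.

(** * Subfields of [algC] *)

Section Subfield.
Variable E : set algC.
Hypothesis sE : subfield E.
Lemma subfield1 : E 1.
Proof. by case: sE => h _ _; apply: set_mem. Qed.
Lemma subfieldB x y : E x -> E y -> E (x - y).
Proof.
case: sE => _ h _ Ex Ey; apply: set_mem.
by apply: (h x y); rewrite inE.
Qed.
Lemma subfield_div x y : E x -> E y -> E (x / y).
Proof.
case: sE => _ _ h Ex Ey; apply: set_mem.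
by apply: (h x y); rewrite inE.
Qed.
Lemma subfield0 : E 0.
Proof. by rewrite -(subrr 1); apply: subfieldB; apply: subfield1. Qed.
Lemma subfieldN x : E x -> E (- x).
Proof. by rewrite -sub0r; apply: subfieldB subfield0. Qed.
Lemma subfieldD x y : E x -> E y -> E (x + y).
Proof. by move=> Ex Ey; rewrite -[y]opprK; apply: subfieldB Ex (subfieldN Ey). Qed.
Lemma subfieldV x : E x -> E x^-1.
Proof. by rewrite -div1r; apply: subfield_div subfield1. Qed.
Lemma subfieldM x y : E x -> E y -> E (x * y).
Proof. by move=> Ex Ey; rewrite -[y]invrK; apply: subfield_div Ex (subfieldV Ey). Qed.
Lemma subfieldX x n : E x -> E (x ^+ n).
Proof.
move=> Ex; elim: n => [|n IH]; first by rewrite expr0; apply: subfield1.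
by rewrite exprS; apply: subfieldM.
Qed.
Lemma subfield_sum I (r : seq I) (P : pred I) (f : I -> algC) :
  (forall i, P i -> E (f i)) -> E (\sum_(i <- r | P i) f i).
Proof. by move=> h; elim/big_ind: _ => //; [exact: subfield0|exact: subfieldD]. Qed.
Lemma subfield_nat n : E n%:R.
Proof.
elim: n => [|n IH]; first exact: subfield0.
by rewrite -natr1; apply: subfieldD subfield1.
Qed.
Lemma subfield_int n : E n%:~R.
Proof. by case: n => n; rewrite ?NegzE ?mulrNz -?pmulrn; [|apply: subfieldN]; apply: subfield_nat. Qed.
Lemma subfield_rat q : E (ratr q).
Proof. by apply: subfield_div; apply: subfield_int. Qed.
Lemma subfield_horner (f : {poly algC}) x : E x -> (forall i, E f`_i) -> E f.[x].
Proof.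
move=> Ex Ef; rewrite horner_coef; apply: subfield_sum => i _.
by apply: subfieldM => //; apply: subfieldX.
Qed.
End Subfield.

Lemma subfieldP (E : set algC) : E 1 -> (forall x y, E x -> E y -> E (x - y)) ->
  (forall x y, E x -> E y -> E (x / y)) -> subfield E.
Proof.
move=> h1 h2 h3; split=> [|x y|x y]; rewrite !inE => *; first exact: h1.
  exact: h2.
exact: h3.
Qed.

Lemma subfield_bigcap (D : set (set algC)) :
  (forall E, D E -> subfield E) -> subfield (\bigcap_(E in D) E)%classic.
Proof.
move=> h; apply: subfieldP => [E DE|x y Ex Ey E DE|x y Ex Ey E DE].
- exact: subfield1 (h _ DE).
- by apply: (subfieldB (h _ DE)); [exact: Ex|exact: Ey].
- by apply: (subfield_div (h _ DE)); [exact: Ex|exact: Ey].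
Qed.

Lemma subfield_smallest (S : set algC) : subfield (smallest subfield S).
Proof. by apply: subfield_bigcap => E []. Qed.

(** * Extension of the p-adic absolute values to [algC] *)

Notation ZtoC := (map_poly (intr : int -> algC)).

Lemma AintP x : reflect (integralOver (intr : int -> algC) x) (x \in Aint).
Proof.
apply: (iffP idP) => [h|[p mp px]].
  have [q Dq] := floorpP h.
  exists q; last by rewrite -Dq root_minCpoly.
  have := minCpoly_monic x; rewrite Dq !monicE lead_coef_map_inj //; last exact: intr_inj.
  by move/eqP => h1; apply/eqP; apply: (@intr_inj algC).
apply: (root_monic_Aint px); first exact: monic_map.
by apply/polyOverP => i; rewrite coef_map /= intr_int.
Qed.

(** The primitive part of the minimal polynomial, cleared of denominators, has content 1, so no
    prime divides all its coefficients. *)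
Lemma int_poly_root_prim (p : nat) (y : algC) : prime p ->
  exists2 f : {poly int}, root (ZtoC f) y & exists j, ~~ (p %| absz (f`_j)%R)%N.
Proof.
move=> pp; have [q [Dq mq] _] := minCpolyP y.
have [g [a a0 Dg]] := rat_poly_scale q.
have q0 : q != 0 := monic_neq0 mq.
have g0 : g != 0 by apply: contra_neq q0 => g0; rewrite Dg g0 rmorph0 scaler0.
have rg : root (ZtoC g) y.
  have := root_minCpoly y; rewrite Dq Dg linearZ /= rootZ ?fmorph_eq0 ?invr_eq0 ?intr_eq0 //.
  rewrite -map_poly_comp; congr (root _ y); apply: eq_map_poly => c /=.
  by rewrite ratr_int.
exists (zprimitive g).
  move: rg; rewrite {1}(zpolyEprim g) linearZ /= rootZ // intr_eq0 zcontents_eq0 //.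
apply: contrapT => h; have : (p%:Z %| zcontents (zprimitive g))%Z.
  rewrite dvdz_contents; apply/polyOverP => j; rewrite unfold_in /=.
  by apply: contrapT => /negP hj; apply: h; exists j.
by rewrite zcontents_primitive g0 dvdz1 /= eqn_leq leqNgt prime_gt1.
Qed.

(** With c the coefficient of index n, multiplying the equation of y by c ^ (n - 1) turns it into a
    monic equation for c y. Nothing is divided by c, which may vanish. *)
Lemma Aint_lead_mul (f : {poly algC}) n (y : algC) :
  (forall i, f`_i \in Aint) -> (size f <= n.+1)%N -> f.[y] = 0 -> f`_n * y \in Aint.
Proof.
move=> fA sf fy; case: n sf => [|n] sf.
  by have := size1_polyC sf => Df; move: fy; rewrite Df hornerC coefC /= => ->; rewrite mul0r Aint0.
set c := f`_n.+1.
pose g := ('X^(n.+1) + \poly_(i < n.+1) (f`_i * c ^+ (n - i)))%R : {poly algC}.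
have szg : (size (\poly_(i < n.+1) (f`_i * c ^+ (n - i)))%R < size ('X^(n.+1) : {poly algC})%R)%N.
  by rewrite size_polyXn ltnS size_poly.
have mg : g \is monic by rewrite monicE lead_coefDl // lead_coefXn.
apply/AintP; apply: (integral_root_monic mg).
  rewrite /root /g hornerD hornerXn horner_poly.
  have : c ^+ n * f.[y] = 0 by rewrite fy mulr0.
  rewrite (horner_coef_wide _ sf) big_ord_recr /= -/c mulrDr mulr_sumr addrC => key.
  apply/eqP; rewrite -[RHS]key; congr (_ + _); first by rewrite exprMn mulrA -exprSr.
  apply: eq_bigr => i _; have -> : c ^+ n = c ^+ (n - i) * c ^+ i.
    by rewrite -exprD subnK // -ltnS.
  by rewrite exprMn; ring.
move=> _ /(nthP 0)[i _ <-]; apply/AintP; rewrite /g coefD coefXn coef_poly.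
apply: rpredD; first by case: eqP; rewrite ?Aint1 ?Aint0.
by case: ifP => _; rewrite ?Aint0 //; apply: rpredM; [|apply: rpredX]; apply: fA.
Qed.

(* The quotients [b i] of the Horner scheme, at [y], of an integral polynomial
   vanishing at [y] are integral, and so are the [y * b i]. *)
Lemma prufer (p : nat) (E : set algC) (P : algC -> Prop) (y : algC) : prime p ->
  subfield E -> E y ->
  (forall a b, a \in Aint -> b \in Aint -> P a -> P b -> P (a - b)) ->
  (forall n : int, P n%:~R -> (p %| `|n|)%N) ->
  exists s, [/\ E s, s \in Aint, y * s \in Aint & ~ P s \/ ~ P (y * s)].
Proof.
move=> pp sE Ey PB Pp; have [f fy [j fj]] := int_poly_root_prim y pp.
pose b i := (ZtoC (drop_poly i f)).[y].
have bE i : b i = (f`_i)%:~R + y * b i.+1.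
  rewrite /b; have -> : drop_poly i f = (f`_i)%:P + 'X * drop_poly i.+1 f.
    apply/polyP => k; rewrite coefD coefC coefXM !coef_drop_poly.
    by case: k => [|k]; rewrite ?addr0 //= add0r addSnnS.
  by rewrite rmorphD rmorphM /= map_polyC map_polyX hornerD hornerC hornerM hornerX.
have bA i : (b i.+1 \in Aint) && (y * b i.+1 \in Aint).
  have [k] := ubnP (size f - i); elim: k => // k IH in i *; move=> hk.
  have bi : b i.+1 \in Aint.
    rewrite bE rpredD ?Aint_int //.
    have [si|si] := leqP (size f) i; last by have /andP[] := IH i.+1 ltac:(by rewrite subnS; lia).
    suff -> : b i.+2 = 0 by rewrite mulr0 Aint0.
    by rewrite /b drop_poly_eq0 ?rmorph0 ?horner0 //; lia.
  rewrite bi /= mulrC.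
  (* Evaluating the part of [f] above degree [i] at [y] leaves a polynomial of degree at most i + 1
     that still vanishes at [y] and has [b i.+1] as top coefficient; [Aint_lead_mul] applies to
     it. *)
  pose g := (ZtoC (take_poly i.+1 f) + b i.+1 *: 'X^(i.+1))%R.
  have -> : b i.+1 = g`_i.+1.
    by rewrite coefD coef_map /= coef_take_poly ltnn rmorph0 add0r coefZ coefXn eqxx mulr1.
  apply: Aint_lead_mul.
  - move=> l; rewrite coefD coef_map /= coefZ coefXn rpredD ?Aint_int //.
    by case: eqP; rewrite ?mulr1 ?mulr0 ?Aint0.
  - rewrite (leq_trans (size_polyD _ _)) // geq_max; apply/andP; split.
      rewrite (leq_trans (size_poly _ _)) // (leq_trans (size_take_poly _ _)) //.
    by rewrite (leq_trans (size_scale_leq _ _)) // size_polyXn.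
  - move: fy; rewrite -{1}(poly_take_drop i.+1 f) rmorphD rmorphM /= map_polyXn /root.
    by rewrite hornerD hornerM /g hornerD hornerZ => /eqP.
have Eb i : E (b i).
  by apply: (subfield_horner sE) => // k; rewrite coef_map /=; apply: subfield_int.
apply: contrapT => no.
(* If no quotient satisfies the conclusion, all of them lie in [P], and the recursion [bE] puts
   every coefficient of [f] in [P], including the one prime to [p]. *)
have allP i : P (b i.+1) /\ P (y * b i.+1).
  have /andP[h1 h2] := bA i.
  apply: contrapT => /not_andP h; apply: no; exists (b i.+1); split=> //.
case: j fj => [|j] fj.
  have b0 : b 0%N = 0.
    by rewrite /b (_ : drop_poly 0 f = f) //; [apply/eqP|rewrite drop_poly0l].
  (* Only closure under subtraction is available, so the opposite of [y * b 1] is reached as (a - a)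
     - a. *)
  have : P ((f`_0)%:~R).
    have -> : (f`_0)%:~R = (y * b 1%N - y * b 1%N) - y * b 1%N.
      by rewrite subrr sub0r; apply/eqP; rewrite -addr_eq0 -bE b0.
    have /andP[_ h2] := bA 0%N; have [_ h3] := allP 0%N.
    by apply: (PB) => //; [rewrite subrr Aint0|apply: PB].
  by move/Pp; apply/negP.
have : P ((f`_j.+1)%:~R).
  have -> : (f`_j.+1)%:~R = b j.+1 - y * b j.+2 by rewrite (bE j.+1) addrK.
  have /andP[h1 _] := bA j; have /andP[_ h2] := bA j.+1.
  by apply: PB => //; [case: (allP j)|case: (allP j.+1)].
by move/Pp; apply/negP.
Qed.

Definition Aset : set algC := [set x | x \in Aint].

(** Zorn's lemma gives an ideal that is maximal among those containing p but not 1, and such an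
    ideal is prime. Working in the ring of all algebraic integers extends the place to [algC] in one
    stroke. *)
Lemma prime_ideal_over (p : nat) : prime p ->
  exists2 P, prime_ideal Aset P & P p%:R.
Proof.
move=> pp.
pose good X := [/\ is_ideal Aset X, X p%:R & ~ X 1].
have [F FP Ftot|P [PQ Pmax]] := @Zorn_bigcup algC [set X | X = set0 \/ good X].
  have [none|/existsNP[X0 /not_implyP[FX0 X0n]]] := pselect (forall X, F X -> X = set0).
    by left; apply/seteqP; split=> // x [X /none ->].
  have gd X x : F X -> X x -> good X.
    by move=> FX Xx; case: (FP X FX) => // Xe; move: Xx; rewrite Xe.
  have [x0 X0x0] : X0 !=set0 by apply/set0P/eqP.
  have [[X0A X00 _ _] X0p _] := gd _ _ FX0 X0x0.
  right; split; first split.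
  - by move=> x [X FX Xx]; case: (gd X x FX Xx) => [[h _ _ _] _ _]; apply: h.
  - by exists X0.
  - move=> x y [X FX Xx] [Y FY Yy].
    case: (Ftot X Y FX FY) => h.
      by exists Y => //; case: (gd Y y FY Yy) => [[_ _ hD _] _ _]; apply: hD => //; apply: h.
    by exists X => //; case: (gd X x FX Xx) => [[_ _ hD _] _ _]; apply: hD => //; apply: h.
  - move=> a x Aa [X FX Xx]; exists X => //.
    by case: (gd X x FX Xx) => [[_ _ _ hM] _ _]; apply: hM.
  - by exists X0.
  - by move=> [X FX X1]; case: (gd X 1 FX X1).
have gP : good P.
  (* A maximal element cannot be empty: the multiples of p form a larger member, proper because 1 /
     p is not integral. *)
  case: PQ => // P0; exfalso.
  pose pA : set algC := [set p%:R * a | a in Aset].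
  have gpA : good pA.
    split; first split.
    - by move=> _ [a Aa <-]; rewrite /Aset /= rpredM // Aint_Cnat // natr_nat.
    - by exists 0; rewrite ?mulr0 //=; apply: Aint0.
    - by move=> _ _ [a Aa <-] [b Ab <-]; exists (a + b); rewrite ?mulrDr //=; apply: rpredD.
    - by move=> c _ Ac [a Aa <-]; exists (c * a); rewrite 1?mulrCA //=; apply: rpredM.
    - by exists 1; rewrite ?mulr1 //; apply: Aint1.
    - move=> [a Aa pa]; have Da : a = p%:R^-1.
        by rewrite -[a]mul1r -[in LHS](mulVf (_ : p%:R != 0 :> algC)) -?mulrA ?pa ?mulr1 // pnatr_eq0 -lt0n prime_gt0.
      have : a \in Num.int.
        by apply: Cint_rat_Aint => //; rewrite Da rpredV rpred_nat.
      case/intrP => z Dz; move: pa; rewrite Dz.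
      rewrite (_ : p%:R = (p%:Z)%:~R :> algC) -?intrM; last by rewrite -pmulrn.
      move=> /(@intr_inj algC _ 1) /(congr1 absz); rewrite abszM /= => /eqP.
      by rewrite muln_eq1 => /andP[/eqP p1]; rewrite p1 in pp.
  have /Pmax : P `<` pA.
    rewrite P0 properEneq; split; last exact: sub0set.
    by rewrite eq_sym; apply/set0P; exists 0; case: gpA => [[]].
  by apply; right.
exists P; last by case: gP.
case: (gP) => iP Pp P1; split=> // a b Aa Ab Pab.
have [Pa|nPa] := pselect (P a); [by left|right].
case: (iP) => PA P0 PD PM.
pose J : set algC := [set x | exists m t, [/\ P m, Aset t & x = m + a * t]].
have PJ : P `<` J.
  rewrite properEneq; split.
    apply/eqP => PJ; apply: nPa; rewrite PJ; exists 0, 1; rewrite add0r mulr1; split=> //.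
    exact: Aint1.
  by move=> x Px; exists x, 0; rewrite mulr0 addr0; split=> //; apply: Aint0.
have J1 : J 1.
  apply: contrapT => nJ1; apply: (Pmax J PJ); right; split=> //; last by apply: (properW PJ).
  split; last 2 first.
  - move=> _ _ [m [t [Pm At ->]]] [m' [t' [Pm' At' ->]]].
    exists (m + m'), (t + t'); split; [exact: PD|exact: rpredD|by ring].
  - move=> c _ Ac [m [t [Pm At ->]]].
    exists (c * m), (c * t); split; [exact: PM|exact: rpredM|by ring].
  - move=> _ [m [t [Pm At ->]]]; apply: rpredD; last exact: rpredM.
    exact: PA.
  - by apply: (properW PJ).
have [m [t [Pm At D1]]] := J1.
have -> : b = b * m + t * (a * b) by rewrite -[LHS]mulr1 D1; ring.
by apply: PD; apply: PM.
Qed.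

Section ValuationFromPrime.
Variables (R : realType) (p : nat) (P : set algC).
Hypotheses (pp : prime p) (primeP : prime_ideal Aset P) (Pp : P p%:R).

Let P0 : P 0. Proof. by case: primeP => [[]]. Qed.
Let PD x y : P x -> P y -> P (x + y). Proof. by case: primeP => [[_ _ h _] _ _]; apply: h. Qed.
Let PM a x : a \in Aint -> P x -> P (a * x).
Proof. by case: primeP => [[_ _ _ h] _ _]; apply: h. Qed.
Let PM' a x : P x -> a \in Aint -> P (x * a).
Proof. by move=> *; rewrite mulrC; apply: PM. Qed.
Let P1 : ~ P 1. Proof. by case: primeP. Qed.
Let Pprime x y : x \in Aint -> y \in Aint -> ~ P x -> ~ P y -> ~ P (x * y).
Proof.
by move=> Ax Ay nPx nPy h; case: primeP => _ _ /(_ x y Ax Ay h) [].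
Qed.
Let PN x : P x -> P (- x).
Proof. by move=> Px; rewrite -mulN1r; apply: PM => //; rewrite rpredN Aint1. Qed.

Let p0 : (p%:R : algC) != 0. Proof. by rewrite pnatr_eq0 -lt0n prime_gt0. Qed.

Let P_int (n : int) : P n%:~R -> (p %| `|n|)%N.
Proof.
move=> Pn; apply: contrapT => /negP; rewrite -prime_coprime // => cop.
have /coprimezP[[u v] /= uv] : coprimez p n by rewrite /coprimez /gcdz eqz_nat.
apply: P1; rewrite (_ : 1 = u%:~R * p%:R + v%:~R * n%:~R).
  by apply: PD; apply: PM => //; apply: Aint_int.
rewrite (_ : p%:R = p%:Z%:~R); last by rewrite -pmulrn.
by rewrite -!intrM -intrD uv.
Qed.

(** The localization of the algebraic integers at [P]; [U] is its unit group. It is shown to be a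
    valuation ring whose value group has rational rank one, which is what lets a real absolute value
    be read off from it. *)
Let V (x : algC) := exists a s, [/\ a \in Aint, s \in Aint, ~ P s & x = a / s].
Let U (x : algC) := [/\ x != 0, V x & V x^-1].

Let nP_neq0 s : ~ P s -> s != 0.
Proof. by move=> h; apply: contra_notN h => /eqP ->. Qed.

Let VA a : a \in Aint -> V a.
Proof. by move=> Aa; exists a, 1; rewrite divr1; split=> //; apply: Aint1. Qed.
Let VM x y : V x -> V y -> V (x * y).
Proof.
move=> [a [s [Aa As Ps ->]]] [b [t [Ab At Pt ->]]]; exists (a * b), (s * t).
by rewrite invfM; split; [exact: rpredM|exact: rpredM|exact: Pprime|ring].
Qed.
Let VX x n : V x -> V (x ^+ n).
Proof.
move=> Vx; elim: n => [|n IH]; first by rewrite expr0; apply: VA; apply: Aint1.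
by rewrite exprS; apply: VM.
Qed.
Let VD x y : V x -> V y -> V (x + y).
Proof.
move=> [a [s [Aa As Ps ->]]] [b [t [Ab At Pt ->]]]; exists (a * t + b * s), (s * t).
split; [by rewrite rpredD // rpredM|exact: rpredM|exact: Pprime|].
by field; rewrite !nP_neq0.
Qed.
(** [prufer] writes y as a quotient of two algebraic integers, one of which is outside P. *)
Let V_total y : y != 0 -> V y \/ V y^-1.
Proof.
move=> y0; have [//|//|||s [_ As Ays h]] := @prufer p setT P y pp.
- by apply: subfieldP.
- by move=> a b _ _ Pa Pb; apply: PD => //; apply: PN.
- exact: P_int.
case: h => h; [left; exists (y * s), s|right; exists s, (y * s)]; split=> //.
  by rewrite mulfK // nP_neq0.
have := nP_neq0 h; rewrite mulf_eq0 => /norP[_ s0].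
by rewrite invfM mulrCA divff ?mulr1.
Qed.

Let U1 : U 1. Proof. by split; rewrite ?invr1 ?oner_eq0 //; apply: VA; apply: Aint1. Qed.
Let UM x y : U x -> U y -> U (x * y).
Proof. by case=> [x0 Vx Wx] [y0 Vy Wy]; split; rewrite ?mulf_neq0 ?invfM //; apply: VM. Qed.
Let UV x : U x -> U x^-1.
Proof. by case=> [x0 Vx Wx]; split; rewrite ?invr_eq0 ?invrK. Qed.
Let UX x n : U x -> U (x ^+ n).
Proof. by move=> Ux; elim: n => [|n IH]; [rewrite expr0|rewrite exprS; apply: UM]. Qed.
Let UN1 : U (-1).
Proof. by split; rewrite ?invrN1 ?oppr_eq0 ?oner_eq0 //; apply: VA; rewrite rpredN Aint1. Qed.

Let nVpV : ~ V p%:R^-1.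
Proof.
move=> [a [s [Aa As Ps D]]]; have s0 := nP_neq0 Ps; apply: Ps.
have -> : s = p%:R * a; last exact: PM'.
transitivity (p%:R * p%:R^-1 * s); first by rewrite divff // mul1r.
by rewrite D -mulrA divfK.
Qed.

Let V_powp (k : int) : V (p%:R ^ k) -> 0 <= k.
Proof.
case: k => // k; rewrite NegzE -exprnN => Vk; exfalso; apply: nVpV.
have -> : p%:R^-1 = p%:R ^+ k * p%:R ^- k.+1 :> algC.
  by rewrite exprS invfM mulrCA divff ?mulr1 // expf_neq0.
by apply: VM => //; apply/VX/VA; apply: Aint_Cnat; apply: natr_nat.
Qed.

Let U_int (n : int) : n != 0 -> U (n%:~R * p%:R ^ (- (logn p `|n|)%:Z)).
Proof.
move=> n0; have h : (0 < `|n|)%N by rewrite absz_gt0.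
have [m pm Dm] := pfactor_coprime pp h.
have Dn : n%:~R = (-1) ^+ (n < 0)%R * (m%:R * p%:R ^+ logn p `|n|) :> algC.
  rewrite [in LHS](intEsign n) rmorphM rmorph_sign; congr (_ * _).
  by rewrite /= -pmulrn {1}Dm natrM natrX.
rewrite {}Dn -exprnN -!mulrA divff ?mulr1 ?expf_neq0 //.
apply: UM; first by apply: UX.
have Pm : ~ P m%:R.
  move=> Pm; have /P_int : P (m%:Z)%:~R by rewrite -pmulrn.
  by rewrite absz_nat; move: pm; rewrite prime_coprime // => /negP.
have m0 := nP_neq0 Pm.
split=> //; first by apply: VA; apply: Aint_Cnat; apply: natr_nat.
exists 1, m%:R; rewrite div1r; split=> //.
by apply: Aint_Cnat; apply: natr_nat.
Qed.

Let max_term (I : eqType) (s : seq I) (t : I -> algC) : s != [::] ->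
  (forall i, i \in s -> t i != 0) ->
  exists2 i, i \in s & forall j, j \in s -> V (t j / t i).
Proof.
elim: s => // x s IH _ h.
have x0 : t x != 0 by apply: h; rewrite mem_head.
have Vx : V (t x / t x) by rewrite divff //; apply: VA; apply: Aint1.
have [s0|sN] := eqVneq s [::].
  by exists x; rewrite ?mem_head // => j; rewrite s0 inE => /eqP ->.
have [|i si Hi] := IH sN; first by move=> i si; apply: h; rewrite inE si orbT.
have i0 : t i != 0 by apply: h; rewrite inE si orbT.
have [|Vi|Vi] := @V_total (t x / t i); first by rewrite mulf_neq0 ?invr_eq0.
  exists i; first by rewrite inE si orbT.
  by move=> j; rewrite inE => /predU1P[->//|]; apply: Hi.
exists x; first by rewrite mem_head.
move=> j; rewrite inE => /predU1P[->//|/Hi Vj].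
have -> : t j / t x = (t j / t i) * (t x / t i)^-1.
  by rewrite invf_div mulrA divfK.
exact: VM.
Qed.

Let nonunit x := exists a s, [/\ P a, s \in Aint, ~ P s & x = a / s].
Let nonunitD x y : nonunit x -> nonunit y -> nonunit (x + y).
Proof.
move=> [a [s [Pa As Ps ->]]] [b [t [Pb At Pt ->]]]; exists (a * t + b * s), (s * t).
split; [by apply: PD; apply: PM'|exact: rpredM|exact: Pprime|].
by field; rewrite !nP_neq0.
Qed.
Let nonunitP x : V x -> ~ U x -> nonunit x.
Proof.
move=> Vx; move: (Vx) => [a [s [Aa As Ps D]]] nU; exists a, s; split=> //.
apply: contrapT => Pa; apply: nU; split=> //; last by exists s, a; rewrite D invf_div.
by rewrite D mulf_neq0 ?invr_eq0 ?nP_neq0.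
Qed.
Let nonunit1 : ~ nonunit (-1).
Proof.
move=> [a [s [Pa As Ps D]]]; have s0 := nP_neq0 Ps; apply: Ps; have -> : s = - a.
  by rewrite -[a](divfK s0) -D mulN1r opprK.
exact: PN.
Qed.

(** In an integral equation of x, at least two terms must share the dominant value. Their quotient
    is a unit, and integers are units up to powers of p, so some power of x is a unit up to a power
    of p. *)
Let unit_pow x : x != 0 -> exists b (z : int), (0 < b)%N /\ U (x ^+ b * p%:R ^ z).
Proof.
move=> x0; have [f fx [j fj]] := int_poly_root_prim x pp.
have f0 : f != 0 by apply: contraNneq fj => ->; rewrite coef0 absz0 dvdn0.
pose I := [seq i <- iota 0 (size f) | f`_i != 0].
pose t i : algC := (f`_i)%:~R * x ^+ i.
have It i : i \in I -> t i != 0.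
  by rewrite mem_filter => /andP[h _]; rewrite mulf_neq0 ?expf_neq0 // intr_eq0.
have IN : (size f).-1 \in I.
  rewrite mem_filter mem_iota /= add0n -/(lead_coef f) lead_coef_eq0 f0 /=.
  by rewrite prednK ?size_poly_gt0.
have sumI : \sum_(i <- I) t i = 0.
  rewrite big_filter; move: fx; rewrite /root horner_coef => /eqP fx; rewrite -[RHS]fx.
  rewrite size_map_inj_poly //; last exact: intr_inj.
  rewrite -(big_mkord xpredT (fun i => (map_poly intr f)`_i * x ^+ i)) /index_iota subn0.
  rewrite big_mkcond; apply: eq_bigr => i _; rewrite coef_map /=.
  by case: eqP => //= ->; rewrite mul0r.
have [|i Ii Hi] := @max_term _ I t _ It; first by case: (I) IN.
(* If the dominant term were alone, the quotients of the other terms by it would be nonunits with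
   sum -1, but -1 is not a nonunit. *)
have [i' [Ii' ii' Ui]] : exists i', [/\ i' \in I, i' != i & U (t i' / t i)].
  apply: contrapT => no; apply: nonunit1.
  have uI : uniq I by rewrite filter_uniq // iota_uniq.
  have : \sum_(i' <- I | i' != i) (t i' / t i) = -1.
    rewrite -mulr_suml; apply: (mulIf (It i Ii)); rewrite divfK ?It // mulN1r.
    by apply/eqP; rewrite -addr_eq0 addrC -(bigD1_seq i) //= sumI.
  move=> <-; rewrite big_seq_cond; elim/big_ind: _ => //.
    by exists 0, 1; rewrite mul0r; split=> //; apply: Aint1.
  move=> k /andP[Ik ki]; apply: nonunitP; first exact: Hi.
  by move=> Uk; apply: no; exists k.
have f1 : f`_i != 0 by move: Ii; rewrite mem_filter => /andP[].
have f2 : f`_i' != 0 by move: Ii'; rewrite mem_filter => /andP[].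
have [z Uz] : exists z : int, U (x ^ (i'%:Z - i%:Z) * p%:R ^ z).
  exists (- (- (logn p `|(f`_i')%R|)%:Z - - (logn p `|(f`_i)%R|)%:Z)).
  have := UM Ui (UM (UV (U_int f2)) (U_int f1)); congr U.
  rewrite opprB opprK !expfzDr // -!invr_expz /t -!exprnP.
  have aux (K : fieldType) (a b c e g h : K) : b != 0 -> c != 0 -> e != 0 ->
      g != 0 -> h != 0 -> c * a / (e * b) * ((c / g)^-1 * (e / h)) = a / b * (h^-1 * g).
    by move=> b0 c0 e0 g0 h0; field; rewrite ?b0 ?c0 ?e0 ?g0 ?h0.
  by apply: aux; rewrite ?expf_neq0 ?intr_eq0.
have [lt|lt|eq] := ltngtP i i'; last by rewrite eq eqxx in ii'.
  exists (i' - i)%N, z; rewrite subn_gt0 lt; split=> //.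
  by move: Uz; rewrite subzn ?(ltnW lt).
exists (i - i')%N, (- z); rewrite subn_gt0 lt; split=> //.
move: (UV Uz); rewrite invfM -[i'%:Z - _]opprB subzn ?(ltnW lt) // -!invr_expz invrK.
by rewrite -exprnP.
Qed.

Let pR0 : (p%:R : R) != 0. Proof. by rewrite pnatr_eq0 -lt0n prime_gt0. Qed.
Let pR_gt0 : 0 < (p%:R : R). Proof. by rewrite ltr0n prime_gt0. Qed.
Let pR_gt1 : 1 < (p%:R : R). Proof. by rewrite ltr1n prime_gt1. Qed.

Let zX (K : fieldType) (x : K) (z : int) (n : nat) : (x ^ z) ^+ n = x ^ (z * n%:Z).
Proof. by rewrite exprnP exprz_exp. Qed.

(* [w x] is the positive real whose [b]-th power is [p ^ z] when
   [x ^ b * p ^ z] is a unit of the localization of the integers at [P]. *)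
Lemma absval_from_prime : exists w, valof (R := R) p w.
Proof.
have ex_t (x : algC) : exists t : R, 0 <= t /\ (if x == 0 then t = 0 else
    exists b (z : int), [/\ (0 < b)%N, U (x ^+ b * p%:R ^ z) & t ^+ b = p%:R ^ z]).
  have [x0|x0] := eqVneq x 0; first by exists 0.
  have [b [z [b0 Ub]]] := unit_pow x0.
  exists ((p%:R ^ z) `^ b%:R^-1); split; first exact: powR_ge0.
  exists b, z; split=> //; rewrite -powR_mulrn ?powR_ge0 // -powRrM mulVf ?powRr1 //.
    by rewrite exprz_ge0 // ltW.
  by rewrite pnatr_eq0 -lt0n.
have [w wP] := choice ex_t.
have w_ge0 x : 0 <= w x by case: (wP x).
have w0 : w 0 = 0 by case: (wP 0) => _; rewrite eqxx.
(* Independence of the pair (b, z): two pairs for the same x make p to the difference of the cross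
   products a unit, and this difference is 0 because 1 / p is not in [V]. *)
have wE x b (z : int) : x != 0 -> (0 < b)%N -> U (x ^+ b * p%:R ^ z) -> w x ^+ b = p%:R ^ z.
  move=> x0 b0 Ub; case: (wP x) => _; rewrite (negbTE x0) => -[c [y [c0 Uc Dw]]].
  have e : z * c%:Z = y * b%:Z.
    have : U ((x ^+ b * p%:R ^ z) ^+ c * ((x ^+ c * p%:R ^ y) ^+ b)^-1).
      by apply: UM; [|apply: UV]; apply: UX.
    rewrite !exprMn -!exprM [(c * b)%N]mulnC invfM mulrACA divff ?expf_neq0 // mul1r.
    rewrite !zX => -[_]; rewrite invfM invrK => h1; rewrite mulrC => h2.
    have {}h1 : V (p%:R ^ (z * c%:Z - y * b%:Z)) by rewrite expfzDr // -invr_expz.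
    have {}h2 : V (p%:R ^ (y * b%:Z - z * c%:Z)).
      by rewrite expfzDr // -invr_expz.
    by apply/eqP; rewrite eq_le -subr_ge0 (V_powp h2) -subr_ge0 (V_powp h1).
  apply/eqP; rewrite -(eqrXn2 (n := c)) ?exprn_ge0 ?exprz_ge0 ?ler0n //.
  by rewrite exprAC Dw !zX e.
have w_neq0 x : x != 0 -> w x != 0.
  move=> x0; case: (wP x) => _; rewrite (negbTE x0) => -[b [z [b0 _ Dw]]].
  have := expfz_neq0 z pR0; rewrite -Dw; apply: contra_neq => ->.
  by rewrite expr0n gtn_eqF.
have wM x y : w (x * y) = w x * w y.
  have [->|x0] := eqVneq x 0; first by rewrite !(mul0r, w0).
  have [->|y0] := eqVneq y 0; first by rewrite !(mulr0, w0).
  have [b [z [b0 Ub]]] := unit_pow x0; have [c [u [c0 Uc]]] := unit_pow y0.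
  have bc0 : (0 < b * c)%N by rewrite muln_gt0 b0.
  apply/eqP; rewrite -(eqrXn2 bc0) ?mulr_ge0 //; apply/eqP.
  rewrite exprMn [w x ^+ _]exprM (wE _ _ _ x0 b0 Ub).
  rewrite [w y ^+ _](_ : _ = (w y ^+ c) ^+ b); last by rewrite mulnC exprM.
  rewrite (wE _ _ _ y0 c0 Uc) (wE (x * y) (b * c)%N (z * c%:Z + u * b%:Z)) ?mulf_neq0 //; last first.
    have := UM (UX c Ub) (UX b Uc); congr U.
    rewrite !exprMn -!exprM expfzDr // !zX [(c * b)%N]mulnC.
    by rewrite mulrACA.
  by rewrite expfzDr // !zX.
have wV x : V x -> w x <= 1.
  move=> Vx; have [->|x0] := eqVneq x 0; first by rewrite w0.
  have [b [z [b0 Ub]]] := unit_pow x0.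
  rewrite -(ler_pXn2r b0) ?nnegrE // expr1n (wE _ _ _ x0 b0 Ub).
  have : V (p%:R ^ (- z)).
    case: Ub => _ _ h; have := VM (VX b Vx) h.
    by rewrite invfM mulrA divff ?expf_neq0 // mul1r invr_expz.
  move/V_powp; rewrite oppr_ge0; case: z {Ub} => // [[]|] // n _.
  by rewrite NegzE -exprnN invf_le1 ?exprn_gt0 // exprn_ege1 // ltW.
have wD x y : w (x + y) <= Num.max (w x) (w y).
  (* By [V_total] one of the two quotients lies in [V]; factoring out the dominant element reduces
     the ultrametric inequality to w <= 1 on [V]. *)
  wlog Vxy : x y / y != 0 /\ V (x / y).
    move=> W; have [->|y0] := eqVneq y 0; first by rewrite addr0 le_max lexx.
    have [->|x0] := eqVneq x 0; first by rewrite add0r le_max lexx orbT.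
    have [|h|h] := @V_total (x / y); first by rewrite mulf_neq0 ?invr_eq0.
      exact: W.
    by rewrite addrC maxC; apply: W; rewrite -invf_div.
  have [y0 Vq] := Vxy; rewrite le_max; apply/orP; right.
  have -> : x + y = (x / y + 1) * y by rewrite mulrDl divfK // mul1r.
  by rewrite wM ler_piMl //; apply/wV/VD => //; apply/VA/Aint1.
have w1 : w 1 = 1.
  have h : w 1 != 0 by rewrite w_neq0 ?oner_eq0.
  by apply: (mulfI h); rewrite -wM !mulr1.
exists w; split=> [|x y|c]; first split=> //.
- move=> x; split=> [h|->//]; apply/eqP; apply: contraT => /w_neq0.
  by rewrite h eqxx.
- by move=> x y; apply: (le_trans (wD x y)); rewrite ge_max lerDl lerDr !w_ge0.
- by rewrite /kappa gtn_eqF ?prime_gt0 // mul1r.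
rewrite /uabs gtn_eqF ?prime_gt0 //.
have wint (n : int) : n != 0 -> w n%:~R = (p%:R ^+ logn p `|n|)^-1.
  move=> n0; rewrite -[LHS]expr1 (wE _ _ (- (logn p `|n|)%:Z)) ?intr_eq0 //.
    by rewrite -exprnN.
  by rewrite expr1; apply: U_int.
have [->|c0] := eqVneq c 0; first by rewrite rmorph0 w0 /padic_abs eqxx.
rewrite /padic_abs (negbTE c0) /ratr wM wint ?numq_eq0 // mulrC; congr (_ * _).
have d0 : (denq c)%:~R != 0 :> algC by rewrite intr_eq0 denq_eq0.
apply: (mulfI (w_neq0 _ d0)); rewrite -wM divff // w1 wint ?denq_eq0 //.
by rewrite mulVf // expf_neq0.
Qed.
End ValuationFromPrime.

Lemma valof_exists (R : realType) (q : nat) : is_pl q -> exists w, valof (R := R) q w.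
Proof.
case/orP => [/eqP ->|pq]; first exact: arch_abs_exists.
have [P primeP Pq] := prime_ideal_over pq.
exact: (absval_from_prime R pq primeP Pq).
Qed.

(** * Degrees over the rational numbers *)

Notation QtoC := (map_poly (ratr : rat -> algC)).

Lemma rat_dependence (n m : nat) (b : 'I_n -> algC) (u : 'I_m -> algC) : (n < m)%N ->
  (forall j, exists c : 'I_n -> rat, u j = \sum_i ratr (c i) * b i) ->
  exists2 k : 'I_m -> rat, exists j, k j != 0 & \sum_j ratr (k j) * u j = 0.
Proof.
move=> nm /choice[c uE].
pose A := \matrix_(j < m, i < n) c j i.
have : kermx A != 0.
  rewrite -mxrank_eq0 mxrank_ker -lt0n subn_gt0 (leq_ltn_trans _ nm) //.
  exact: rank_leq_col.
case/rowV0Pn => v /sub_kermxP vA v0; exists (fun j => v 0 j).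
  apply: contrapT => h; case/eqP: v0; apply/rowP => j; rewrite mxE.
  by apply: contrapT => /eqP vj; apply: h; exists j.
under eq_bigr do rewrite uE mulr_sumr.
rewrite exchange_big big1 //= => i _.
under eq_bigr do rewrite mulrA -rmorphM.
rewrite -mulr_suml -rmorph_sum /=.
have /rowP/(_ i) := vA; rewrite !mxE => vAi.
suff -> : \sum_j v 0 j * c j i = 0 by rewrite rmorph0 mul0r.
by rewrite -[RHS]vAi; apply: eq_bigr => j _; rewrite mxE.
Qed.

Lemma rationalsP y : rationals y <-> exists c : rat, y = ratr c.
Proof. by rewrite /rationals /=; split=> [/CratP|h]; last apply/CratP. Qed.

(** Generation without independence: this passes to towers at no cost and suffices to bound
    degrees. *)
Definition qspan (E : set algC) (n : nat) (b : 'I_n -> algC) : Prop :=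
  (forall i, E (b i)) /\
  forall y, E y -> exists c : 'I_n -> rat, y = \sum_i ratr (c i) * b i.

Lemma basis_qspan E n (b : 'I_n -> algC) : is_basis rationals E b -> qspan E (n := n) b.
Proof.
case=> hb hs _; split=> // y /hs[c hc ->].
have /choice[q qE] : forall i, exists q : rat, c i = ratr q by move=> i; apply/rationalsP.
by exists q; apply: eq_bigr => i _; rewrite qE.
Qed.

Lemma basis_size_le E n m b (c : 'I_m -> algC) :
  qspan E (n := n) b -> is_basis rationals E c -> (m <= n)%N.
Proof.
move=> [_ hs] [hc _ hi]; rewrite leqNgt; apply/negP => nm.
have [|k [j kj] k0] := @rat_dependence n m b c nm; first by move=> j; apply: hs.
have := hi (fun j => ratr (k j)) _ k0 j.
have h i : rationals (ratr (k i)) by apply/rationalsP; exists (k i).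
by move=> /(_ h) /eqP; rewrite fmorph_eq0 (negbTE kj).
Qed.

(** A generating family of least size is independent, since a nontrivial relation would allow one
    member to be dropped. *)
Lemma qspan_has_degree E n b : qspan E (n := n) b -> exists2 m, has_degree rationals E m & (m <= n)%N.
Proof.
move=> hb.
pose S m := `[< exists b : 'I_m -> algC, qspan E b >].
have exS : exists m, S m by exists n; apply/asboolP; exists b.
pose m := ex_minn exS; have [Sm minm] : S m /\ forall k, S k -> (m <= k)%N.
  by rewrite /m; case: ex_minnP.
have mn : (m <= n)%N by apply: minm; apply/asboolP; exists b.
exists m => //; move/asboolP: Sm => [e [Ee es]]; exists e; split=> //.
  move=> y /es[c ->]; exists (fun i => ratr (c i)) => // i.
  by apply/rationalsP; exists (c i).
move=> c cQ c0 i0.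
have /choice[q qE] : forall i, exists q : rat, c i = ratr q by move=> i; apply/rationalsP.
rewrite qE; apply/eqP; rewrite fmorph_eq0; apply: contraT => q0.
clearbody m; clear mn.
move: e Ee es minm c cQ c0 i0 q qE q0.
case: m => [|m'] e Ee es minm c cQ c0 i0 q qE q0; first by case: (i0).
have : (m'.+1 <= m')%N; last by rewrite ltnn.
apply: minm; apply/asboolP; exists (fun i => e (lift i0 i)); split=> // y /es[a ->].
exists (fun i => a (lift i0 i) - a i0 / q i0 * q (lift i0 i)).
have De : e i0 = - (ratr (q i0))^-1 * \sum_i ratr (q (lift i0 i)) * e (lift i0 i).
  have qi : ratr (q i0) != 0 :> algC by rewrite fmorph_eq0.
  apply: (mulfI qi); rewrite mulNr mulrN mulrA divff // mul1r.
  apply/eqP; rewrite -addr_eq0; apply/eqP; rewrite -[RHS]c0 (bigD1_ord i0) //= qE.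
  by congr (_ + _); apply: eq_bigr => i _; rewrite qE.
rewrite (bigD1_ord i0) //= De mulr_sumr mulr_sumr -big_split /=; apply: eq_bigr => i _.
by rewrite rmorphB rmorphM fmorph_div /=; ring.
Qed.

Lemma degree_qspan E n b : qspan E (n := n) b ->
  (degree rationals E <= n)%N /\ has_degree rationals E (degree rationals E).
Proof.
move=> hb; have [m hm mn] := qspan_has_degree hb.
have hd : has_degree rationals E (degree rationals E) by rewrite /degree; case: xgetP => // /(_ m).
by split=> //; case: hd => c /(basis_size_le hb).
Qed.

Lemma degree_basis E n (b : 'I_n -> algC) : is_basis rationals E b -> degree rationals E = n.
Proof.
move=> hb; have [le [c hc]] := degree_qspan (basis_qspan hb).
by apply/eqP; rewrite eqn_leq le (basis_size_le (basis_qspan hc) hb).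
Qed.

(** For nonzero x the minimal polynomial has a nonzero constant term, as otherwise x would be a root
    of its quotient by X; the relation is then solved for 1 / x. *)
Lemma inv_poly (x : algC) : exists f, x^-1 = (QtoC f).[x].
Proof.
have [->|x0] := eqVneq x 0.
  by exists 0; rewrite rmorph0 horner0 invr0.
have [q [Dq mq] min_q] := minCpolyP x.
have qx : (QtoC q).[x] = 0 by apply/eqP; rewrite -/(root _ _) -Dq root_minCpoly.
have Eq : q = (q`_0)%:P + 'X * drop_poly 1 q.
  apply/polyP => k; rewrite coefD coefC coefXM coef_drop_poly.
  by case: k => [|k]; rewrite ?addr0 //= add0r addn1.
have Ex : ratr q`_0 + x * (QtoC (drop_poly 1 q)).[x] = 0.
  by rewrite -qx [in RHS]Eq rmorphD rmorphM /= map_polyC map_polyX hornerD hornerC hornerM hornerX.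
have q0 : q`_0 != 0.
  apply: contraTneq isT => q0; move: Ex; rewrite q0 rmorph0 add0r => /eqP.
  rewrite mulf_eq0 (negbTE x0) /= -/(root _ _) min_q => /dvdp_leq.
  have sq : (0 < size q)%N by rewrite size_poly_gt0 monic_neq0.
  have dn0 : drop_poly 1 q != 0.
    by apply: contraTneq mq => d0; rewrite Eq q0 d0 mulr0 addr0 monicE lead_coef0 eq_sym oner_eq0.
  by move=> /(_ dn0); rewrite size_drop_poly leqNgt subn1 prednK // leqnn.
exists (- (q`_0)^-1 *: drop_poly 1 q).
have qC0 : ratr q`_0 != 0 :> algC by rewrite fmorph_eq0.
rewrite linearZ /= hornerZ rmorphN fmorphV; apply: (mulfI x0); rewrite divff //.
rewrite mulrCA; move/eqP: Ex; rewrite addr_eq0 => /eqP Ex.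
by rewrite -[x * _]opprK -Ex mulrNN mulVf.
Qed.

(** Every element is algebraic, so its inverse is a rational polynomial in it and inverses come for
    free. *)
Lemma subfield_of_subring (E : set algC) :
  E 1 -> (forall q, E (ratr q)) -> (forall x y, E x -> E y -> E (x + y)) ->
  (forall x y, E x -> E y -> E (x * y)) -> subfield E.
Proof.
move=> E1 EQ ED EM.
have EX x k : E x -> E (x ^+ k).
  by move=> Ex; elim: k => [|k IH]; rewrite ?expr0 // exprS; apply: EM.
have EV x : E x -> E x^-1.
  move=> Ex; have [f ->] := inv_poly x; rewrite horner_coef.
  elim/big_ind: _ => [||i _]; [by rewrite -(rmorph0 (@ratr algC)); apply: EQ|exact: ED|].
  by rewrite coef_map; apply: EM; [exact: EQ|exact: EX].
apply: subfieldP => // x y Ex Ey; last by apply: EM => //; apply: EV.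
rewrite -mulN1r; apply: ED => //; apply: EM => //.
by rewrite -(rmorph1 (@ratr algC)) -rmorphN; apply: EQ.
Qed.

Section Adjoin.
Variable x : algC.
Local Notation Fx := (smallest subfield [set x]).
Local Notation n := (size (minCpoly x)).-1.

Lemma adjoinP y : Fx y <-> exists f, y = (QtoC f).[x].
Proof.
split=> [|[f ->]]; last first.
  have sF := subfield_smallest [set x].
  apply: (subfield_horner sF) => [|i]; first by move=> E [_]; apply.
  by rewrite coef_map; apply: subfield_rat.
move=> Fy; apply: (Fy [set y | exists f, y = (QtoC f).[x]]); split; last first.
  by move=> _ ->; exists 'X; rewrite map_polyX hornerX.
apply: subfield_of_subring => [|q|_ _ [f ->] [g ->]|_ _ [f ->] [g ->]].
- by exists 1; rewrite rmorph1 hornerC.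
- by exists q%:P; rewrite map_polyC hornerC.
- by exists (f + g); rewrite rmorphD hornerD.
- by exists (f * g); rewrite rmorphM hornerM.
Qed.

Lemma adjoin_basis : is_basis rationals Fx (fun i : 'I_n => x ^+ i).
Proof.
have [q [Dq mq] min_q] := minCpolyP x.
have qx : (QtoC q).[x] = 0 by apply/eqP; rewrite -/(root _ _) -Dq root_minCpoly.
have sq : size q = n.+1.
  rewrite Dq size_map_poly prednK // size_poly_gt0 monic_neq0 //.
split=> [i|y /adjoinP[f ->]|c cQ].
- by apply/adjoinP; exists 'X^i; rewrite map_polyXn hornerXn.
- exists (fun i => ratr (f %% q)`_i); first by move=> i; apply/rationalsP; exists (f %% q)`_i.
  rewrite {1}(divp_eq f q) rmorphD rmorphM hornerD hornerM qx mulr0 add0r.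
  rewrite (@horner_coef_wide _ n); last first.
    by rewrite size_map_poly -ltnS -sq ltn_modp monic_neq0.
  by apply: eq_bigr => i _; rewrite coef_map.
have /choice[k kE] : forall i, exists k : rat, c i = ratr k by move=> i; apply/rationalsP.
move=> c0 i; rewrite kE.
pose g := \poly_(j < n) (if insub j is Some l then k l else 0).
have gE (j : 'I_n) : g`_j = k j by rewrite coef_poly ltn_ord valK.
have : root (QtoC g) x.
  apply/eqP; rewrite -[RHS]c0 (@horner_coef_wide _ n) ?size_map_poly ?size_poly //.
  by apply: eq_bigr => j _; rewrite coef_map gE kE.
rewrite min_q => qg; have [g0|g0] := eqVneq g 0.
  by rewrite -gE g0 coef0 rmorph0.
have := dvdp_leq g0 qg; rewrite sq ltnNge.
by rewrite size_poly.
Qed.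

Lemma degree_adjoin : degree rationals Fx = n.
Proof. exact: degree_basis adjoin_basis. Qed.
End Adjoin.

(** * Normal closures and conjugates *)

Lemma map_polyOver1 (L : fieldExtType rat) (iota : {rmorphism L -> algC}) (g : {poly L}) :
  g \is a polyOver 1%VS -> exists f, map_poly iota g = QtoC f.
Proof.
move=> /polyOverP gQ.
have /choice[a aE] : forall i, exists a, g`_i = a%:A :> L by move=> i; apply/vlineP/gQ.
exists (\poly_(i < size g) a i); apply/polyP => i; rewrite !coef_map coef_poly /=.
case: ltnP => [_|si]; first by rewrite aE alg_num_field fmorph_rat.
by rewrite nth_default // !rmorph0.
Qed.

Lemma polyOver1_map (L : fieldExtType rat) (iota : {rmorphism L -> algC}) (g : {poly L}) f :
  map_poly iota g = QtoC f -> g \is a polyOver 1%VS.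
Proof.
move=> gf; apply/polyOverP => i; apply/vlineP; exists f`_i.
apply: (fmorph_inj iota); rewrite alg_num_field fmorph_rat.
by rewrite -!coef_map gf coef_map.
Qed.

(** Adjoining all conjugates of the members of [s] gives a splitting field of a rational polynomial,
    which is Galois in characteristic zero. *)
Lemma normal_closure (s : seq algC) :
  exists (N : splittingFieldType rat) (iota : {rmorphism N -> algC}),
    galois 1 {:N} /\ {in s, forall x, exists y, iota y = x}.
Proof.
have rtsP z : exists rs : seq algC, minCpoly z = \prod_(r <- rs) ('X - r%:P).
  have [rs Drs] := closed_field_poly_normal (minCpoly z).
  by exists rs; rewrite Drs (monicP (minCpoly_monic z)) scale1r.
have [rts rtsE] := choice rtsP.
have [N0 [iota [s1 Ds1 gens]]] := num_field_exists (flatten [seq rts z | z <- s]).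
pose p := \prod_(y <- s1) ('X - y%:P).
have Dp : map_poly iota p = \prod_(z <- s) minCpoly z.
  rewrite rmorph_prod /=; under eq_bigr do rewrite map_polyXsubC.
  rewrite -(big_map iota xpredT (fun y => 'X - y%:P)) Ds1 big_flatten big_map.
  by apply: eq_bigr => z _; rewrite rtsE.
have p1 : p \is a polyOver 1%VS.
  have /choice[q qE] : forall z, exists q, minCpoly z = QtoC q.
    by move=> z; have [q [Dq _] _] := minCpolyP z; exists q.
  apply: (@polyOver1_map _ iota _ (\prod_(z <- s) q z)).
  by rewrite Dp rmorph_prod; apply: eq_bigr => z _; rewrite qE.
have ax : splitting_field_axiom N0.
  by exists p => //; exists s1; rewrite ?eqpxx.
have Nax : FieldExt_isSplittingField _ N0 by constructor.
pose N : splittingFieldType rat := HB.pack_for (splittingFieldType rat) N0 Nax.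
exists N, iota; split.
  apply/and3P; split; [exact: subvf| |exact: normalFieldf].
  apply/separableP => y _; apply: pcharf0_separable => i.
  by rewrite -(fmorph_pchar iota) pchar_num.
move=> x xs; have : x \in map iota s1.
  rewrite Ds1; apply/flattenP; exists (rts x); first exact: map_f.
  by have := root_minCpoly x; rewrite rtsE root_prod_XsubC.
by case/mapP => y _ ->; exists y.
Qed.

(** The Galois group of a normal closure is transitive on the conjugates, and its elements extend to
    [algC]. *)
Lemma aut_of_root (x r : algC) : root (minCpoly x) r ->
  exists nu : {rmorphism algC -> algC}, nu x = r.
Proof.
have [N [iota [galN /(_ x)]]] := normal_closure [:: x].
rewrite mem_head => /(_ isT)[y Dx] xr.
have [q [Dq _] min_q] := minCpolyP x.
have [f Df] := map_polyOver1 iota (minPolyOver 1 y).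
have qf : (q %| f) by rewrite -min_q -Df -Dx fmorph_root root_minPoly.
have rf : root (map_poly iota (minPoly 1 y)) r.
  by rewrite Df; case/dvdpP: qf => h ->; rewrite rmorphM rootM /= -Dq xr orbT.
have [rs [_ _ Drs]] := galois_factors (sub1v _) galN y (memvf y).
move: rf; rewrite Drs rmorph_prod /=; under eq_bigr do rewrite map_polyXsubC.
rewrite -(big_map iota xpredT (fun y => 'X - y%:P)) root_prod_XsubC.
case/mapP => _ /mapP[g _ ->] ->.
have [nu nuE] := extend_algC_subfield_aut iota g.
by exists nu; rewrite -Dx -nuE.
Qed.

Lemma minCpoly_roots (x : algC) : exists rs : seq algC,
  [/\ uniq rs, minCpoly x = \prod_(r <- rs) ('X - r%:P) & x \in rs].
Proof.
have [rs Drs] := closed_field_poly_normal (minCpoly x).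
move: Drs; rewrite (monicP (minCpoly_monic x)) scale1r => Drs; exists rs; split=> //.
  have [N [iota [galN /(_ x)]]] := normal_closure [:: x].
  rewrite mem_head => /(_ isT)[y Dx].
  have [q [Dq mq] min_q] := minCpolyP x.
  rewrite -separable_prod_XsubC -Drs Dq separable_map.
  have irr_q : irreducible_poly q.
    split=> [|g sg gq]; first by have := size_minCpoly x; rewrite Dq size_map_poly.
    case/dvdpP: (gq) => h Dh; have : root (QtoC q) x by rewrite min_q.
    rewrite Dh rmorphM rootM => /orP[]; rewrite min_q => qh; last by rewrite /eqp -Dh gq.
    have h0 : h != 0 by apply: contraTneq (monic_neq0 mq) => h0; rewrite Dh h0 mul0r eqxx.
    have g0 : g != 0 by apply: contraTneq (monic_neq0 mq) => g0; rewrite Dh g0 mulr0 eqxx.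
    have := dvdp_leq h0 qh; rewrite Dh size_mul //.
    have : (0 < size g)%N by rewrite size_poly_gt0.
    move=> sg0 hle; exfalso; have : (0 < size h)%N by rewrite size_poly_gt0.
    by case: (size h) (size g) sg sg0 hle => [|a] [|[|b]] // _ _; rewrite !addSn !addnS /= ltnNge leq_addr.
  rewrite separable_poly.unlock; apply/coprimepP => d dq dq'; apply/idPn; rewrite -size_poly_eq1 => d1.
  have [_ /(_ d d1 dq)] := irr_q; rewrite /eqp => /andP[_ qd].
  have : deriv q != 0.
    have [sq _] := irr_q; have /monicP := mq; rewrite /lead_coef.
    case: (size q) sq => [|[|k]] //= _ qk.
    apply: contra_eq_neq (coef_deriv q k) => ->; rewrite coef0 qk eq_sym.
    by rewrite pnatr_eq0.
  move=> q'0; have := dvdp_leq q'0 (dvdp_trans qd dq'); rewrite leqNgt lt_size_deriv //.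
  exact: monic_neq0.
by have := root_minCpoly x; rewrite Drs root_prod_XsubC.
Qed.

Section PowerBounds.
Variable R : realType.

Lemma pow_unbounded (c M : R) : 1 < c -> exists N, forall n, (N <= n)%N -> M < c ^+ n.
Proof.
move=> c1; have c0 : 0 < c - 1 by rewrite subr_gt0.
have bern n : 1 + n%:R * (c - 1) <= c ^+ n.
  elim: n => [|n IH]; first by rewrite mul0r addr0 expr0.
  rewrite exprS; apply: (@le_trans _ _ (c * (1 + n%:R * (c - 1)))); last first.
    by rewrite ler_pM2l // (lt_trans ltr01).
  rewrite -natr1 -subr_ge0.
  have -> : c * (1 + n%:R * (c - 1)) - (1 + (n%:R + 1) * (c - 1)) = n%:R * ((c - 1) * (c - 1)) by ring.
  by rewrite !mulr_ge0 // ltW.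
pose N := Num.bound (M / (c - 1)); exists N => n Nn.
apply: lt_le_trans (bern n).
have : M / (c - 1) < n%:R.
  apply: (le_lt_trans (ler_norm _)); apply: (lt_le_trans (archi_boundP (normr_ge0 _))).
  by rewrite ler_nat (leq_trans _ Nn) // /N /Num.bound normr_id.
rewrite ltr_pdivrMr // => h; apply: (lt_trans h); rewrite ltrDr //.
Qed.

Lemma pow_small (c e : R) : 0 <= c -> c < 1 -> 0 < e ->
  exists N, forall n, (N <= n)%N -> c ^+ n < e.
Proof.
rewrite le_eqVlt => /predU1P[<- _ e0|c0 c1 e0].
  by exists 1%N => -[|n] // _; rewrite exprS mul0r.
have c1' : 1 < c^-1 by rewrite invf_gt1.
have [N HN] := pow_unbounded e^-1 c1'; exists N => n /HN.
by rewrite exprVn ltf_pV2 // posrE ?exprn_gt0.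
Qed.
End PowerBounds.

(** * Places of a field and existence of local bases *)

Section Place.
Variables (R : realType) (F : set algC) (sF : subfield F).

Section OnePlace.
Variables (v : algC -> R) (vP : place R F v).

Lemma place_ge0 x : F x -> 0 <= v x.
Proof. by case: vP => _ h _ _ _ /h[]. Qed.
Lemma place_eq0 x : F x -> (v x == 0) = (x == 0).
Proof. by case: vP => _ h _ _ _ /h[_ [h1 h2]]; apply/eqP/eqP. Qed.
Lemma place_gt0 x : F x -> (0 < v x) = (x != 0).
Proof. by move=> Fx; rewrite lt_def place_eq0 // place_ge0 // andbT. Qed.
Lemma placeM x y : F x -> F y -> v (x * y) = v x * v y.
Proof. by case: vP => _ _ h _ _; apply: h. Qed.
Lemma placeD x y : F x -> F y -> v (x + y) <= v x + v y.
Proof. by case: vP => _ _ _ h _; apply: h. Qed.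
Lemma place0 : v 0 = 0.
Proof. by apply/eqP; rewrite place_eq0 //; apply: subfield0. Qed.
Lemma place1 : v 1 = 1.
Proof.
have F1 := subfield1 sF; have h : v 1 != 0 by rewrite place_eq0 // oner_eq0.
by apply: (mulfI h); rewrite -placeM // !mulr1.
Qed.
Lemma placeX x n : F x -> v (x ^+ n) = v x ^+ n.
Proof.
move=> Fx; elim: n => [|n IH]; first by rewrite !expr0 place1.
by rewrite !exprS placeM ?IH //; apply: subfieldX.
Qed.
Lemma placeN x : F x -> v (- x) = v x.
Proof.
move=> Fx; have FN1 := subfieldN sF (subfield1 sF).
have h : v (-1) = 1.
  have : v (-1) ^+ 2 = 1 by rewrite -placeX // sqrrN expr1n place1.
  move/eqP; rewrite sqrf_eq1 => /orP[/eqP//|/eqP h].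
  by have := place_ge0 FN1; rewrite h oppr_ge0 ler10.
by rewrite -mulN1r placeM // h mul1r.
Qed.
Lemma placeV x : F x -> v x^-1 = (v x)^-1.
Proof.
move=> Fx; have [->|x0] := eqVneq x 0; first by rewrite invr0 place0 invr0.
have h : v x != 0 by rewrite place_eq0.
by apply: (mulfI h); rewrite -placeM ?divff ?place1 //; apply: subfieldV.
Qed.
Lemma place_sum I (r : seq I) (P : pred I) (f : I -> algC) : (forall i, F (f i)) ->
  v (\sum_(i <- r | P i) f i) <= \sum_(i <- r | P i) v (f i).
Proof.
move=> Ff; elim: r => [|i r IH]; first by rewrite !big_nil place0.
rewrite !big_cons; case: ifP => // _; apply: (le_trans (placeD _ _)) => //.
  exact: (subfield_sum sF).
by rewrite lerD2l.
Qed.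

(** Independence over the completion of Q, stated with rational coefficients only: the uniform
    constant survives limits, so coordinates of Cauchy sequences are Cauchy and coordinates of null
    sequences are null. *)
Definition place_free (k : nat) (b : 'I_k -> algC) : Prop :=
  (forall i, F (b i)) /\ exists2 C : R, 0 < C & forall (c : 'I_k -> rat) i,
    v (ratr (c i)) <= C * v (\sum_i ratr (c i) * b i).

Let Flin k (b : 'I_k -> algC) (c : 'I_k -> rat) : (forall i, F (b i)) ->
  F (\sum_i ratr (c i) * b i).
Proof.
move=> Fb; apply: (subfield_sum sF) => i _; apply: (subfieldM sF) => //.
exact: subfield_rat.
Qed.

Lemma place_free_local_basis (k : nat) (b : 'I_k -> algC) : place_free b ->
  (forall y (e : R), F y -> 0 < e ->
    exists c : 'I_k -> rat, v (y - \sum_i ratr (c i) * b i) < e) ->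
  is_local_basis F v (fun i (_ : nat) => b i).
Proof.
move=> [Fb [C C0 HC]] dense; split.
- move=> i; split=> // e e0; exists 0%N => m n _ _; rewrite subrr place0 //.
- move=> u [Fu cu].
  have /choice[c cP] : forall N, exists c : 'I_k -> rat,
      v (u N - \sum_i ratr (c i) * b i) < N.+1%:R^-1.
    by move=> N; apply: dense => //; rewrite invr_gt0 ltr0n.
  have small (e : R) : 0 < e -> exists N, forall n, (N <= n)%N -> n.+1%:R^-1 < e.
    move=> e0; exists (Num.bound e^-1) => n Nn; rewrite invf_plt ?posrE ?ltr0n //.
    have e0' : 0 <= e^-1 by rewrite invr_ge0 ltW.
    by apply: (lt_le_trans (archi_boundP e0')); rewrite ler_nat (leq_trans Nn).
  exists (fun i N => ratr (c N i)); last first.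
    by move=> e /small[N HN]; exists N => n /HN; apply: lt_trans.
  move=> i; split=> [N|e e0]; first by apply/rationalsP; exists (c N i).
  (* Three errors add up, namely the variation of [u] and the two approximation errors; [C] is lost
     when passing to coordinates. *)
  have e3 : 0 < e / C / 3 by rewrite !divr_gt0.
  have [N1 HN1] := cu _ e3; have [N2 HN2] := small _ e3.
  exists (maxn N1 N2) => m n; rewrite !geq_max => /andP[m1 m2] /andP[n1 n2].
  rewrite -rmorphB; apply: le_lt_trans (HC (fun i => c m i - c n i) i) _.
  rewrite mulrC -ltr_pdivlMr //.
  have -> : \sum_i ratr (c m i - c n i) * b i =
     (u m - u n) + ((u n - \sum_i ratr (c n i) * b i) - (u m - \sum_i ratr (c m i) * b i)).
    under eq_bigr do rewrite rmorphB mulrBl.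
    by rewrite sumrB; ring.
  have Fd l : F (u l - \sum_i ratr (c l i) * b i) by apply: subfieldB => //; apply: Flin.
  have Fu' : F (u m - u n) by apply: subfieldB.
  apply: (le_lt_trans (placeD _ _)) => //; first exact: subfieldB.
  have h1 := HN1 m n m1 n1.
  have h2 := lt_trans (cP n) (HN2 n n2).
  have h3 := lt_trans (cP m) (HN2 m m2).
  have h4 : v ((u n - \sum_i ratr (c n i) * b i) - (u m - \sum_i ratr (c m i) * b i)) <=
     v (u n - \sum_i ratr (c n i) * b i) + v (u m - \sum_i ratr (c m i) * b i).
    by rewrite -[in X in _ <= X](placeN (Fd m)); apply: placeD => //; apply: subfieldN.
  by move: h1 h2 h3 h4; lra.
- move=> c cQ c0 i e e0.
  have /choice[q qE] : forall i, exists q : nat -> rat, forall N, c i N = ratr (q N).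
    move=> j; have [h _] := cQ j.
    have /choice[q qE] : forall N, exists q : rat, c j N = ratr q.
      by move=> N; apply/rationalsP.
    by exists q.
  have [N HN] := c0 (e / C) (divr_gt0 e0 C0); exists N => n /HN h.
  rewrite qE; apply: (le_lt_trans (HC (fun i => q i n) i)).
  rewrite mulrC -ltr_pdivlMr //; congr (v _ < _) : h.
  by apply: eq_bigr => j _; rewrite qE.
Qed.

(* A rational family whose coordinates are controlled by [v], of maximal size,
   spans a dense subspace of the completion, hence all of it. *)
Lemma local_basis_exists (n : nat) (g : 'I_n -> algC) : qspan F g ->
  exists k (b : 'I_k -> nat -> algC), is_local_basis F v b.
Proof.
move=> [Fg gs].
pose S k := `[< exists b : 'I_k -> algC, place_free b >].
have S0 : exists k, S k.
  exists 0%N; apply/asboolP; exists (fun _ => 0); split; first by case.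
  by exists 1 => // c [].
have Sn k : S k -> (k <= n)%N.
  move/asboolP => [b [Fb [C C0 HC]]]; rewrite leqNgt; apply/negP => nk.
  have [|c [j cj] c0] := @rat_dependence n k g b nk; first by move=> j; apply: gs.
  have := HC c j; rewrite c0 place0 mulr0 leNgt place_gt0 ?fmorph_eq0 ?cj //.
  exact: subfield_rat.
have [k /asboolP[b fb] kmax] : exists2 k, S k & forall l, S l -> (l <= k)%N.
  by case: (ex_maxnP S0 Sn) => k Sk km; exists k.
exists k, (fun i _ => b i); apply: place_free_local_basis => // y e Fy e0.
have [Fb [Cb Cb0 HCb]] := fb.
apply: contrapT => far.
have : (k.+1 <= k)%N; last by rewrite ltnn.
apply: kmax; apply/asboolP.
exists (fun i => if unlift ord0 i is Some j then b j else y).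
split; first by move=> i; case: unlift => [j|].
(* With D the value of the whole combination, [far] gives v c0 <= D / e, and the rest of the
   combination has value at most D + v c0 * v y. So the old coordinates are at most Cb D + Cb (v y)
   D / e; the summand 1 covers c0 itself. *)
pose C := Cb + (Cb * v y + 1) / e.
have C1 : 0 < (Cb * v y + 1) / e.
  by rewrite divr_gt0 // ltr_wpDl // mulr_ge0 ?place_ge0 // ltW.
exists C; first by rewrite addr_gt0.
move=> c i; rewrite big_ord_recl unlift_none.
under eq_bigr do rewrite liftK.
set c0 := c ord0; set c' := fun j => c (lift ord0 j).
rewrite -[X in _ + X]/(\sum_(j < k) ratr (c' j) * b j); set Sb := \sum_(j < k) _.
have FSb : F Sb by apply: Flin.
have Fr q : F (ratr q) by apply: subfield_rat.
have [c00|c00] := eqVneq c0 0.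
  rewrite c00 rmorph0 mul0r add0r.
  have [j ->|->] := unliftP ord0 i; last by rewrite -/c0 c00 rmorph0 place0 mulr_ge0 ?place_ge0 ?addr_ge0 // ltW.
  apply: (le_trans (HCb c' j)); rewrite -/Sb ler_wpM2r ?place_ge0 //.
  by rewrite /C lerDl ltW.
set D := v (ratr c0 * y + Sb).
have Fcy : F (ratr c0 * y) by apply: subfieldM.
have FD : F (ratr c0 * y + Sb) by apply: subfieldD.
have vc0 : 0 < v (ratr c0) by rewrite place_gt0 // fmorph_eq0.
(* Otherwise division by c0 would bring [y] within [e] of the span of [b], against [far]. *)
have De : e * v (ratr c0) <= D.
  rewrite leNgt; apply/negP => h; apply: far.
  exists (fun j => - c' j / c0).
  rewrite -(ltr_pM2r vc0) -placeM //; last by apply: subfieldB => //; apply: Flin.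
  apply: le_lt_trans h; rewrite le_eqVlt; apply/orP; left; apply/eqP; congr v.
  rewrite mulrBl mulrC; congr (_ + _); rewrite -mulNr -sumrN mulr_suml; apply: eq_bigr => j _.
  by rewrite fmorph_div rmorphN /= mulNr mulrAC divfK ?fmorph_eq0 // mulNr opprK.
have vSb : v Sb <= D + v (ratr c0) * v y.
  have -> : Sb = (ratr c0 * y + Sb) + - (ratr c0 * y) by ring.
  rewrite -placeM // -[X in _ <= _ + X](placeN Fcy); apply: placeD => //.
  exact: subfieldN.
have D0 : 0 <= D := place_ge0 FD.
have CD : Cb * D + (Cb * v y + 1) / e * D = C * D by rewrite /C; ring.
have h1 : (Cb * v y + 1) * v (ratr c0) <= (Cb * v y + 1) / e * D.
  rewrite -mulrA ler_wpM2l //.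
    by rewrite addr_ge0 // mulr_ge0 ?place_ge0 // ltW.
  by rewrite mulrC ler_pdivlMr // mulrC.
have vy0 : 0 <= Cb * v y by rewrite mulr_ge0 ?place_ge0 // ltW.
have [j ->|->] := unliftP ord0 i.
  apply: (le_trans (HCb c' j)); rewrite -/Sb.
  apply: (@le_trans _ _ (Cb * (D + v (ratr c0) * v y))); first by rewrite ler_pM2l.
  by rewrite -CD; nra.
rewrite -/c0 -CD; nra.
Qed.
End OnePlace.
End Place.

(** * Lower bound for local degrees *)

Section Convergence.
Variables (R : realType) (w : algC -> R) (wA : absval w).

Definition conv (u : nat -> algC) (l : algC) := null_seq w (fun N => u N - l).

Lemma conv_cst l : conv (fun _ => l) l.
Proof. by move=> e e0; exists 0%N => n _; rewrite subrr absval0. Qed.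

Lemma convD u v l m : conv u l -> conv v m -> conv (fun N => u N + v N) (l + m).
Proof.
move=> cu cv e e0; have e2 : 0 < e / 2 by rewrite divr_gt0.
have [N HN] := cu _ e2; have [M HM] := cv _ e2; exists (maxn N M) => n.
rewrite geq_max => /andP[/HN h1 /HM h2].
rewrite (_ : _ - _ = (u n - l) + (v n - m)); last by ring.
by apply: (le_lt_trans (absvalD wA _ _)); move: h1 h2; lra.
Qed.

Lemma convM u v l m : conv u l -> conv v m -> conv (fun N => u N * v N) (l * m).
Proof.
move=> cu cv e e0.
pose K := 1 + w l + w m.
have wl := absval_ge0 wA l; have wm := absval_ge0 wA m.
have K1 : 1 <= K by rewrite /K; lra.
have K0 : 0 < K by lra.
pose d := Num.min 1 (e / 2 / K).
have d0 : 0 < d by rewrite lt_min ltr01 !divr_gt0.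
have dK : d * K <= e / 2 by rewrite -ler_pdivlMr // ge_min lexx orbT.
have d1 : d <= 1 by rewrite ge_min lexx.
have [N HN] := cu _ d0; have [M HM] := cv _ d0; exists (maxn N M) => n.
rewrite geq_max => /andP[/HN h1 /HM h2].
rewrite (_ : _ - _ = (u n - l) * (v n - m) + (u n - l) * m + l * (v n - m)); last by ring.
apply: (le_lt_trans (absvalD wA _ _)); apply: (le_lt_trans (lerD (absvalD wA _ _) (lexx _))).
rewrite !absvalM //; set a := w (u n - l) in h1 *; set b := w (v n - m) in h2 *.
have a0 : 0 <= a := absval_ge0 wA _; have b0 : 0 <= b := absval_ge0 wA _.
have ab : a * b <= d * 1 by rewrite ler_pM ?(ltW h1) //; lra.
have am : a * w m <= d * w m by rewrite ler_wpM2r // ltW.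
have bl : w l * b <= w l * d by rewrite ler_wpM2l // ltW.
have : a * b + a * w m + w l * b <= d * K by rewrite /K; lra.
lra.
Qed.

Lemma conv_sum (I : Type) (r : seq I) (P : pred I) (u : I -> nat -> algC) (l : I -> algC) :
  (forall i, conv (u i) (l i)) ->
  conv (fun N => \sum_(i <- r | P i) u i N) (\sum_(i <- r | P i) l i).
Proof.
move=> cu; elim: r => [|i r IH].
  by rewrite big_nil; under eq_fun do rewrite big_nil; apply: conv_cst.
rewrite big_cons; under eq_fun do rewrite big_cons.
by case: (P i) => //; apply: convD.
Qed.

Lemma conv_prod (I : Type) (r : seq I) (P : pred I) (u : I -> nat -> algC) (l : I -> algC) :
  (forall i, conv (u i) (l i)) ->
  conv (fun N => \prod_(i <- r | P i) u i N) (\prod_(i <- r | P i) l i).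
Proof.
move=> cu; elim: r => [|i r IH].
  by rewrite big_nil; under eq_fun do rewrite big_nil; apply: conv_cst.
rewrite big_cons; under eq_fun do rewrite big_cons.
by case: (P i) => //; apply: convM.
Qed.

Lemma conv_det m (u : nat -> 'M[algC]_m) (l : 'M[algC]_m) :
  (forall i j, conv (fun N => u N i j) (l i j)) -> conv (fun N => \det (u N)) (\det l).
Proof.
move=> cu; apply: conv_sum => s; apply: convM; first exact: conv_cst.
exact: conv_prod.
Qed.

Lemma conv_cst_uniq l : conv (fun _ => 0) l -> l = 0.
Proof.
move=> c; apply/eqP; rewrite -(absval_eq0 wA); apply: contraT => wl.
have wl0 : 0 < w l by rewrite lt_def wl absval_ge0.
by have [N /(_ N (leqnn N))] := c _ wl0; rewrite sub0r absvalN // ltxx.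
Qed.
End Convergence.

(* The [m] conjugates of [x] inducing the same place give an invertible
   Vandermonde matrix, which is a limit of matrices of rank at most [k]. *)
Lemma local_basis_size_ge (R : realType) (w v : algC -> R) (x : algC) m
    (nu : 'I_m -> {rmorphism algC -> algC}) k (b : 'I_k -> nat -> algC) :
  absval w -> injective (fun j => nu j x) ->
  (forall j y, smallest subfield [set x] y -> v y = w (nu j y)) ->
  is_local_basis (smallest subfield [set x]) v b -> (m <= k)%N.
Proof.
move=> wA inj vw [bF bs _]; rewrite leqNgt; apply/negP => km.
set F := smallest subfield [set x] in vw bF bs.
have sF : subfield F := subfield_smallest _.
have Fx i : F (x ^+ i) by apply: (subfieldX sF) => E [_ h]; apply: h.
have v0 : (0 < m)%N -> v 0 = 0.
  by case: m nu inj vw km => // m nu _ vw _ _; rewrite (vw ord0) ?rmorph0 ?absval0 //; apply: (subfield0 sF).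
have m0 : (0 < m)%N by apply: leq_ltn_trans km.
have cx i : cauchy_in v F (fun _ => x ^+ i).
  by split=> // e e0; exists 0%N => p q _ _; rewrite subrr v0.
have /choice[c cP] : forall i : 'I_m, exists c : 'I_k -> nat -> algC,
   (forall l, cauchy_in v rationals (c l)) /\
   null_seq v (fun N => x ^+ i - \sum_l c l N * b l N).
  by move=> i; have [c h1 h2] := bs _ (cx i); exists c.
pose A N := \matrix_(i < m, l < k) c i l N.
pose B N := \matrix_(l < k, j < m) nu j (b l N).
pose V : 'M[algC]_m := Vandermonde m (\row_j nu j x).
have cQ i l N : rationals (c i l N) by have [/(_ l)[]] := cP i.
have cV : conv w (fun N => \det (A N *m B N)) (\det V).
  apply: conv_det => // i j e e0; have [_ /(_ e e0)[N HN]] := cP i.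
  exists N => n /HN; rewrite (vw j); last first.
    apply: (subfieldB sF) => //; apply: (subfield_sum sF) => l _; apply: (subfieldM sF).
      by have /rationalsP[q ->] := cQ i l n; apply: (subfield_rat sF).
    by have [] := bF l.
  rewrite rmorphB rmorphXn rmorph_sum /= !mxE absvalB //.
  set s1 := \sum_(_ < _) _; set s2 := \sum_(_ < _) _; suff -> : s1 = s2 by [].
  apply: eq_bigr => l _; rewrite !mxE rmorphM /=; congr (_ * _).
  by have /rationalsP[q ->] := cQ i l n; rewrite fmorph_rat.
have AB0 N : \det (A N *m B N) = 0.
  apply/eqP; rewrite -[_ == _]negbK -unitfE -unitmxE -row_free_unit -row_leq_rank -ltnNge.
  apply: leq_ltn_trans (mxrankM_maxl _ _) _.
  exact: leq_ltn_trans (rank_leq_col _) km.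
move: cV; under eq_fun do rewrite AB0.
move/(conv_cst_uniq wA); rewrite det_Vandermonde => /eqP.
apply/negP; rewrite prodf_seq_neq0; apply/allP => i _ /=.
rewrite prodf_seq_neq0; apply/allP => j _ /=; apply/implyP => ij.
by rewrite !mxE subr_eq0; apply: contraTneq ij => /inj ->; rewrite ltnn.
Qed.

(** * Separation of the places above one rational place *)

Lemma usual_absP (R : realType) (f : rat -> R) : usual_abs f -> exists2 q, is_pl q & f = uabs R q.
Proof.
case=> [->|[p pp ->]]; first by exists 0%N.
by exists p; rewrite /is_pl ?pp ?orbT // /uabs gtn_eqF ?prime_gt0.
Qed.

(** Archimedean values of rationals are dense and N = 1 works. The p-adic ones are discrete, so N-th
    powers are taken until the interval is wide enough to contain a power of p. *)
Lemma uabs_sep (R : realType) (q : nat) (a b : R) : is_pl q -> 0 < b -> b < a ->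
  exists N (t : rat), [/\ t != 0, b ^+ N < uabs R q t & uabs R q t < a ^+ N].
Proof.
move=> qP b0 ba; have [w [wA _ wE]] := @valof_exists R q qP.
case/orP: qP => [/eqP q0|qp].
  have [t] := rat_in_itvoo ba; rewrite in_itv /= => /andP[bt ta].
  have t0 : 0 < t by rewrite -(ltr0q R) (lt_trans b0).
  by exists 1%N, t; rewrite !expr1 /uabs q0 /= gtr0_norm // gt_eqF.
have qR1 : 1 < (q%:R : R) by rewrite ltr1n prime_gt1.
have qR0 : 0 < (q%:R : R) by rewrite ltr0n prime_gt0.
have a0 : 0 < a by apply: lt_trans ba.
(* The ratio of the two N-th powers exceeds q, so the first power of q above b ^ N is still below a
   ^ N. The shift by q ^ m pushes b ^ N above 1, so that the least exponent [k] can be sought among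
   natural numbers. *)
have [N /(_ N (leqnn N)) HN] : exists N, forall n, (N <= n)%N -> q%:R < (a / b) ^+ n.
  by apply: pow_unbounded; rewrite ltr_pdivlMr // mul1r.
have [m /(_ m (leqnn m)) Hm] := pow_unbounded (b ^+ N)^-1 qR1.
have bN0 : 0 < b ^+ N by rewrite exprn_gt0.
have qm0 : 0 < (q%:R : R) ^+ m by rewrite exprn_gt0.
have ex_k : exists k, q%:R ^+ m * b ^+ N < q%:R ^+ k.
  by have [k /(_ k (leqnn k)) Hk] := pow_unbounded (q%:R ^+ m * b ^+ N) qR1; exists k.
pose k := ex_minn ex_k.
have [Hk kmin] : q%:R ^+ m * b ^+ N < q%:R ^+ k /\
   forall l, q%:R ^+ m * b ^+ N < q%:R ^+ l -> (k <= l)%N.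
  by rewrite /k; case: ex_minnP.
have qmb : 1 < q%:R ^+ m * b ^+ N.
  by rewrite -(ltr_pM2r bN0) mulVf ?gt_eqF // in Hm.
have Hk' : q%:R ^+ k <= q%:R * (q%:R ^+ m * b ^+ N).
  case: (k) Hk kmin => [|k'] Hk kmin.
    by move: Hk; rewrite expr0 => /(lt_trans qmb); rewrite ltxx.
  rewrite exprS ler_pM2l // leNgt; apply/negP => /kmin.
  by rewrite ltnn.
exists N, (q%:R ^+ m / q%:R ^+ k).
have -> : uabs R q (q%:R ^+ m / q%:R ^+ k) = q%:R ^+ k / q%:R ^+ m.
  rewrite -wE fmorph_div !rmorphXn absvalM // absvalV // !absvalX //.
  rewrite wE /= /uabs gtn_eqF ?prime_gt0 // padic_abs_p // !exprVn invrK mulrC //.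
have q0 : (q%:R : rat) != 0 by rewrite pnatr_eq0 -lt0n prime_gt0.
split; first by rewrite mulf_neq0 ?invr_eq0 ?expf_neq0.
  by rewrite ltr_pdivlMr // mulrC.
rewrite ltr_pdivrMr //; apply: (le_lt_trans Hk').
rewrite mulrCA mulrC ltr_pM2r // -ltr_pdivlMr // -expr_div_n //.
Qed.

Section Places.
Variables (R : realType) (F : set algC) (sF : subfield F) (q : nat).
Hypothesis qP : is_pl q.

Definition place_over (v : algC -> R) : Prop :=
  place R F v /\ (fun c : rat => v (ratr c)) = uabs R q.

Lemma place_overE v (c : rat) : place_over v -> v (ratr c) = uabs R q c.
Proof. by case=> _ <-. Qed.

(** Distinct places differ at some z. Both agree on rationals, so dividing a power of z by a
    rational of intermediate value puts the two values on opposite sides of 1. *)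
Lemma place_separation v0 v1 : place_over v0 -> place_over v1 -> v0 != v1 ->
  exists y, [/\ F y, 1 < v0 y & v1 y < 1].
Proof.
move=> h0 h1 nv; have [P0 _] := h0; have [P1 _] := h1.
have [z [Fz z0 vz]] : exists z, [/\ F z, z != 0 & v1 z < v0 z].
  apply: contrapT => no; case/eqP: nv; apply/funext => z.
  have [Fz|nFz] := pselect (F z); last first.
    by case: P0 => -> // _ _ _ _; case: P1 => -> // .
  have [->|z0] := eqVneq z 0; first by rewrite !(place0 sF).
  have [lt|lt|//] := ltgtP (v0 z) (v1 z); exfalso; apply: no.
    exists z^-1; rewrite invr_eq0; split=> //; first exact: subfieldV.
    by rewrite !(placeV sF) // ltf_pV2 // posrE (place_gt0 _ Fz).
  by exists z.
have v1z : 0 < v1 z by rewrite (place_gt0 P1 Fz).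
have [N [t [t0 h2 h3]]] := uabs_sep qP v1z vz.
have Ft : F (ratr t) by apply: subfield_rat.
have t0' : ratr t != 0 :> algC by rewrite fmorph_eq0.
have FzN : F (z ^+ N) by apply: subfieldX.
have FtV : F (ratr t)^-1 by apply: subfieldV.
have tp : 0 < uabs R q t by rewrite -(place_overE _ h0) (place_gt0 P0 Ft).
exists (z ^+ N / ratr t); split; first exact: subfield_div.
  by rewrite (placeM P0) // (placeV sF P0) // (placeX sF P0) // (place_overE _ h0) ltr_pdivlMr // mul1r.
by rewrite (placeM P1) // (placeV sF P1) // (placeX sF P1) // (place_overE _ h1) ltr_pdivrMr // mul1r.
Qed.

Lemma eventually_all (T : eqType) (s : seq T) (Q : T -> nat -> Prop) :
  (forall x, x \in s -> exists N, forall n, (N <= n)%N -> Q x n) ->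
  exists N, forall n, (N <= n)%N -> forall x, x \in s -> Q x n.
Proof.
elim: s => [|x s IH] h; first by exists 0%N.
have [N HN] : exists N, forall n, (N <= n)%N -> forall x, x \in s -> Q x n.
  by apply: IH => y ys; apply: h; rewrite inE ys orbT.
have [M HM] := h x (mem_head _ _); exists (maxn N M) => n; rewrite geq_max => /andP[n1 n2] y.
by rewrite inE => /predU1P[->|]; [apply: HM|apply: HN].
Qed.

(** Induction on the list: z handles the old places and y the new one. If v1 z <= 1, then z ^ r * y
    works for large r. Otherwise z is large at both v0 and v1, and the factor z ^ r / (1 + z ^ r) is
    close to 1 there and close to 0 at the old places. *)
Lemma places_separation v0 (s : seq (algC -> R)) : place_over v0 ->
  (forall v, v \in s -> place_over v /\ v0 != v) ->
  exists z, [/\ F z, 1 < v0 z & forall v, v \in s -> v z < 1].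
Proof.
move=> h0; have [P0 _] := h0.
elim: s => [_|v1 s IH hs].
  have [N [t [t0 _ h]]] := uabs_sep qP (@ltr01 R) (ltr1n R 2).
  have [N' [t' [t0' h' _]]] := uabs_sep qP (@ltr01 R) (ltr1n R 2).
  exists (ratr t'); split=> //; first exact: subfield_rat.
  by rewrite (place_overE _ h0); move: h'; rewrite expr1n.
have [|z [Fz z1 zs]] := IH; first by move=> v vs; apply: hs; rewrite inE vs orbT.
have [h1 n01] := hs v1 (mem_head _ _); have [P1 _] := h1.
have [y [Fy y0 y1]] := place_separation h0 h1 n01.
have hsP v : v \in s -> place R F v.
  by move=> vs; have [|[]] := hs v; rewrite ?inE ?vs ?orbT.
have [le|gt] := leP (v1 z) 1.
  have [r Hr] : exists N, forall n, (N <= n)%N -> forall v, v \in s -> v z ^+ n < (v y + 1)^-1.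
    apply: eventually_all => v vs; have Pv := hsP v vs.
    apply: pow_small; [exact: (place_ge0 Pv)|exact: zs|].
    by rewrite invr_gt0 ltr_wpDl // (place_ge0 Pv).
  have FzX : F (z ^+ r) by apply: subfieldX.
  exists (z ^+ r * y); split; first exact: subfieldM.
    rewrite (placeM P0) // (placeX sF P0) //.
    apply: (lt_le_trans y0); rewrite ler_peMl ?(place_ge0 P0) //.
    by rewrite exprn_ege1 // ltW.
  move=> v; rewrite inE => /predU1P[->|vs].
    rewrite (placeM P1) // (placeX sF P1) //; apply: le_lt_trans y1.
    by rewrite ler_piMl ?(place_ge0 P1) // exprn_ile1 // (place_ge0 P1).
  have Pv := hsP v vs; have vy := place_ge0 Pv Fy.
  rewrite (placeM Pv) // (placeX sF Pv) //.
  have := Hr r (leqnn r) v vs; rewrite -[_^-1]mul1r ltr_pdivlMr; last by rewrite ltr_wpDl.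
  have : 0 <= v z ^+ r by rewrite exprn_ge0 // (place_ge0 Pv).
  by rewrite mulrDr mulr1; lra.
have Y0 : 0 < v0 y - 1 by rewrite subr_gt0.
have Y1 : 0 < 1 - v1 y by rewrite subr_gt0.
(* With t = z ^ r, the three thresholds say v0 t + 1 < v0 t * v0 y, v1 t * v1 y < v1 t - 1 and v t *
   v y < 1 - v t; each is compared with the value of 1 + t by the triangle inequality. *)
have [r1 Hr1] := pow_unbounded (v0 y - 1)^-1 z1.
have [r2 Hr2] := pow_unbounded (1 - v1 y)^-1 gt.
have [r3 Hr3] : exists N, forall n, (N <= n)%N -> forall v, v \in s -> v z ^+ n < (v y + 1)^-1.
  apply: eventually_all => v vs; have Pv := hsP v vs.
  apply: pow_small; [exact: (place_ge0 Pv)|exact: zs|].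
  by rewrite invr_gt0 ltr_wpDl // (place_ge0 Pv).
pose r := (r1 + r2 + r3)%N.
have {}Hr1 : (v0 y - 1)^-1 < v0 z ^+ r by apply: Hr1; rewrite /r -addnA leq_addr.
have {}Hr2 : (1 - v1 y)^-1 < v1 z ^+ r by apply: Hr2; rewrite /r addnAC leq_addl.
have {}Hr3 : forall v, v \in s -> v z ^+ r < (v y + 1)^-1 by apply: Hr3; rewrite /r leq_addl.
set t := z ^+ r; have Ft : F t by apply: subfieldX.
have F1 : F 1 := subfield1 sF.
have Ft1 : F (1 + t) by apply: subfieldD.
have Ft1V : F (1 + t)^-1 by apply: subfieldV.
have Fq : F (t / (1 + t)) by apply: subfieldM.
have yr : (1 + t) != 0.
  apply: contraTneq Hr2 => /eqP; rewrite addrC addr_eq0 => /eqP t1.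
  rewrite -(placeX sF P1) // -/t t1 (placeN sF P1) // (place1 sF P1) -leNgt invf_ge1 //.
  by rewrite gerBl (place_ge0 P1).
have vD v : place R F v -> v (t / (1 + t) * y) = v t * v y / v (1 + t).
  by move=> Pv; rewrite !(placeM Pv) // (placeV sF Pv) //; ring.
exists (t / (1 + t) * y); split; first exact: subfieldM.
- rewrite vD // ltr_pdivlMr ?(place_gt0 P0) // mul1r.
  apply: (le_lt_trans (placeD P0 F1 Ft)); rewrite (place1 sF P0).
  rewrite (placeX sF P0) //; move: Hr1; rewrite -[_^-1]mul1r ltr_pdivrMr //.
  by rewrite mulrBr mulr1; lra.
- move=> v; rewrite inE => /predU1P[->|vs].
    rewrite vD // ltr_pdivrMr ?(place_gt0 P1) // mul1r.
    have : v1 t <= v1 (1 + t) + 1.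
      have := placeD P1 Ft1 (subfieldN sF F1); rewrite (placeN sF P1 F1) (place1 sF P1).
      by rewrite addrAC subrr add0r.
    rewrite (placeX sF P1) //; move: Hr2; rewrite -[_^-1]mul1r ltr_pdivrMr //.
    by rewrite mulrBr mulr1; lra.
  have Pv := hsP v vs; have vy := place_ge0 Pv Fy.
  rewrite vD // ltr_pdivrMr ?(place_gt0 Pv) // mul1r.
  have : 1 <= v (1 + t) + v t.
    have := placeD Pv Ft1 (subfieldN sF Ft); rewrite (placeN sF Pv Ft).
    by rewrite addrK (place1 sF Pv).
  have := Hr3 v vs; rewrite -[_^-1]mul1r ltr_pdivlMr; last by rewrite ltr_wpDl.
  by rewrite -(placeX sF Pv) // -/t mulrDr mulr1; lra.
Qed.

(** With more than n places, the high powers of separating elements z_i satisfy a rational relation.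
    At the place whose coefficient is largest, the term of that index has at least the value of the
    coefficient, while each of the others has less than 1 / K of it: a contradiction. *)
Lemma places_over_size (n : nat) (g : 'I_n -> algC) (s : seq (algC -> R)) :
  qspan F g -> uniq s -> (forall v, v \in s -> place_over v) -> (size s <= n)%N.
Proof.
move=> [Fg gs] us hs; rewrite leqNgt; apply/negP => ns.
set K := size s in ns; pose v (i : 'I_K) := nth (fun _ => 0) s i.
have vs i : v i \in s by apply: mem_nth.
have vP i : place R F (v i) by case: (hs _ (vs i)).
have /choice[z zP] : forall i : 'I_K, exists z, [/\ F z, 1 < v i z & forall j, j != i -> v j z < 1].
  move=> i; have [|x|z [Fz z1 zs]] := @places_separation (v i) [seq x <- s | x != v i].
  - exact: hs.
  - by rewrite mem_filter /= => /andP[h xs]; split; [exact: hs|rewrite eq_sym].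
  exists z; split=> // j ji; apply: zs; rewrite mem_filter vs andbT /=.
  by rewrite nth_uniq.
have Fz i : F (z i) by case: (zP i).
have K0 : (0 < K)%N by apply: leq_ltn_trans ns.
have [r Hr] : exists N, forall m, (N <= m)%N -> forall ij : 'I_K * 'I_K,
    ij \in enum {: 'I_K * 'I_K} -> ij.2 != ij.1 -> v ij.2 (z ij.1) ^+ m < K%:R^-1.
  apply: eventually_all => -[i j] _ /=; have [->|ji] := eqVneq j i; first by exists 0%N.
  have [_ _ /(_ j ji) h] := zP i.
  have Kp : 0 < (K%:R : R)^-1 by rewrite invr_gt0 ltr0n.
  have [N HN] := pow_small (place_ge0 (vP j) (Fz i)) h Kp.
  by exists N => m /HN.
have {}Hr i j : j != i -> v j (z i) ^+ r < K%:R^-1.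
  by move=> ji; apply: (Hr r (leqnn r) (i, j)) => //; rewrite mem_enum.
have [|c [j0 cj0] c0] := @rat_dependence n K g (fun i => z i ^+ r) ns.
  by move=> j; apply: gs; apply: subfieldX.
pose a i := uabs R q (c i).
have [i0 _ Hi0] := arg_maxP a (isT : xpredT j0).
have vc i j : v j (ratr (c i)) = a i by apply: place_overE; apply: hs.
have FcZ i : F (ratr (c i)) by apply: subfield_rat.
have FzX i : F (z i ^+ r) by apply: subfieldX.
have a_gt0 : 0 < a i0.
  apply: lt_le_trans (Hi0 j0 isT); rewrite /= -(vc j0 i0) (place_gt0 (vP i0)) ?fmorph_eq0 //.
have := c0; rewrite (bigD1 i0) //= => /eqP; rewrite addr_eq0 => /eqP E0.
have : v i0 (ratr (c i0) * z i0 ^+ r) <= \sum_(i | i != i0) a i0 * K%:R^-1.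
  have FS : F (\sum_(i < K | i != i0) ratr (c i) * z i ^+ r).
    by apply: (subfield_sum sF) => i _; apply: subfieldM.
  rewrite E0 (placeN sF (vP i0)) //; apply: (le_trans (place_sum sF (vP i0) _ _ _)).
    by move=> i; apply: subfieldM.
  apply: ler_sum => i ii0; rewrite (placeM (vP i0)) // vc (placeX sF (vP i0)) //.
  apply: ler_pM; rewrite ?exprn_ge0 ?(place_ge0 (vP i0)) //.
  - by rewrite -(vc i i0) (place_ge0 (vP i0)).
  - exact: Hi0.
  - by rewrite ltW // Hr // eq_sym.
rewrite (placeM (vP i0)) // vc (placeX sF (vP i0)) // sumr_const cardC1 card_ord.
have : a i0 * 1 <= a i0 * v i0 (z i0) ^+ r.
  by rewrite ler_pM2l // exprn_ege1 // ltW //; case: (zP i0).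
move=> h1 h2; have := le_trans h1 h2; rewrite -mulrnAr ler_pM2l // -mulr_natr.
rewrite mulrC ler_pdivlMr ?ltr0n // mul1r ler_nat.
by rewrite -ltnS prednK // ltnn.
Qed.
End Places.

(** Reduction modulo a monic integral equation writes each power of [a] with integer coefficients
    and bounded degree. The powers of [v a] are thus bounded, which forces [v a <= 1]. *)
Lemma place_Aint_le1 (R : realType) (F : set algC) (p : nat) (v : algC -> R) (a : algC) :
  subfield F -> prime p -> place_over F p v -> F a -> a \in Aint -> v a <= 1.
Proof.
move=> sF pp [Pv vQ] Fa Aa; have [f mf fa] : integralOver (intr : int -> algC) a by apply/AintP.
have vint (z : int) : v z%:~R <= 1.
  rewrite -(ratr_int algC z) -[v _]/((fun c : rat => v (ratr c)) _) vQ.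
  by rewrite /uabs gtn_eqF ?prime_gt0 //; apply: padic_abs_int_le1.
have va0 := place_ge0 Pv Fa.
have bound k : v a ^+ k <= \sum_(i < size f) v a ^+ i.
  rewrite -(placeX sF Pv) //.
  have -> : a ^+ k = (ZtoC (Pdiv.Ring.rmodp 'X^k f)).[a].
    have := Pdiv.RingMonic.rdivp_eq mf 'X^k => /(congr1 (fun g => (ZtoC g).[a])).
    rewrite rmorphD rmorphM /= map_polyXn hornerD hornerM hornerXn => ->.
    by rewrite (eqP fa) mulr0 add0r.
  rewrite (@horner_coef_wide _ (size f)); last first.
    rewrite size_map_inj_poly //; last exact: intr_inj.
    by rewrite ltnW // Pdiv.Ring.ltn_rmodpN0 // monic_neq0.
  have Fc i : F (ZtoC (Pdiv.Ring.rmodp 'X^k f))`_i by rewrite coef_map; apply: subfield_int.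
  have FaX i : F (a ^+ i) by apply: subfieldX.
  apply: (le_trans (place_sum sF Pv _ _ _)) => [i|]; first exact: subfieldM.
  apply: ler_sum => i _; rewrite (placeM Pv) // (placeX sF Pv) //.
  by rewrite ler_piMl ?exprn_ge0 // coef_map vint.
rewrite leNgt; apply/negP => /(pow_unbounded (\sum_(i < size f) v a ^+ i))[N /(_ N (leqnn N))].
by rewrite ltNge bound.
Qed.

(** * Comparison of the height with the conjugates *)

Lemma Aint_multiple (x : algC) : exists2 m : int, m != 0 & m%:~R * x \in Aint.
Proof.
have [f fx [j fj]] := int_poly_root_prim x (isT : prime 2).
have f0 : f != 0 by apply: contraNneq fj => ->; rewrite coef0 absz0 dvdn0.
have sf : (0 < size f)%N by rewrite size_poly_gt0.
exists (lead_coef f); first by rewrite lead_coef_eq0.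
have := @Aint_lead_mul (ZtoC f) (size f).-1 x; rewrite coef_map; apply.
- by move=> i; rewrite coef_map; apply: Aint_int.
- by rewrite prednK // size_map_inj_poly //; exact: intr_inj.
- exact/eqP.
Qed.

(** If m x is integral with m a nonzero integer, a finite place with v x > 1 lies above a divisor of
    m. This leaves finitely many rational places, each with finitely many extensions. *)
Lemma finite_places_gt1 (R : realType) (F : set algC) (n : nat) (g : 'I_n -> algC) (x : algC) :
  subfield F -> qspan F g -> F x ->
  finite_set [set v : algC -> R | place R F v /\ 1 < v x].
Proof.
move=> sF hg Fx; have [m m0 Amx] := Aint_multiple x.
have fin q : is_pl q -> finite_set [set v : algC -> R | place_over F q v].
  move=> qP; apply: contrapT => /(@infinite_set_fset _ _ n.+1)[B BA].
  rewrite leqNgt ltnS; apply/negP; rewrite negbK.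
  by apply: (places_over_size sF qP hg); [exact: finmap.fset_uniq|move=> v vB; apply: BA].
pose M := `|m|%N.+1.
apply: (@sub_finite_set _ _ (\bigcup_(q in [set q | (q < M)%N /\ is_pl q])
    [set v : algC -> R | place_over F q v])); last first.
  apply: bigcup_finite; last by move=> q [_ qP]; apply: fin.
  by apply: (@sub_finite_set _ _ `I_M); [move=> q []|exact: finite_II].
move=> v [Pv vx]; case: (Pv) => _ _ _ _ /usual_absP[q qP vq].
exists q => //; split=> //; rewrite ltnS; case/orP: (qP) => [/eqP -> //|qp].
have vo : place_over F q v by [].
have qm : (q %| `|m|)%N.
  rewrite -(padic_abs_int_lt1 R qp); have := place_Aint_le1 sF qp vo (subfieldM sF (subfield_int sF m) Fx) Amx.
  have Fm := subfield_int sF m.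
  rewrite (placeM Pv) //.
  have -> : v m%:~R = padic_abs R q m%:~R.
    rewrite -(ratr_int algC m) -[v _]/((fun c : rat => v (ratr c)) _) vq.
    by rewrite /uabs gtn_eqF ?prime_gt0.
  have [u0 h|u0 _] := ltP 0 (padic_abs R q m%:~R); last exact: le_lt_trans u0 ltr01.
  by apply: lt_le_trans h; rewrite ltr_pMr.
by apply: dvdn_leq qm; rewrite absz_gt0.
Qed.

Lemma uabs_inj (R : realType) (q q' : nat) : is_pl q -> is_pl q' ->
  uabs R q = uabs R q' -> q = q'.
Proof.
have gt1 : uabs R 0 2%:R = 2 by rewrite /uabs eqxx /= ger0_norm // ratr_nat.
have u2 p : prime p -> uabs R p 2%:R <= 1.
  by move=> pp; rewrite /uabs gtn_eqF ?prime_gt0 //; apply: (padic_abs_int_le1 R pp 2).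
have h0 p : prime p -> uabs R 0 = uabs R p -> False.
  by move=> pp e; have := u2 p pp; rewrite -e gt1 leNgt ltr1n.
case/orP=> [/eqP ->|qp]; case/orP=> [/eqP ->|qp'] e //.
- by case: (h0 q').
- by case: (h0 q).
have : uabs R q q%:R < 1.
  by rewrite /uabs gtn_eqF ?prime_gt0 // padic_abs_p // invf_lt1 ?ltr0n ?ltr1n ?prime_gt1 ?prime_gt0.
rewrite e /uabs gtn_eqF ?prime_gt0 //.
rewrite (padic_abs_int_lt1 R qp' q) /= dvdn_prime2 // => /eqP //.
Qed.

Lemma prod_fibers (R : comNzRingType) (I T : eqType) (s : seq T) (l : seq I) (h : I -> T) (g : T -> R) :
  uniq s -> (forall i, h i \notin s -> g (h i) = 1) ->
  \prod_(i <- l) g (h i) = \prod_(v <- s) g v ^+ count (fun i => h i == v) l.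
Proof.
move=> us gs; elim: l => [|i l IH]; first by rewrite big_nil big1.
rewrite big_cons IH /=; under [RHS]eq_bigr do rewrite exprD.
rewrite big_split /=; congr (_ * _).
have [hs|hs] := boolP (h i \in s); last first.
  rewrite gs // big1_seq // => v /= vs; have [e|] := eqVneq (h i) v; last by rewrite expr0.
  by rewrite e vs in hs.
rewrite (bigD1_seq (h i)) //= eqxx expr1 big1 ?mulr1 // => v.
by rewrite eq_sym => /negbTE ->; rewrite expr0.
Qed.

(* The conjugates [nu r] of [x] inducing a place [v] through [W q] are at most
   [local_degree F v] in number. *)
Lemma height_lower_bound (R : realType) (x : algC) (rs : seq algC) (W : nat -> algC -> R) (B : nat) :
  (forall q, is_pl q -> valof q (W q)) -> uniq rs ->
  minCpoly x = \prod_(r <- rs) ('X - r%:P) ->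
  \prod_(0 <= q < B | is_pl q) \prod_(r <- rs) Num.max 1 (W q r) <= height R x ^+ size rs.
Proof.
move=> WP urs Drs; set F := smallest subfield [set x].
have sF : subfield F := subfield_smallest _.
have Fx : F x by move=> E [_ h]; apply: h.
have Dn : degree rationals F = size rs.
  by rewrite degree_adjoin Drs size_prod_XsubC.
have n0 : (0 < size rs)%N.
  by have := size_minCpoly x; rewrite Drs size_prod_XsubC.
have hg := basis_qspan (adjoin_basis x); rewrite -/F in hg.
have /choice[nu nuP] : forall r, exists nu : {rmorphism algC -> algC}, r \in rs -> nu x = r.
  move=> r; have [rrs|nrs] := boolP (r \in rs); last by exists idfun.
  by have [|nu ?] := @aut_of_root x r; [rewrite Drs root_prod_XsubC|exists nu].
pose S := [set v : algC -> R | place R F v /\ 1 < v x].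
have finS : finite_set S := finite_places_gt1 R sF hg Fx.
pose s := finmap.enum_fset (fset_set S).
have inS v : (v \in s) = (v \in S) by rewrite -(in_fset_set finS).
have us : uniq s := finmap.fset_uniq _.
pose g (v : algC -> R) := Num.max 1 (v x).
have g1 v : 1 <= g v by rewrite le_max lexx.
have -> : height R x = \prod_(v <- s) (g v `^ ((local_degree F v)%:R / (size rs)%:R)).
  rewrite /height /height_in -/F Dn (fsbigE s) //.
  - by rewrite big_seq_cond [RHS]big_seq; apply: eq_bigl => v; rewrite inS; apply: andb_idr => /set_mem[h _]; exact: mem_set.
  - by move=> v /=; rewrite inS => /set_mem[].
  - move=> v Pv; rewrite inS => /negP vS.
    have [vx|vx] := leP (v x) 1; first by rewrite powR1.
    by case: vS; apply: mem_set.
rewrite -prodrXl.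
(* [size rs] is the degree of [F], so raising to it clears the denominators of the exponents. *)
have -> : \prod_(v <- s) (g v `^ ((local_degree F v)%:R / (size rs)%:R)) ^+ size rs =
    \prod_(v <- s) g v ^+ local_degree F v.
  apply: eq_bigr => v _; rewrite -powR_mulrn ?powR_ge0 // -powRrM divfK ?powR_mulrn //.
    by apply: le_trans (g1 v).
  by rewrite pnatr_eq0 -lt0n.
(* [W q] pulled back along the conjugation [nu r] is a place of [F]; the value 0 outside [F] matches
   the normalization of [place]. *)
pose h (qr : nat * algC) : algC -> R := fun y => if `[< F y >] then W qr.1 (nu qr.2 y) else 0.
have hP q r : is_pl q -> place_over F q (h (q, r)).
  move=> qP; have [wA _ wE] := WP q qP.
  have hE y : F y -> h (q, r) y = W q (nu r y) by move=> Fy; rewrite /h asboolT.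
  have hQ : (fun c : rat => h (q, r) (ratr c)) = uabs R q.
    by apply/funext => c; rewrite hE ?fmorph_rat ?wE //; apply: subfield_rat.
  split=> //; split.
  - by move=> y nFy; rewrite /h asboolF.
  - move=> y Fy; rewrite hE // absval_ge0 //; split=> //.
    by split=> [/eqP|->]; rewrite ?absval_eq0 // ?fmorph_eq0 ?rmorph0 ?absval0 // => /eqP.
  - by move=> y z Fy Fz; rewrite !hE ?rmorphM ?absvalM //; apply: (subfieldM sF).
  - by move=> y z Fy Fz; rewrite !hE ?rmorphD ?absvalD //; apply: (subfieldD sF).
  - rewrite hQ; case/orP: qP => [/eqP ->|qp]; first by left.
    by right; exists q; rewrite // /uabs gtn_eqF ?prime_gt0.
pose l := [seq (q, r) | q <- [seq q <- iota 0 B | is_pl q], r <- rs].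
have lP qr : qr \in l -> is_pl qr.1 /\ qr.2 \in rs.
  by case/allpairsP => [[q r] [/= + ? ->]]; rewrite mem_filter => /andP[].
have ul : uniq l by apply: allpairs_uniq => //; rewrite ?filter_uniq ?iota_uniq // => -[? ?] [? ?].
have -> : \prod_(0 <= q < B | is_pl q) \prod_(r <- rs) Num.max 1 (W q r) = \prod_(qr <- l) g (h qr).
  rewrite big_allpairs_dep /= /index_iota subn0 big_filter big_seq_cond [RHS]big_seq_cond.
  apply: eq_bigr => q /andP[_ qP]; rewrite big_seq [RHS]big_seq; apply: eq_bigr => r rrs.
  by rewrite /g /h asboolT //= nuP.
have -> : \prod_(qr <- l) g (h qr) = \prod_(v <- s) g v ^+ count (fun qr => h qr == v) l.
  have -> : \prod_(qr <- l) g (h qr) = \prod_(qr <- l) (if h qr \in s then g (h qr) else 1).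
    rewrite big_seq [RHS]big_seq; apply: eq_bigr => -[q r] /lP[/= qP rrs].
    case: ifP => // /negbT; rewrite inS => /negP vS; rewrite /g max_l // leNgt.
    by apply/negP => vx; apply: vS; apply: mem_set; split=> //; case: (hP q r qP).
  rewrite (@prod_fibers R _ _ s l h (fun v => if v \in s then g v else 1)) //.
    by rewrite big_seq [RHS]big_seq; apply: eq_bigr => v ->.
  by move=> i /negbTE ->.
rewrite big_seq [X in _ <= X]big_seq; apply: ler_prod => v; rewrite inS => /set_mem[Pv vx].
have g0 : 0 <= g v by apply: le_trans (g1 v).
rewrite exprn_ge0 //=; apply: ler_weXn2l => //.
have [b hb] : exists b : 'I_(local_degree F v) -> nat -> algC, is_local_basis F v b.
  have [k hk] := local_basis_exists sF Pv hg.
  by rewrite /local_degree; case: xgetP => // /(_ k).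
rewrite -size_filter; set l' := [seq qr <- l | h qr == v].
have l'P i : (i < size l')%N -> [/\ is_pl (nth (0%N, 0) l' i).1, (nth (0%N, 0) l' i).2 \in rs
    & h (nth (0%N, 0) l' i) = v].
  move=> /(mem_nth (0%N, 0)); rewrite mem_filter => /andP[/eqP e /lP[]].
  by split.
have [->//|l0] := posnP (size l').
pose q0 := (nth (0%N, 0) l' 0).1; have [q0P _ hq0] := l'P 0%N l0.
(* Pairs inducing the same place have the same restriction to the rationals, hence the same [q]; the
   fibre therefore consists of distinct conjugates for a single [W q0]. *)
have qE i : (i < size l')%N -> (nth (0%N, 0) l' i).1 = q0.
  move=> il; have [qP _ hv] := l'P i il; apply: (uabs_inj (R := R)) => //.
  have [_ <-] := hP _ (nth (0%N, 0) l' i).2 qP; have [_ <-] := hP _ (nth (0%N, 0) l' 0).2 q0P.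
  by rewrite /q0 -!surjective_pairing hv hq0.
have [wA _ _] := WP q0 q0P.
apply: (@local_basis_size_ge R (W q0) v x (size l') (fun j => nu (nth (0%N, 0) l' j).2) _ b) => //.
  move=> i j; have [_ ri _] := l'P i (ltn_ord i); have [_ rj _] := l'P j (ltn_ord j).
  rewrite !nuP // => e; apply/val_inj/eqP; have ul' : uniq l' by rewrite filter_uniq.
  rewrite -(nth_uniq (0%N, 0) (ltn_ord i) (ltn_ord j) ul').
  rewrite [X in X == _]surjective_pairing [X in _ == X]surjective_pairing.
  by rewrite e !qE.
move=> j y Fy; have [_ _ <-] := l'P j (ltn_ord j).
by rewrite /h asboolT // qE.
Qed.

(** * Northcott's theorem in bounded degree *)

Lemma prod_is_pl (R : realType) (B : nat) (f : nat -> R) : (0 < B)%N ->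
  \prod_(0 <= q < B | is_pl q) f q = f 0%N * \prod_(0 <= q < B | prime q) f q.
Proof.
case: B => // B _; rewrite big_mkcond [in RHS]big_mkcond !big_nat_recl //= mul1r.
by congr (_ * _); apply: eq_bigr => q _; rewrite /is_pl.
Qed.

Lemma height_ge0 (R : realType) (x : algC) : 0 <= height R x.
Proof. by apply: prodr_ge0 => v _; apply: powR_ge0. Qed.

Lemma kappa_ge1 (R : realType) q : 1 <= kappa R q.
Proof. by rewrite /kappa; case: ifP => _; rewrite ?ler1n. Qed.

(** Multiplying by X - r makes each coefficient a difference of two terms, which costs one factor
    [kappa] and one factor max(1, w r). *)
Lemma coef_prod_XsubC_bound (R : realType) (q : nat) (w : algC -> R) (rs : seq algC) k :
  valof q w ->
  w (\prod_(r <- rs) ('X - r%:P))`_k <= kappa R q ^+ size rs * \prod_(r <- rs) Num.max 1 (w r).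
Proof.
move=> [wA wU _]; have k1 := kappa_ge1 R q.
elim: rs k => [|r rs IH] k.
  rewrite !big_nil coef1 mulr1 expr0; case: eqP => _ /=; last by rewrite absval0.
  by rewrite absval1.
rewrite !big_cons mulrBl coefB coefXM coefCM /= exprS.
set C := _ ^+ _; set A := \prod_(_ <- _) Num.max _ _; set p := \prod_(_ <- _) ('X - _).
have IHp j : w p`_j <= C * A by apply: IH.
have CA0 : 0 <= C * A by apply: le_trans (IHp 0%N); rewrite absval_ge0.
have -> : kappa R q * C * (Num.max 1 (w r) * A) = kappa R q * (Num.max 1 (w r) * (C * A)) by ring.
apply: (le_trans (wU _ _)); rewrite ler_pM2l ?(lt_le_trans ltr01) //.
have m1 : 1 <= Num.max 1 (w r) by rewrite le_max lexx.
rewrite ge_max; apply/andP; split.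
  case: eqP => _; first by rewrite absval0 // mulr_ge0 // (le_trans ler01).
  by apply: (le_trans (IHp _)); rewrite ler_peMl.
rewrite absvalN // absvalM //; apply: ler_pM; rewrite ?absval_ge0 //.
by rewrite le_max lexx orbT.
Qed.

Lemma max1_prod_ge1 (R : realType) (w : algC -> R) (rs : seq algC) :
  1 <= \prod_(r <- rs) Num.max 1 (w r).
Proof.
elim: rs => [|r rs IH]; first by rewrite big_nil.
by rewrite big_cons mulr_ege1 // le_max lexx.
Qed.

(** A prime power in the denominator of c is the p-adic value of c, so the denominator is at most
    the product of the finite contributions. The numerator is |c| times the denominator, and the
    archimedean coefficient bound brings in the power of 2. *)
Lemma minCpoly_coef_bound (R : realType) (x : algC) (q : {poly rat}) k :
  minCpoly x = QtoC q ->
  Num.max `|numq q`_k|%N%:R `|denq q`_k|%N%:R <=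
    2 ^+ (size q).-1 * height R x ^+ (size q).-1.
Proof.
move=> Dq; set M := _ * _ ^+ _; set c := q`_k; rewrite ge_max.
have [rs [urs Drs _]] := minCpoly_roots x.
have sq : (size q).-1 = size rs by rewrite -(size_map_poly (@ratr algC)) -Dq Drs size_prod_XsubC.
have /choice[W WP] : forall j, exists w : algC -> R, is_pl j -> valof j w.
  move=> j; case hj: (is_pl j); last by exists (fun _ => 0).
  by have [w hw] := @valof_exists R j hj; exists w.
pose A j := \prod_(r <- rs) Num.max 1 (W j r).
have A1 j : 1 <= A j by apply: max1_prod_ge1.
have A0 j : 0 < A j := lt_le_trans ltr01 (A1 j).
have bnd j : is_pl j -> uabs R j c <= kappa R j ^+ size rs * A j.
  move=> hj; have := coef_prod_XsubC_bound rs k (WP j hj); rewrite -Drs Dq coef_map.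
  by have [_ _ ->] := WP j hj.
pose B := (`|numq c| + `|denq c|).+1.
have T := height_lower_bound (R := R) B WP urs Drs.
rewrite prod_is_pl // -/(A 0%N) in T; set Ap := \prod_(_ <= _ < _ | _) _ in T.
have d0 : (0 < `|denq c|)%N by rewrite absz_gt0 denq_eq0.
have denA : `|denq c|%N%:R <= Ap.
  rewrite {1}(@nat_prod_primes _ B d0) ?ltnS ?leq_addl // natr_prod /Ap.
  apply: ler_prod => j hj; rewrite ler0n /= -/(A j).
  have [dj|dj] := boolP (j %| `|denq c|)%N; last first.
    by rewrite lognE hj d0 (negbTE dj) expn0.
  have c0 : c != 0 by apply: contraTneq dj => ->; rewrite dvdn1 gtn_eqF ?prime_gt1.
  have := bnd j; rewrite /is_pl hj orbT => /(_ isT).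
  rewrite /uabs /kappa gtn_eqF ?prime_gt0 // expr1n mul1r /padic_abs (negbTE c0).
  have nj : logn j `|numq c| = 0%N.
    apply/eqP; rewrite -leqn0 leqNgt logn_gt0 mem_primes hj absz_gt0 numq_eq0 c0 /=.
    apply/negP => nj; have := coprime_num_den c; rewrite /coprime => /eqP e.
    by have := dvdn_gcd j `|numq c| `|denq c|; rewrite e nj dj dvdn1 gtn_eqF ?prime_gt1.
  by rewrite nj expr0 divr1 natrX.
have AM : A 0%N * Ap <= height R x ^+ size rs by [].
have AM2 : 2 ^+ size rs * (A 0%N * Ap) <= M by rewrite /M sq ler_pM2l // exprn_gt0.
have Ap0 : 0 <= Ap by apply: le_trans denA.
have k2 : 1 <= (2 : R) ^+ size rs by rewrite exprn_ege1 // ler1n.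
apply/andP; split; last first.
  apply: le_trans AM2; apply: (le_trans denA).
  by rewrite mulrA ler_peMl // mulr_ege1.
have [c0|c0] := eqVneq c 0.
  rewrite c0 (numq_int 0) absz0; apply: le_trans AM2.
  by rewrite !mulr_ge0 ?exprn_ge0 // ltW.
have := bnd 0%N isT; rewrite /kappa eqxx /= => b0.
apply: le_trans AM2; rewrite mulrA.
have -> : `|numq c|%N%:R = uabs R 0 c * `|denq c|%N%:R.
  rewrite /uabs eqxx -[in ratr _](divq_num_den c) normrM normfV -!intr_norm -!abszE.
  by rewrite fmorph_div /= !ratr_int -!pmulrn divfK // pnatr_eq0 -lt0n.
apply: ler_pM => //; rewrite -(rmorph0 (@ratr R)) /uabs eqxx ler_rat //.
Qed.

Lemma finite_roots (f : {poly algC}) : f != 0 -> finite_set [set x | root f x].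
Proof.
move=> f0; have [rs Drs] := closed_field_poly_normal f.
apply: (@sub_finite_set _ _ [set` rs]); last exact/finite_seqP/(ex_intro _ rs).
by move=> x /=; rewrite Drs rootZ ?lead_coef_eq0 // root_prod_XsubC.
Qed.

Lemma northcott_bounded_degree (R : realType) (D : nat) (X : R) :
  finite_set [set x : algC | (size (minCpoly x) <= D.+1)%N /\ height R x <= X].
Proof.
(* Taking the maximum with 1 makes the bound increase with the degree, so that one [M] serves all
   degrees up to [D]. *)
pose M := 2 ^+ D * Num.max 1 X ^+ D; have M0 : 0 <= M by rewrite mulr_ge0 ?exprn_ge0 // le_max ler01.
pose N := Num.bound M.
pose cf (t : 'I_N * 'I_N * bool) : rat := (-1) ^+ t.2 * (t.1.1)%:R / (t.1.2)%:R.
pose P (a : {ffun 'I_D.+1 -> 'I_N * 'I_N * bool}) := \poly_(i < D.+1) cf (a (inord i)).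
apply: (@sub_finite_set _ _ (\bigcup_(a in [set a | P a != 0]) [set x | root (QtoC (P a)) x])); last first.
  apply: bigcup_finite; first exact: finite_finset.
  by move=> a /= Pa; apply: finite_roots; rewrite map_poly_eq0.
move=> x [sx hx]; have [q [Dq mq] _] := minCpolyP x.
have sq : (size q <= D.+1)%N by rewrite Dq size_map_poly in sx.
have H0 := height_ge0 R x.
have m1 : 1 <= Num.max 1 X by rewrite le_max lexx.
have hm : height R x <= Num.max 1 X by rewrite le_max hx orbT.
have bnd k : (`|numq q`_k| < N)%N && (`|denq q`_k| < N)%N.
  have MM : 2 ^+ (size q).-1 * height R x ^+ (size q).-1 <= M.
    apply: ler_pM; rewrite ?exprn_ge0 //.
      by apply: ler_weXn2l; rewrite ?ler1n //; case: (size q) sq.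
    apply: (@le_trans _ _ (Num.max 1 X ^+ (size q).-1)).
      by apply: lerXn2r; rewrite ?nnegrE //; apply: le_trans m1.
    by apply: ler_weXn2l => //; case: (size q) sq.
  have MN := archi_boundP M0.
  have := minCpoly_coef_bound R k Dq; rewrite ge_max => /andP[h1 h2].
  by rewrite -!(ltr_nat R) (le_lt_trans h1) ?(le_lt_trans h2) // (le_lt_trans MM).
have b1 k : (`|numq q`_k| < N)%N by case/andP: (bnd k).
have b2 k : (`|denq q`_k| < N)%N by case/andP: (bnd k).
pose a := [ffun i : 'I_D.+1 => (Ordinal (b1 i), Ordinal (b2 i), (q`_i < 0))].
have Pa : P a = q.
  apply/polyP => k; rewrite coef_poly; case: ltnP => [kD|Dk]; last first.
    by rewrite nth_default // (leq_trans sq).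
  rewrite /cf ffunE /= inordK // -[RHS]divq_num_den; congr (_ / _).
    rewrite [in RHS](intEsign (numq _)) rmorphM rmorph_sign /= numq_lt0 -pmulrn //.
  by rewrite [in RHS](intEsign (denq _)) ltNge denq_ge0 mul1r -pmulrn.
exists a; rewrite /= Pa; first exact: monic_neq0.
by rewrite -Dq root_minCpoly.
Qed.

(** * Ultrametric estimates *)

Section Padic.
Variables (R : realType) (p : nat) (w : algC -> R).
Hypotheses (pp : prime p) (wP : valof p w).

Let wA : absval w. Proof. by case: wP. Qed.

Lemma padic_p : w p%:R = p%:R^-1.
Proof.
case: wP => _ _ /(_ p%:R); rewrite ratr_nat => ->.
by rewrite /uabs gtn_eqF ?prime_gt0 // padic_abs_p.
Qed.

Lemma padic_ultra x y : w (x + y) <= Num.max (w x) (w y).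
Proof. by case: wP => _ /(_ x y) + _; rewrite /kappa gtn_eqF ?prime_gt0 // mul1r. Qed.

Lemma padicD_le x y M : w x <= M -> w y <= M -> w (x + y) <= M.
Proof. by move=> hx hy; apply: (le_trans (padic_ultra x y)); rewrite ge_max hx. Qed.

Lemma padicD_lt x y M : w x < M -> w y < M -> w (x + y) < M.
Proof. by move=> hx hy; apply: (le_lt_trans (padic_ultra x y)); rewrite gt_max hx. Qed.

Lemma padicB_le x y M : w x <= M -> w y <= M -> w (x - y) <= M.
Proof. by move=> hx hy; apply: padicD_le; rewrite ?absvalN. Qed.

Lemma padic_sum_le I (r : seq I) (P : pred I) (f : I -> algC) M : 0 <= M ->
  (forall i, P i -> w (f i) <= M) -> w (\sum_(i <- r | P i) f i) <= M.
Proof. by move=> M0 h; apply: (big_ind (fun z => w z <= M)) => // [|x y]; [rewrite absval0|apply: padicD_le]. Qed.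

Lemma padic_sum_lt I (r : seq I) (P : pred I) (f : I -> algC) M : 0 < M ->
  (forall i, P i -> w (f i) < M) -> w (\sum_(i <- r | P i) f i) < M.
Proof. by move=> M0 h; apply: (big_ind (fun z => w z < M)) => // [|x y]; [rewrite absval0|apply: padicD_lt]. Qed.

Lemma padic_isosceles x y : w x < w y -> w (x + y) = w y.
Proof.
move=> h; apply/eqP; rewrite eq_le padicD_le ?(ltW h) //= leNgt; apply/negP => h2.
have : w y < w y; last by rewrite ltxx.
rewrite {1}(_ : y = (x + y) + - x); last by ring.
by apply: padicD_lt; rewrite ?absvalN.
Qed.

Lemma padic_int (n : int) : w n%:~R <= 1.
Proof.
case: wP => _ _ /(_ n%:~R); rewrite ratr_int => ->.
by rewrite /uabs gtn_eqF ?prime_gt0 // padic_abs_int_le1.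
Qed.

Lemma padic_int_lt1 (n : int) : (w n%:~R < 1) = (p %| `|n|)%N.
Proof.
case: wP => _ _ /(_ n%:~R); rewrite ratr_int => ->.
by rewrite /uabs gtn_eqF ?prime_gt0 // padic_abs_int_lt1.
Qed.

Lemma padic_Aint a : a \in Aint -> w a <= 1.
Proof.
move=> Aa; apply: (@place_Aint_le1 R setT p) => //; first exact: subfieldP.
case: wP => [[w1 w2 w3 w4] _ wQ]; have wE : (fun c : rat => w (ratr c)) = uabs R p by exact/funext.
split=> //; split=> [x []//|x _|x y _ _|x y _ _|]; [by split|exact: w3|exact: w4|].
by rewrite wE; right; exists p; rewrite // /uabs gtn_eqF ?prime_gt0.
Qed.

Lemma padic_rat (c : rat) : c != 0 -> exists z : int, w (ratr c) = p%:R ^ z.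
Proof.
case: wP => _ _ -> c0; have [z hz] := padic_abs_pow R pp c0; exists z.
by rewrite /uabs gtn_eqF ?prime_gt0.
Qed.

Lemma padic_valof_comp (nu : {rmorphism algC -> algC}) : valof p (w \o nu).
Proof.
case: wP => _ h1 h2; split; first exact: absval_comp.
- by move=> x y /=; rewrite rmorphD.
- by move=> c /=; rewrite fmorph_rat.
Qed.

(** Ramification index one at [w], in terms of the value group, so that it makes sense for subfields
    of any degree. *)
Definition pvalues (E : set algC) : Prop :=
  forall y, E y -> y != 0 -> exists z : int, w y = p%:R ^ z.

Lemma sum_distinct_values (n : nat) (t : 'I_n -> algC) :
  (forall i j, w (t i) = w (t j) -> t i != 0 -> i = j) ->
  forall j, w (t j) <= w (\sum_i t i).
Proof.
move=> inj j; have [i _ Hi] := arg_maxP (fun i => w (t i)) (isT : xpredT j).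
apply: (le_trans (Hi j isT)) => /=.
have [ti0|ti0] := eqVneq (t i) 0; first by rewrite ti0 absval0 ?absval_ge0.
rewrite (bigD1 i) //= addrC padic_isosceles //.
apply: padic_sum_lt; first by rewrite absval_gt0.
move=> k ki; have hk : w (t k) <= w (t i) := Hi k isT.
rewrite lt_neqAle hk andbT; apply: contra_neq ki => e.
by rewrite (inj i k) // e.
Qed.

(** The n-th powers of the values of the terms have exponents congruent to -j modulo n. Nonzero
    terms thus have distinct values, and the largest of them is the value of the sum. *)
Lemma sum_uniformizer_powers (n : nat) (pi : algC) (E : set algC) (a : 'I_n -> algC) :
  w pi ^+ n = p%:R^-1 -> pvalues E -> (forall i, E (a i)) ->
  forall j, w (a j * pi ^+ j) <= w (\sum_(i < n) a i * pi ^+ i).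
Proof.
move=> wpi Ev Ea; apply: sum_distinct_values => i j + t0.
have p1 : 1 < (p%:R : R) by rewrite ltr1n prime_gt1.
have p0 : (p%:R : R) != 0 by rewrite pnatr_eq0 -lt0n prime_gt0.
move=> e; have ai0 : a i != 0 by apply: contraNneq t0 => ->; rewrite mul0r.
have tj0 : w (a j * pi ^+ j) != 0 by rewrite -e absval_eq0.
have aj0 : a j != 0 by apply: contraNneq tj0 => ->; rewrite mul0r absval0.
have [z hz] := Ev _ (Ea i) ai0; have [u hu] := Ev _ (Ea j) aj0.
have n0 : (0 < n)%N by apply: leq_ltn_trans (ltn_ord i).
have val (k : 'I_n) (s : int) : w (a k) = p%:R ^ s -> w (a k * pi ^+ k) ^+ n = p%:R ^ (s * n%:Z - k%:Z).
  move=> hs; rewrite absvalM // absvalX // exprMn hs exprAC wpi expfzDr //.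
  by rewrite -invr_expz exprVn [(_ ^ s) ^+ n]exprnP exprz_exp.
have := congr1 (fun x => x ^+ n) e; rewrite (val i z hz) (val j u hu).
have gt1 (k l : int) : (p%:R : R) ^ k = p%:R ^ l -> k = l.
  wlog kl : k l / k <= l.
    by move=> W; have [/W//|/ltW/W h /esym/h] := leP k l.
  move=> /eqP; rewrite -[l](subrK k) addrC expfzDr // -[X in X == _]mulr1.
  rewrite (inj_eq (mulfI (expfz_neq0 _ p0))) => /eqP.
  have : 0 <= l - k by rewrite subr_ge0.
  case: (l - k) => // m _; rewrite -exprnP; case: m => [|m]; first by rewrite addr0.
  by move/eqP; rewrite lt_eqF // exprn_egt1.
move/gt1 => h; apply/val_inj/eqP; rewrite /= -(modn_small (ltn_ord i)) -(modn_small (ltn_ord j)).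
have : (i%:Z = j%:Z %[mod n%:Z])%Z.
  have -> : i%:Z = (z - u) * n%:Z + j%:Z by rewrite mulrBl; lia.
  by rewrite modzMDl.
by rewrite !modz_nat => -[->].
Qed.
End Padic.

(** * A uniformizer at a totally ramified prime *)

Section TotalRamification.
Variables (R : realType) (p : nat) (F : set algC).
Hypotheses (pp : prime p) (sF : subfield F).
Local Notation O := (ring_of_integers F).

Lemma ringO_M x y : O x -> O y -> O (x * y).
Proof. by move=> [Fx Ax] [Fy Ay]; split; [exact: subfieldM|exact: rpredM]. Qed.
Lemma ringO_D x y : O x -> O y -> O (x + y).
Proof. by move=> [Fx Ax] [Fy Ay]; split; [exact: subfieldD|exact: rpredD]. Qed.
Lemma ringO_int (n : int) : O n%:~R.
Proof. by split; [exact: subfield_int|exact: Aint_int]. Qed.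
Lemma ringO_nat (n : nat) : O n%:R.
Proof. by have := ringO_int n; rewrite -pmulrn. Qed.
Lemma ringO1 : O 1. Proof. exact: (ringO_int 1). Qed.
Lemma ringO_X x n : O x -> O (x ^+ n).
Proof. by move=> [Fx Ax]; split; [exact: subfieldX|exact: rpredX]. Qed.
Lemma ringO_horner (f : {poly int}) x : O x -> O (ZtoC f).[x].
Proof.
move=> Ox; rewrite horner_coef; elim/big_ind: _ => [||i _].
- exact: (ringO_int 0).
- exact: ringO_D.
- by rewrite coef_map; apply: ringO_M; [exact: ringO_int|exact: ringO_X].
Qed.

Lemma ideal_sum I (J : set algC) (r : seq I) (P : pred I) (f : I -> algC) :
  is_ideal O J -> (forall i, P i -> J (f i)) -> J (\sum_(i <- r | P i) f i).
Proof. by move=> [_ J0 JD _] h; elim/big_ind: _. Qed.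

Lemma ideal_exp_sub J k : is_ideal O J -> ideal_exp O J k `<=` O.
Proof.
move=> [JO _ _ _]; elim: k => // k IH _ [m [a [b [Ja Jb ->]]]].
elim/big_ind: _ => [||i _]; [exact: (ringO_int 0)|exact: ringO_D|].
by apply: ringO_M; [exact/JO/Ja|exact/IH/Jb].
Qed.

Lemma ideal_exp_pow J k y : J y -> ideal_exp O J k (y ^+ k).
Proof.
move=> Jy; elim: k => [|k IH]; first exact: ringO1.
exists 1%N, (fun=> y), (fun=> y ^+ k); split=> //.
by rewrite big_ord_recl big_ord0 addr0 exprS.
Qed.

(** Used by contradiction: since p lies in the n-th power of P, some element of P must have value at
    least p ^ (-1 / n). *)
Lemma ideal_exp_lt (w : algC -> R) J (t : R) k : valof p w -> is_ideal O J -> 0 < t ->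
  (forall a, J a -> w a < t) -> forall z, ideal_exp O J k.+1 z -> w z < t ^+ k.+1.
Proof.
move=> wP iJ t0 Jt; have [wA _ _] := wP; have [JO _ _ _] := iJ.
elim: k => [|k IH] z [m [a [b [Ja Jb ->]]]].
  rewrite expr1; apply: (padic_sum_lt pp wP) => // i _; rewrite absvalM //.
  apply: le_lt_trans (Jt _ (Ja i)); rewrite ler_piMr ?absval_ge0 //.
  by apply: (padic_Aint pp wP); have [] := Jb i.
apply: (padic_sum_lt pp wP) => [|i _]; first by rewrite exprn_gt0.
rewrite absvalM // exprS; apply: (@le_lt_trans _ _ (w (a i) * t ^+ k.+1)).
  by rewrite ler_wpM2l ?absval_ge0 //; apply/ltW/IH/Jb.
by rewrite ltr_pM2r ?exprn_gt0 //; apply: Jt.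
Qed.

Lemma prime_ideal_pow P y k : prime_ideal O P -> O y -> ~ P y -> ~ P (y ^+ k).
Proof.
move=> [_ P1 Pp] Oy nPy; elim: k => [//|k IH]; rewrite exprS => /Pp.
by case=> //; apply: ringO_X.
Qed.

(* If [y] is not in [P], reducing an integral equation of [y] modulo [p] gives
   an element of [P] congruent modulo [y] to an integer prime to [p]. *)
Lemma prime_ideal_center (w : algC -> R) P : valof p w -> prime_ideal O P -> P p%:R ->
  (forall y, P y -> w y < 1) -> forall y, O y -> w y < 1 -> P y.
Proof.
move=> wP primeP Pp Pw y Oy wy; apply: contrapT => nPy.
have [wA _ _] := wP; have [[PO P0 PD PM] P1 Ppr] := primeP.
have [Fy Ay] := Oy; have [f mf fy] : integralOver (intr : int -> algC) y by apply/AintP.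
have ex_k : exists k, ~~ (p %| absz (f`_k)%R)%N.
  exists (size f).-1; rewrite -/(lead_coef f) (monicP mf) /= dvdn1 gtn_eqF //.
  exact: prime_gt1.
pose k := ex_minn ex_k.
have [fk kmin] : ~~ (p %| absz (f`_k)%R)%N /\ forall i, (i < k)%N -> (p %| absz (f`_i)%R)%N.
  rewrite /k; case: ex_minnP => l h1 h2; split=> // i il; apply: contraT => /h2.
  by rewrite leqNgt il.
have Phi : P ((ZtoC (take_poly k f)).[y]).
  rewrite horner_coef; apply: (ideal_sum (J := P)) => [|i _]; first by case: primeP.
  have /dvdzP[c Dc] : (p%:Z %| (take_poly k f)`_i)%Z.
    rewrite coef_take_poly; case: ifP => [ik|_]; last exact: dvdz0.
    by rewrite dvdzE /=; apply: kmin.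
  rewrite coef_map Dc /= intrM -pmulrn mulrAC; apply: PM => //.
  by apply: ringO_M; [exact: ringO_int|exact: ringO_X].
have Plo : P (y ^+ k * (ZtoC (drop_poly k f)).[y]).
  have := eqP fy; rewrite -{1}(poly_take_drop k f) rmorphD rmorphM /= map_polyXn.
  rewrite hornerD hornerM hornerXn addrC => /eqP; rewrite addr_eq0 mulrC => /eqP ->.
  by rewrite -mulN1r; apply: PM => //; apply: (ringO_int (-1)).
have [|Pg] := Ppr _ _ (ringO_X k Oy) (ringO_horner (drop_poly k f) Oy) Plo.
  by apply: prime_ideal_pow.
have Eg : (ZtoC (drop_poly k f)).[y] = (f`_k)%:~R + y * (ZtoC (drop_poly k.+1 f)).[y].
  have -> : drop_poly k f = (f`_k)%:P + 'X * drop_poly k.+1 f.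
    apply/polyP => l; rewrite coefD coefC coefXM !coef_drop_poly.
    by case: l => [|l]; rewrite ?addr0 //= add0r addSnnS.
  by rewrite rmorphD rmorphM /= map_polyC map_polyX hornerD hornerC hornerM hornerX.
move/negP: fk; apply; rewrite -(padic_int_lt1 pp wP).
have -> : (f`_k)%:~R = (ZtoC (drop_poly k f)).[y] - y * (ZtoC (drop_poly k.+1 f)).[y].
  by rewrite Eg addrK.
apply: (padicD_lt pp wP); first exact: Pw.
rewrite absvalN // absvalM //; apply: le_lt_trans wy; rewrite ler_piMr ?absval_ge0 //.
by apply: (padic_Aint pp wP); case: (ringO_horner (drop_poly k.+1 f) Oy).
Qed.

Lemma ideal_exp_subl P n : (0 < n)%N -> is_ideal O P -> ideal_exp O P n `<=` P.
Proof.
case: n => // n _ iP z [m [a [b [Pa Pb ->]]]]; apply: (ideal_sum (J := P)) => // i _.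
case: (iP) => PO _ _ PM; rewrite mulrC; apply: PM => //.
exact: (ideal_exp_sub iP (Pb i)).
Qed.

(** Any pi in P satisfies pi ^ n = p u with u integral. If pi has value at least p ^ (-1 / n) at one
    extension, then u has value 1 there and is outside P. By [prime_ideal_center] every extension is
    centred at P, so u has value 1 at all of them. *)
Lemma totally_ramified_uniformizer : (exists n (b : 'I_n -> algC), qspan F b) ->
  ramifies_totally p F ->
  exists2 pi, O pi & forall w : algC -> R, valof p w ->
    w pi ^+ degree rationals F = p%:R^-1.
Proof.
move=> [N [bN hN]] [P primeP Dp]; set n0 := degree _ _ in Dp *.
have [_ [b hb]] := degree_qspan hN; rewrite -/n0 in b hb.
have n_gt0 : (0 < n0)%N.
  case: (n0) b hb => // b [_ /(_ 1 (subfield1 sF))[c _ +] _].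
  by rewrite big_ord0 => /eqP; rewrite oner_eq0.
have p1 : 1 < (p%:R : R) by rewrite ltr1n prime_gt1.
have p0 : 0 < (p%:R : R) by rewrite (lt_trans ltr01).
have iP : is_ideal O P by case: primeP.
have pE : ideal_exp O P n0 p%:R by rewrite -Dp; exists 1; [exact: ringO1|rewrite mulr1].
have Pp : P p%:R by apply: (ideal_exp_subl n_gt0 iP).
have Ppow y : P y -> exists2 u, O u & y ^+ n0 = p%:R * u.
  by move=> /(@ideal_exp_pow P n0); rewrite -Dp => -[u Ou <-]; exists u.
have wpow (w : algC -> R) y : valof p w -> P y -> w y ^+ n0 <= p%:R^-1.
  move=> wP /Ppow[u [_ Au] Dy]; have [wA _ _] := wP.
  rewrite -absvalX // Dy absvalM // (padic_p pp wP) ler_piMr ?invr_ge0 ?(ltW p0) //.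
  exact: (padic_Aint pp wP).
have Pw (w : algC -> R) : valof p w -> forall y, P y -> w y < 1.
  move=> wP y Py; have [wA _ _] := wP; have := wpow w y wP Py.
  rewrite ltNge => h; apply/negP => h1.
  have : 1 <= w y ^+ n0 by rewrite exprn_ege1.
  by move=> /le_trans /(_ h); rewrite leNgt invf_lt1 ?p1.
have [w0 w0P] : exists w : algC -> R, valof p w by apply: valof_exists; rewrite /is_pl pp orbT.
have [w0A _ _] := w0P.
pose t : R := p%:R^-1 `^ n0%:R^-1.
have t0 : 0 < t by rewrite powR_gt0 ?invr_gt0.
have tn : t ^+ n0 = p%:R^-1.
  by rewrite -powR_mulrn ?ltW // -powRrM mulVf ?powRr1 ?invr_ge0 ?ltW // pnatr_eq0 -lt0n.
have [pi Ppi pit] : exists2 pi, P pi & t <= w0 pi.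
  apply: contrapT => no; have h a : P a -> w0 a < t.
    by move=> Pa; rewrite ltNge; apply/negP => ta; apply: no; exists a.
  have := ideal_exp_lt (k := n0.-1) w0P iP t0 h; rewrite prednK // tn => /(_ _ pE).
  by rewrite (padic_p pp w0P) ltxx.
have [u Ou Du] := Ppow pi Ppi.
have [PO _ _ _] := iP.
have w0u : w0 u = 1.
  apply/eqP; rewrite eq_le (padic_Aint pp w0P) //=; last by case: Ou.
  have : t ^+ n0 <= w0 pi ^+ n0 by rewrite lerXn2r ?nnegrE ?absval_ge0 // ltW.
  rewrite tn -absvalX // Du absvalM // (padic_p pp w0P) => h.
  by rewrite -(ler_pM2l (x := p%:R^-1)) ?invr_gt0 // mulr1.
have nPu : ~ P u by move=> /(Pw w0 w0P); rewrite w0u ltxx.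
exists pi; first exact: PO.
move=> w wP; have [wA _ _] := wP.
rewrite -absvalX // Du absvalM // (padic_p pp wP).
have -> : w u = 1; last by rewrite mulr1.
apply/eqP; rewrite eq_le (padic_Aint pp wP) /=; last by case: Ou.
rewrite leNgt; apply/negP => wu; apply: nPu.
exact: (prime_ideal_center wP primeP Pp (Pw w wP)).
Qed.
End TotalRamification.

(** * Expansion in powers of the uniformizer and the action of sigma *)

Section UniformizerSpan.
Variables (R : realType) (p n : nat) (E F : set algC) (pi : algC).
Hypotheses (pp : prime p) (sE : subfield E) (sF : subfield F).
Hypotheses (Fpi : F pi) (Fn : has_degree rationals F n).
Hypothesis wpi : forall w : algC -> R, valof p w -> w pi ^+ n = p%:R^-1.

Lemma pvalues_rationals (w : algC -> R) : valof p w -> pvalues p w rationals.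
Proof.
move=> wP y /rationalsP[c ->] c0; apply: (padic_rat pp wP).
by rewrite fmorph_eq0 in c0.
Qed.

(** Together with x the n powers of [pi] are n + 1 elements of an n-dimensional space. In a relation
    between them x has a nonzero coefficient, because powers of [pi] alone have independent
    values. *)
Lemma uniformizer_span x : F x -> exists c : 'I_n -> rat, x = \sum_i ratr (c i) * pi ^+ i.
Proof.
move=> Fx; have [b hb] := Fn; have [_ bs] := basis_qspan hb.
have [w wP] : exists w : algC -> R, valof p w by apply: valof_exists; rewrite /is_pl pp orbT.
have [wA _ _] := wP.
have [|k k0 ks] := @rat_dependence n n.+1 b
  (fun i => if unlift ord0 i is Some j then pi ^+ j else x) (ltnSn n).
  by move=> i; apply: bs; case: unlift => [j|] //; apply: subfieldX.
move: ks; rewrite big_ord_recl unlift_none; under eq_bigr do rewrite liftK.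
set q := k ord0; set a := fun j => k (lift ord0 j).
rewrite -[X in _ + X]/(\sum_(j < n) ratr (a j) * pi ^+ j) => ks.
have [q0|q0] := eqVneq q 0.
  exfalso; case: k0 => i; have [j ->|->] := unliftP ord0 i; last by rewrite -/q q0 eqxx.
  move: ks; rewrite q0 rmorph0 mul0r add0r => ks; rewrite -/(a j) => aj.
  have := @sum_uniformizer_powers R p w pp wP n pi rationals (fun j => ratr (a j)) (wpi wP)
    (pvalues_rationals wP) _ j; rewrite ks absval0 // => h.
  have pi0 : pi != 0.
    have := wpi wP; apply: contra_eq_neq => ->; rewrite absval0 // expr0n.
    rewrite gtn_eqF; last by apply: leq_ltn_trans (ltn_ord j).
    by rewrite eq_sym invr_eq0 pnatr_eq0 -lt0n prime_gt0.
  have : w (ratr (a j) * pi ^+ j) <= 0 by apply: h => l; apply/rationalsP; exists (a l).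
  by rewrite leNgt absval_gt0 // mulf_neq0 ?fmorph_eq0 ?expf_neq0.
exists (fun j => - a j / q).
have qC : ratr q != 0 :> algC by rewrite fmorph_eq0.
apply: (mulfI qC); rewrite mulr_sumr; move/eqP: ks; rewrite addr_eq0 => /eqP ->.
rewrite -sumrN; apply: eq_bigr => j _; rewrite fmorph_div rmorphN /=.
by rewrite mulrA mulrCA divff // mulr1 mulNr.
Qed.

Definition uspan : set algC :=
  [set x | exists2 a : 'I_n -> algC, forall i, E (a i) & x = \sum_i a i * pi ^+ i].

Let n_gt0 : (0 < n)%N.
Proof.
case: n Fn => // -[b [_ /(_ 1 (subfield1 sF))[c _ +] _]].
by rewrite big_ord0 => /eqP; rewrite oner_eq0.
Qed.

Let uspanD x y : uspan x -> uspan y -> uspan (x + y).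
Proof.
move=> [a Ea ->] [b Eb ->]; exists (fun i => a i + b i) => [i|]; first exact: subfieldD.
by rewrite -big_split; apply: eq_bigr => i _; rewrite mulrDl.
Qed.

Let uspanZ c x : E c -> uspan x -> uspan (c * x).
Proof.
move=> Ec [a Ea ->]; exists (fun i => c * a i) => [i|]; first exact: subfieldM.
by rewrite mulr_sumr; apply: eq_bigr => i _; rewrite mulrA.
Qed.

Lemma uspan_extension : F `<=` uspan.
Proof.
move=> x /uniformizer_span[c ->]; exists (fun i => ratr (c i)) => // i.
exact: subfield_rat.
Qed.

Lemma uspan_base : E `<=` uspan.
Proof.
move=> x Ex; rewrite -[x]mulr1; apply: uspanZ => //.
by apply: uspan_extension; apply: subfield1.
Qed.

(** A product of two powers of [pi] lies in [F], hence is again a rational combination of the first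
    n powers. Containing both [E] and [F], the span then contains their compositum. *)
Lemma subfield_uspan : subfield uspan.
Proof.
have sum I (r : seq I) (f : I -> algC) : (forall i, uspan (f i)) -> uspan (\sum_(i <- r) f i).
  by move=> h; elim/big_ind: _ => [|x y|i _]; [apply/uspan_base/(subfield0 sE)|exact: uspanD|exact: h].
apply: subfield_of_subring => //; [by apply/uspan_base/(subfield1 sE)|by move=> q; apply/uspan_base/(subfield_rat sE)|].
move=> _ _ [a Ea ->] [b Eb ->]; rewrite mulr_suml; apply: (sum) => i.
rewrite mulr_sumr; apply: (sum) => j.
rewrite mulrACA -exprD; apply: uspanZ; first exact: subfieldM.
by apply: uspan_extension; apply: subfieldX.
Qed.

Variables (w : algC -> R) (sigma : {rmorphism algC -> algC}).
Hypotheses (wP : valof p w) (Ew : pvalues p w E) (sigmaE : forall y, E y -> sigma y = y).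

Let wA : absval w. Proof. by case: wP. Qed.
Let w'P : valof p (w \o sigma). Proof. exact: padic_valof_comp. Qed.
Let Ew' : pvalues p (w \o sigma) E.
Proof. by move=> y Ey y0; rewrite /= sigmaE //; apply: Ew. Qed.
Let p0 : 0 < (p%:R : R). Proof. by rewrite ltr0n prime_gt0. Qed.
Let p1 : 1 < (p%:R : R). Proof. by rewrite ltr1n prime_gt1. Qed.

Let wsigma_pi : w (sigma pi) = w pi.
Proof.
apply/eqP; rewrite -(eqrXn2 n_gt0) ?absval_ge0 //.
by rewrite (wpi wP) -(wpi w'P).
Qed.

Let wterm (a : 'I_n -> algC) j : (forall i, E (a i)) ->
  w (sigma (a j * pi ^+ j)) = w (a j * pi ^+ j).
Proof. by move=> Ea; rewrite rmorphM rmorphXn /= sigmaE // !absvalM // !absvalX // wsigma_pi. Qed.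

(** [w] and [w \o sigma] agree on [E] and on [pi], hence on each term of the expansion, and on the
    span both are the maximum over the terms. *)
Let w_uspan_sigma x : uspan x -> w (sigma x) = w x.
Proof.
move=> [a Ea ->]; apply/eqP; rewrite eq_le; apply/andP; split.
  rewrite rmorph_sum; apply: (padic_sum_le pp wP); first exact: absval_ge0.
  by move=> j _; rewrite wterm //; apply: (sum_uniformizer_powers pp wP (wpi wP) Ew Ea).
apply: (padic_sum_le pp wP); first exact: absval_ge0.
by move=> j _; rewrite -wterm //; apply: (sum_uniformizer_powers pp w'P (wpi w'P) Ew' Ea).
Qed.

Let wpi_gt0 : 0 < w pi.
Proof.
rewrite lt_def absval_ge0 // andbT; apply: contra_eq_neq (wpi wP) => ->.
by rewrite expr0n gtn_eqF // eq_sym invr_eq0 gt_eqF.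
Qed.

Let wpi_lt1 : w pi < 1.
Proof.
rewrite ltNge; apply/negP => h; have : 1 <= w pi ^+ n by rewrite exprn_ege1.
by rewrite (wpi wP) leNgt invf_lt1 ?p1.
Qed.

(** The coefficients of an integral x turn out to be integral. The term of index 0 lies in [E] and
    cancels, and every other term keeps a factor of the size of [pi]. *)
Let uspan_sub_integral x : uspan x -> w x <= 1 -> w (x - sigma x) <= w pi.
Proof.
move=> [a Ea Dx] wx.
have h j : w (a j * pi ^+ j) <= 1.
  by apply: le_trans wx; rewrite Dx; apply: (sum_uniformizer_powers pp wP (wpi wP) Ew Ea).
(* From [h], the n-th power of w (a j) is at most p ^ j < p ^ n, so w (a j) < p; being an integral
   power of p, it is at most 1. *)
have wa j : w (a j) <= 1.
  have [->|aj] := eqVneq (a j) 0; first by rewrite absval0.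
  have [z hz] := Ew (Ea j) aj; rewrite hz.
  have : w (a j) < p%:R.
    have hj : w (a j) ^+ n * w pi ^+ (j * n) <= 1.
      by rewrite exprM -exprMn -absvalX // -absvalM // exprn_ile1 ?absval_ge0.
    rewrite -(ltr_pXn2r n_gt0) ?nnegrE ?absval_ge0 ?ltW //.
    move: hj; rewrite mulnC exprM (wpi wP) exprVn ler_pdivrMr ?exprn_gt0 // mul1r => /le_lt_trans.
    by apply; rewrite ltr_eXn2l.
  rewrite hz; case: z {hz} => [[|z]|z] //.
    by rewrite -exprnP exprS => hz; have := hz; rewrite ltNge ler_peMr ?exprn_ege1 // ltW.
  by move=> _; rewrite NegzE -exprnN invf_le1 ?exprn_gt0 // exprn_ege1 // ltW.
rewrite Dx rmorph_sum -sumrB; apply: (padic_sum_le pp wP) => [|j _]; first exact: ltW.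
rewrite rmorphM rmorphXn /= sigmaE // -mulrBr absvalM //.
case: j => -[|j] hj /=; first by rewrite !expr0 subrr absval0 // mulr0 ltW.
rewrite -[w pi]mul1r; apply: ler_pM; rewrite ?absval_ge0 //.
have le t : w t = w pi -> w (t ^+ j.+1) <= w pi.
  by move=> wt; rewrite absvalX // wt exprS ler_piMr ?exprn_ile1 ?ltW.
by apply: (padicB_le pp wP); apply: le.
Qed.

Lemma uspan_sub_sigma x : uspan x ->
  w (x - sigma x) <= w pi * (Num.max 1 (w x) * Num.max 1 (w (sigma x))).
Proof.
move=> ux; rewrite w_uspan_sigma //.
have [wx|wx] := leP (w x) 1.
  by rewrite !mulr1; apply: uspan_sub_integral.
have x0 : x != 0 by rewrite -(absval_gt0 wA) (lt_trans ltr01).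
have uV : uspan x^-1 by apply: (subfieldV subfield_uspan).
have wV : w x^-1 <= 1 by rewrite absvalV // invf_le1 ?ltW // (lt_trans ltr01).
(* When [w x] exceeds 1, the integral case is applied to the inverse, and the factor x * sigma x
   yields the two maxima. *)
have -> : x - sigma x = - (x^-1 - sigma x^-1) * (x * sigma x).
  rewrite fmorphV; move: x0; rewrite -(fmorph_eq0 sigma) => s0.
  have x0 : x != 0 by rewrite -(fmorph_eq0 sigma).
  rewrite opprB mulrBl mulrCA mulVf // mulr1 mulrA mulVf // mul1r //.
rewrite absvalM // absvalN // absvalM // w_uspan_sigma //.
by rewrite ler_wpM2r ?mulr_ge0 ?absval_ge0 //; apply: uspan_sub_integral.
Qed.
End UniformizerSpan.

(** [S] is only a semiring, since [teich_ring] has no constructor for opposites; the remainder is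
    therefore built from the binomial coefficients divided by p, without any subtraction. *)
Lemma frobenius_add (p : nat) (S : set algC) : prime p ->
  S 0 -> S 1 -> (forall x y, S x -> S y -> S (x + y)) -> (forall x y, S x -> S y -> S (x * y)) ->
  forall m x y, S x -> S y ->
  exists2 s, S s & (x + y) ^+ (p ^ m) = x ^+ (p ^ m) + y ^+ (p ^ m) + p%:R * s.
Proof.
move=> pp S0 S1 SD SM.
have SX x k : S x -> S (x ^+ k) by move=> Sx; elim: k => // k IH; rewrite exprS; apply: SM.
have Sn x k : S x -> S (x *+ k) by move=> Sx; elim: k => // k IH; rewrite mulrS; apply: SD.
have one x y : S x -> S y -> exists2 s, S s & (x + y) ^+ p = x ^+ p + y ^+ p + p%:R * s.
  move=> Sx Sy; case: p pp => // q qp.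
  exists (\sum_(i < q) (x ^+ (q - i) * y ^+ i.+1) *+ ('C(q.+1, i.+1) %/ q.+1)).
    by elim/big_ind: _ => // i _; apply: Sn; apply: SM; apply: SX.
  rewrite exprDn big_ord_recl big_ord_recr /= subn0 bin0 mulr1 mulr1n subnn mul1r binn mulr1n.
  rewrite -addrA [_ + y ^+ _]addrC; congr (_ + (_ + _)).
  rewrite mulr_sumr; apply: eq_bigr => i _.
  rewrite /bump /= add1n subSS mulr_natl -mulrnA divnK //.
  by rewrite prime_dvd_bin //= ltnS ltn_ord.
elim=> [|m IH] x y Sx Sy; first by exists 0; rewrite // !expr1 mulr0 addr0.
have [s Ss Ds] := IH x y Sx Sy.
have SXm k : S k -> S (k ^+ (p ^ m)) by apply: SX.
have Sp : S p%:R by apply: Sn.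
have [s1 Ss1 Ds1] := one (x ^+ (p ^ m) + y ^+ (p ^ m)) (p%:R * s) (SD _ _ (SXm _ Sx) (SXm _ Sy)) (SM _ _ Sp Ss).
have [s2 Ss2 Ds2] := one _ _ (SXm _ Sx) (SXm _ Sy).
exists (s2 + p%:R ^+ p.-1 * s ^+ p + s1).
  by apply: (SD) => //; apply: (SD) => //; apply: SM; apply: (SX).
have Dp : p%:R ^+ p = p%:R * p%:R ^+ p.-1 :> algC by rewrite -exprS prednK ?prime_gt0.
by rewrite expnSr !exprM Ds Ds1 Ds2 exprMn Dp; ring.
Qed.

(** * Approximate Teichmueller representatives *)

Section UnramifiedClosure.
Variables (R : realType) (p : nat) (w : algC -> R).
Hypotheses (pp : prime p) (wP : valof p w).

Let wA : absval w. Proof. by case: wP. Qed.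
Let p0 : 0 < (p%:R : R). Proof. by rewrite ltr0n prime_gt0. Qed.
Let p1 : 1 < (p%:R : R). Proof. by rewrite ltr1n prime_gt1. Qed.
Let wp : w p%:R = p%:R^-1. Proof. exact: padic_p. Qed.
Let pV_gt0 k : 0 < (p%:R : R) ^- k. Proof. by rewrite invr_gt0 exprn_gt0. Qed.
Let pV_le1 k : (p%:R : R) ^- k <= 1. Proof. by rewrite invf_le1 ?exprn_gt0 // exprn_ege1 // ltW. Qed.
Let V : set algC := [set x | w x <= 1].
Let V0 : V 0. Proof. by rewrite /V /= absval0. Qed.
Let V1 : V 1. Proof. by rewrite /V /= absval1. Qed.
Let VD x y : V x -> V y -> V (x + y). Proof. exact: (padicD_le pp wP). Qed.
Let VM x y : V x -> V y -> V (x * y).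
Proof. by rewrite /V /= absvalM // => h1 h2; rewrite mulr_ile1 ?absval_ge0. Qed.
Let VX x k : V x -> V (x ^+ k).
Proof. by rewrite /V /= absvalX // => h; rewrite exprn_ile1 ?absval_ge0. Qed.

Lemma padicX_sub x y k : V x -> V y -> w (x ^+ k - y ^+ k) <= w (x - y).
Proof.
move=> Vx Vy; rewrite subrXX absvalM // ler_piMr ?absval_ge0 //.
apply: (padic_sum_le pp wP) => // i _.
by apply: VM; apply: VX.
Qed.

Lemma padicM_sub x y x' y' M : V x -> V y' -> w (x - x') <= M -> w (y - y') <= M ->
  w (x * y - x' * y') <= M.
Proof.
move=> Vx Vy h1 h2; rewrite (_ : _ - _ = x * (y - y') + (x - x') * y'); last by ring.
apply: (padicD_le pp wP); rewrite absvalM //.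
  by apply: le_trans h2; rewrite ler_piMl ?absval_ge0.
by apply: le_trans h1; rewrite ler_piMr ?absval_ge0.
Qed.

Lemma padic_pow_iter x q j : V x -> w (x ^+ (q ^ j) - x) <= w (x ^+ q - x).
Proof.
move=> Vx; elim: j => [|j IH]; first by rewrite expr1 subrr absval0 // absval_ge0.
rewrite expnSr exprM (_ : _ - x = (x ^+ (q ^ j) ^+ q - x ^+ q) + (x ^+ q - x)); last by ring.
apply: (padicD_le pp wP) => //; apply: le_trans IH; apply: padicX_sub => //; exact: VX.
Qed.

(** Each p-th power gains a factor p: if a and b agree modulo p, the cofactor of a - b in a ^ p - b
    ^ p is a sum of p terms congruent to b ^ (p - 1). *)
Lemma padic_pow_lift x y N : V x -> V y -> w (x - y) <= p%:R^-1 ->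
  w (x ^+ (p ^ N) - y ^+ (p ^ N)) <= p%:R ^- N.+1.
Proof.
move=> Vx Vy h; elim: N => [|N IH]; first by rewrite !expr1.
rewrite expnSr !exprM; set a := x ^+ _ in IH *; set b := y ^+ _ in IH *.
have Va : V a by apply: VX. have Vb : V b by apply: VX.
rewrite subrXX absvalM // exprSr invfM; apply: ler_pM; rewrite ?absval_ge0 //.
have hab : w (a - b) <= p%:R^-1.
  by apply: (le_trans IH); rewrite exprS invfM ler_piMr ?invr_ge0 ?(ltW p0).
rewrite (_ : \sum_(_ < _) _ = \sum_(i < p) (a ^+ (p.-1 - i) * b ^+ i - b ^+ p.-1) + p%:R * b ^+ p.-1); last first.
  by rewrite sumrB sumr_const card_ord mulr_natl subrK.
apply: (padicD_le pp wP); last first.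
  by rewrite absvalM // wp ler_piMr ?invr_ge0 ?(ltW p0) //; apply: VX.
apply: (padic_sum_le pp wP) => [|i _]; first by rewrite invr_ge0 ltW.
have -> : b ^+ p.-1 = b ^+ (p.-1 - i) * b ^+ i.
  by rewrite -exprD subnK // -ltnS prednK ?prime_gt0.
rewrite -mulrBl absvalM //; apply: (le_trans _ (le_trans (padicX_sub (p.-1 - i) Va Vb) hab)).
by rewrite ler_piMr ?absval_ge0 //; apply: VX.
Qed.

(* The elements congruent modulo [p ^ k] to polynomial expressions in
   approximate Teichmueller representatives.  These expressions satisfy
   [z ^ (p ^ K) = z + p s] modulo [p ^ k], so that [w z < 1] forces
   [w z = w (p s)]: this is why [w] only takes integral powers of [p] as values. *)
Definition teich k (t : algC) : Prop :=
  V t /\ exists2 K, (0 < K)%N & w (t ^+ (p ^ K) - t) <= p%:R ^- k.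

(** Sums and products suffice: modulo p ^ k the opposite is multiplication by p ^ k - 1, and without
    it the induction for the Frobenius identity has only these cases. *)
Inductive teich_ring k : algC -> Prop :=
| teich_gen t of teich k t : teich_ring k t
| teich_add x y of teich_ring k x & teich_ring k y : teich_ring k (x + y)
| teich_mul x y of teich_ring k x & teich_ring k y : teich_ring k (x * y).

Lemma teich_ring0 k : teich_ring k 0.
Proof.
apply: teich_gen; split=> //; exists 1%N => //.
by rewrite expn1 expr0n gtn_eqF ?prime_gt0 // subrr absval0 // ltW.
Qed.

Lemma teich_ring1 k : teich_ring k 1.
Proof.
by apply: teich_gen; split=> //; exists 1%N => //; rewrite expr1n subrr absval0 // ltW.
Qed.

Lemma teich_ring_nat k s m : teich_ring k s -> teich_ring k (s *+ m).
Proof. by move=> h; elim: m => [|m IH]; [exact: teich_ring0|rewrite mulrS; apply: teich_add]. Qed.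

Lemma teich_ring_V k s : teich_ring k s -> V s.
Proof. by elim=> [t []//|x y _ Vx _ Vy|x y _ Vx _ Vy]; [apply: VD|apply: VM]. Qed.

(** The quantifier over [j] lets two elements with exponents K and L be treated at the common
    exponent K * L. *)
Lemma teich_ring_frobenius k z : teich_ring k z ->
  exists2 K, (0 < K)%N & forall j, exists2 s, teich_ring k s &
    w (z ^+ (p ^ (K * j)) - (z + p%:R * s)) <= p%:R ^- k.
Proof.
elim=> [t [Vt [K K0 hK]]|x y Sx [K K0 hK] Sy [L L0 hL]|x y Sx [K K0 hK] Sy [L L0 hL]].
- exists K => // j; exists 0; first exact: teich_ring0.
  by rewrite mulr0 addr0 expnM; apply: le_trans hK; apply: padic_pow_iter.
- exists (K * L)%N; first by rewrite muln_gt0 K0.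
  move=> j; have [s1 Ss1 h1] := hK (L * j)%N; have [s2 Ss2 h2] := hL (K * j)%N.
  rewrite mulnA in h1; rewrite mulnA [(L * K)%N]mulnC in h2.
  have [s3 Ss3 Ds3] := frobenius_add pp (teich_ring0 k) (teich_ring1 k) (@teich_add k)
    (@teich_mul k) (K * L * j) Sx Sy.
  exists (s1 + s2 + s3); first by do 2?apply: teich_add.
  rewrite Ds3; set a := x ^+ _ in h1 *; set b := y ^+ _ in h2 *.
  rewrite (_ : _ - _ = (a - (x + p%:R * s1)) + (b - (y + p%:R * s2))); last by ring.
  exact: (padicD_le pp wP).
- exists (K * L)%N; first by rewrite muln_gt0 K0.
  move=> j; have [s1 Ss1 h1] := hK (L * j)%N; have [s2 Ss2 h2] := hL (K * j)%N.
  rewrite mulnA in h1; rewrite mulnA [(L * K)%N]mulnC in h2.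
  have Sp : teich_ring k p%:R by apply: teich_ring_nat; apply: teich_ring1.
  exists (s1 * y + x * s2 + p%:R * (s1 * s2)).
    by repeat (apply: teich_add || apply: teich_mul).
  rewrite exprMn (_ : x * y + _ = (x + p%:R * s1) * (y + p%:R * s2)); last by ring.
  apply: padicM_sub => //; first by apply: VX; apply: teich_ring_V Sx.
  by apply: (@teich_ring_V k); apply: teich_add => //; apply: teich_mul.
Qed.

(** While w z < 1 and z is not negligible, the Frobenius identity gives w z = w s / p with s in the
    same ring. Repeating this at most k times ends at value 1 or at precision p ^ k. *)
Lemma teich_ring_values k z : teich_ring k z ->
  w z <= p%:R ^- k \/ exists i : nat, w z = p%:R ^- i.
Proof.
suff main m : (m <= k)%N -> forall z, teich_ring k z ->
    w z <= p%:R ^- m \/ exists i : nat, w z = p%:R ^- i by apply: main.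
elim: m => [_ {}z /teich_ring_V Vz|m IH mk {}z Sz]; first by left; rewrite expr0 invr1.
have Vz := teich_ring_V Sz.
have [z0|z0] := eqVneq z 0; first by left; rewrite z0 absval0 // ltW.
have [wz1|wz1] := eqVneq (w z) 1; first by right; exists 0%N; rewrite expr0 invr1.
have {}wz1 : w z < 1 by rewrite lt_neqAle wz1.
have [wk|wk] := leP (w z) (p%:R ^- k).
  left; apply: (le_trans wk); rewrite lef_pV2 ?posrE ?exprn_gt0 //.
  by rewrite ler_eXn2l.
have [K K0 /(_ 1%N)] := teich_ring_frobenius Sz; rewrite muln1 => -[s Ss hs].
have q1 : (1 < p ^ K)%N by rewrite -(exp1n K) ltn_exp2r // prime_gt1.
have wzs : w z = p%:R^-1 * w s.
  rewrite -wp -absvalM // -[in RHS](absvalN wA).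
  have wq : w (z ^+ (p ^ K)) < w z.
    rewrite absvalX // -[X in _ < X]expr1 ltr_iXn2l ?absval_gt0 //.
  rewrite -[LHS](@padic_isosceles R p w pp wP (- z ^+ (p ^ K) + (z ^+ (p ^ K) - (z + p%:R * s)))).
    by congr w; ring.
  by apply: (padicD_lt pp wP); rewrite ?absvalN //; apply: le_lt_trans wk.
have [|h|[i hi]] := IH _ s Ss; first exact: ltnW.
  by left; rewrite wzs exprS invfM ler_pM2l ?invr_gt0.
by right; exists i.+1; rewrite wzs hi exprS invfM.
Qed.

Definition teich_closure (z : algC) : Prop :=
  forall k, exists2 s, teich_ring k s & w (z - s) <= p%:R ^- k.

Lemma teich_closure_V z : teich_closure z -> V z.
Proof.
move=> /(_ 0%N)[s /teich_ring_V Vs]; rewrite expr0 invr1 => h.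
by rewrite -[z](subrK s); apply: VD.
Qed.

Lemma teich_closureD x y : teich_closure x -> teich_closure y -> teich_closure (x + y).
Proof.
move=> hx hy k; have [s Ss h1] := hx k; have [t St h2] := hy k.
exists (s + t); first exact: teich_add.
by rewrite opprD addrACA; apply: (padicD_le pp wP).
Qed.

Lemma teich_closureM x y : teich_closure x -> teich_closure y -> teich_closure (x * y).
Proof.
move=> hx hy k; have [s Ss h1] := hx k; have [t St h2] := hy k.
exists (s * t); first exact: teich_mul.
by apply: padicM_sub => //; [exact: teich_closure_V|exact: teich_ring_V St].
Qed.

Lemma teich_closure_nat n : teich_closure n%:R.
Proof.
move=> k; exists n%:R; last by rewrite subrr absval0 // ltW.
exact/teich_ring_nat/teich_ring1.
Qed.

Lemma teich_closureN x : teich_closure x -> teich_closure (- x).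
Proof.
move=> hx k; have [s Ss h] := hx k.
exists (s *+ (p ^ k).-1); first exact: teich_ring_nat.
have -> : s *+ (p ^ k).-1 = p%:R ^+ k * s - s.
  by rewrite -natrX mulr_natl -{2}[(p ^ k)%N]prednK ?expn_gt0 ?prime_gt0 // mulrSr addrK.
rewrite (_ : _ - _ = - (x - s) + - (p%:R ^+ k * s)); last by ring.
apply: (padicD_le pp wP); rewrite absvalN //.
rewrite absvalM // absvalX // wp exprVn ler_piMr ?(ltW (pV_gt0 k)) //.
exact: teich_ring_V Ss.
Qed.

Lemma teich_closure_int (n : int) : teich_closure n%:~R.
Proof.
by case: n => n; rewrite ?NegzE ?mulrNz -pmulrn; [|apply: teich_closureN]; apply: teich_closure_nat.
Qed.

Lemma teich_closure_values z : teich_closure z -> z != 0 -> exists i : nat, w z = p%:R ^- i.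
Proof.
move=> hz z0; have wz : 0 < w z by rewrite absval_gt0.
have [k /(_ k (leqnn k)) hk] := pow_unbounded (w z)^-1 p1.
have {}hk : p%:R ^- k < w z by rewrite invf_plt ?posrE ?exprn_gt0.
have [s Ss h] := hz k.
have ws : w s = w z.
  rewrite -[s](subrK z) (padic_isosceles pp wP) // absvalB //; exact: le_lt_trans hk.
have [|[i hi]] := teich_ring_values Ss; first by rewrite ws leNgt hk.
by exists i; rewrite -ws.
Qed.

(** Fraction field of [teich_closure]. Its values are powers of p and it contains every subfield
    with that property, so it is the largest one; composita inside it inherit the property. *)
Definition teich_field : set algC :=
  [set z | exists s, [/\ s != 0, teich_closure s & teich_closure (z * s)]].

Lemma subfield_teich_field : subfield teich_field.
Proof.
apply: subfield_of_subring.
- by exists 1; rewrite oner_eq0 mulr1; split=> //; apply: (teich_closure_nat 1).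
- move=> c; exists (denq c)%:~R; rewrite intr_eq0 denq_eq0; split=> //; first exact: teich_closure_int.
  by rewrite divfK ?intr_eq0 ?denq_eq0 //; apply: teich_closure_int.
- move=> x y [s [s0 Cs Cxs]] [t [t0 Ct Cyt]]; exists (s * t); rewrite mulf_neq0 //; split=> //.
    exact: teich_closureM.
  rewrite (_ : _ * _ = (x * s) * t + (y * t) * s); last by ring.
  by apply: teich_closureD; apply: teich_closureM.
- move=> x y [s [s0 Cs Cxs]] [t [t0 Ct Cyt]]; exists (s * t); rewrite mulf_neq0 //; split=> //.
    exact: teich_closureM.
  by rewrite mulrACA; apply: teich_closureM.
Qed.

Lemma pvalues_teich_field : pvalues p w teich_field.
Proof.
move=> z [s [s0 Cs Czs]] z0.
have [i hi] := teich_closure_values Cs s0.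
have [j hj] := teich_closure_values Czs (mulf_neq0 z0 s0).
exists (i%:Z - j%:Z); rewrite -[z](mulfK s0) absvalM // absvalV // hi hj invrK.
by rewrite expfzDr ?gt_eqF // -invr_expz -!exprnP mulrC.
Qed.
End UnramifiedClosure.

(** * Frobenius on residues and p-adic digits *)

Section ResidueFrobenius.
Variables (R : realType) (p : nat) (w : algC -> R).
Hypotheses (pp : prime p) (wP : valof p w).

Let wA : absval w. Proof. by case: wP. Qed.
Let p0 : 0 < (p%:R : R). Proof. by rewrite ltr0n prime_gt0. Qed.
Let p1 : 1 < (p%:R : R). Proof. by rewrite ltr1n prime_gt1. Qed.
Let wp : w p%:R = p%:R^-1. Proof. exact: padic_p. Qed.
Let pV_lt1 : (p%:R : R)^-1 < 1. Proof. by rewrite invf_lt1. Qed.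

(** [prufer] for the elements of value less than 1: of s and y s one has value 1, and since w y <= 1
    it must be s. *)
Lemma integral_denominator (E : set algC) y : subfield E -> E y -> w y <= 1 ->
  exists s, [/\ E s, s \in Aint, y * s \in Aint & w s = 1].
Proof.
move=> sE Ey wy.
have [|n|s [Es As Ays h]] := @prufer p E (fun a => w a < 1) y pp sE Ey.
- by move=> a b _ _ wa wb; apply: (padicD_lt pp wP); rewrite ?absvalN.
- by rewrite (padic_int_lt1 pp wP).
exists s; split=> //; apply/eqP; rewrite eq_le (padic_Aint pp wP) //= leNgt; apply/negP => ws.
case: h => //; apply; rewrite absvalM //; apply: le_lt_trans ws.
by rewrite ler_piMl ?absval_ge0.
Qed.

Let frob m x y : w x <= 1 -> w y <= 1 ->
  w ((x - y) ^+ (p ^ m) - (x ^+ (p ^ m) - y ^+ (p ^ m))) < 1.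
Proof.
move=> wx wy.
have [||u v hu hv|u v hu hv||s /= ws] := @frobenius_add p [set x | w x <= 1] pp _ _ _ _ m (x - y) y _ wy.
- by rewrite /= absval0.
- by rewrite /= absval1.
- exact: (padicD_le pp wP) hu hv.
- by rewrite /= absvalM // mulr_ile1 ?absval_ge0.
- exact: (padicB_le pp wP).
rewrite subrK => ->; rewrite (_ : _ - _ = - (p%:R * s)); last by ring.
rewrite absvalN // absvalM // wp; apply: le_lt_trans pV_lt1.
by rewrite ler_piMr // invr_ge0 ltW.
Qed.

(** Fermat's little theorem, obtained from the additivity of the p-th power modulo elements of value
    less than 1. *)
Let frob_int (c : int) : w (c%:~R ^+ p - c%:~R) < 1.
Proof.
have sub (a b : int) : w (a%:~R ^+ p - a%:~R) < 1 -> w (b%:~R ^+ p - b%:~R) < 1 ->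
    w ((a - b)%:~R ^+ p - (a - b)%:~R) < 1.
  move=> ha hb; rewrite rmorphB /=.
  have := frob 1 (padic_int pp wP a) (padic_int pp wP b); rewrite expn1 => h.
  rewrite (_ : _ - _ = ((a%:~R - b%:~R) ^+ p - (a%:~R ^+ p - b%:~R ^+ p)) +
    ((a%:~R ^+ p - a%:~R) - (b%:~R ^+ p - b%:~R))); last by ring.
  by do 2?apply: (padicD_lt pp wP) => //; rewrite absvalN.
have h0 : w ((0 : int)%:~R ^+ p - (0 : int)%:~R) < 1.
  by rewrite expr0n gtn_eqF ?prime_gt0 // subrr absval0.
have hN1 : w ((-1 : int)%:~R ^+ p - (-1 : int)%:~R) < 1.
  have := sub 0 1 h0; rewrite sub0r; apply.
  by rewrite expr1n subrr absval0.
have hn (n : nat) : w ((n%:Z)%:~R ^+ p - (n%:Z)%:~R) < 1.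
  elim: n => [//|n IH]; have := sub n%:Z (-1) IH hN1.
  by rewrite (_ : n%:Z - -1 = n.+1%:Z) // opprK intS addrC.
by case: c => // n; rewrite NegzE; have := sub 0 n.+1%:Z h0 (hn n.+1); rewrite sub0r.
Qed.

Let frob_poly (f : {poly int}) x : w x <= 1 ->
  w ((ZtoC f).[x] ^+ p - (ZtoC f).[x ^+ p]) < 1.
Proof.
move=> wx; elim/poly_ind: f => [|f c IH].
  by rewrite rmorph0 !horner0 expr0n gtn_eqF ?prime_gt0 // subrr absval0.
rewrite rmorphD rmorphM /= map_polyX map_polyC /= !hornerD !hornerM !hornerX !hornerC.
set a := (ZtoC f).[x] in IH *; set b := (ZtoC f).[x ^+ p] in IH *.
have hf y : w y <= 1 -> w (ZtoC f).[y] <= 1.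
  move=> wy; rewrite horner_coef; apply: (padic_sum_le pp wP) => // i _.
  by rewrite absvalM // absvalX // mulr_ile1 ?exprn_ge0 ?absval_ge0 ?exprn_ile1 ?absval_ge0 // coef_map (padic_int pp wP).
have wa : w (a * x) <= 1 by rewrite absvalM // mulr_ile1 ?absval_ge0 ?hf.
have wc : w (- c%:~R) <= 1 by rewrite absvalN // (padic_int pp wP).
have h1 := frob 1 wa wc; have h2 := frob_int (- c).
rewrite expn1 opprK in h1; rewrite rmorphN /= in h2.
rewrite (_ : _ - _ = ((a * x + c%:~R) ^+ p - ((a * x) ^+ p - (- c%:~R) ^+ p)) +
   ((a ^+ p - b) * x ^+ p - ((- c%:~R) ^+ p - - c%:~R))); last by rewrite exprMn; ring.
apply: (padicD_lt pp wP) => //; apply: (padicD_lt pp wP); rewrite ?absvalN //.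
rewrite absvalM //; apply: le_lt_trans IH; rewrite ler_piMr ?absval_ge0 //.
by rewrite absvalX // exprn_ile1 ?absval_ge0.
Qed.

(** The residue of [a] is algebraic over the prime field. Each a ^ (p ^ i) is a root modulo the
    maximal ideal, hence close to one of finitely many conjugates. Two iterates are close to the
    same one, and since the p-th power is injective on residues, the smaller iterate can be removed
    from both. *)
Let frob_Aint a : a \in Aint -> exists2 K, (0 < K)%N & w (a ^+ (p ^ K) - a) < 1.
Proof.
move=> Aa; have [f Df] := floorpP Aa; have wa := padic_Aint pp wP Aa.
have wX i : w (a ^+ i) <= 1 by rewrite absvalX // exprn_ile1 ?absval_ge0.
have fa i : w (ZtoC f).[a ^+ (p ^ i)] < 1.
  elim: i => [|i IH].
    by rewrite expr1 -Df (eqP (root_minCpoly a)) absval0.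
  rewrite expnSr exprM -[X in w X](subrK ((ZtoC f).[a ^+ (p ^ i)] ^+ p)).
  apply: (padicD_lt pp wP); first by rewrite absvalB // frob_poly.
  have IH' := ltW IH; rewrite absvalX //; apply: le_lt_trans IH.
  by rewrite -[X in _ <= X]expr1; apply: ler_wiXn2l; rewrite ?absval_ge0 ?prime_gt0.
have [rs [_ Drs _]] := minCpoly_roots a.
have near i : exists j : 'I_(size rs), w (a ^+ (p ^ i) - rs`_j) < 1.
  apply: contrapT => no; have := fa i; rewrite ltNge -Df Drs horner_prod absval_prod //.
  case/negP; rewrite big_seq; elim/big_ind: _ => // [x y|r rrs]; first exact: mulr_ege1.
  rewrite hornerXsubC leNgt; apply/negP => h; apply: no.
  by exists (Ordinal (etrans (index_mem r rs) rrs)); rewrite nth_index.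
have [j hj] := choice near.
have /injectivePn[i1 [i2 ne e]] : ~~ injectiveb (fun i : 'I_(size rs).+1 => j i).
  apply/negP => /injectiveP /leq_card; rewrite !card_ord ltnn //.
wlog lt : i1 i2 ne e / (i1 < i2)%N.
  move=> W; have [lt|lt|eq] := ltngtP i1 i2; first exact: W lt.
    by apply: (W i2 i1) => //; rewrite eq_sym.
  by move: ne; rewrite (val_inj eq) eqxx.
exists (i2 - i1)%N; first by rewrite subn_gt0.
set b := a ^+ (p ^ (i2 - i1)).
have h1 : w (b ^+ (p ^ i1) - a ^+ (p ^ i1)) < 1.
  rewrite /b -exprM -expnD subnK; last exact: ltnW.
  rewrite (_ : _ - _ = (a ^+ (p ^ i2) - rs`_(j i1)) - (a ^+ (p ^ i1) - rs`_(j i1))); last by ring.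
  by apply: (padicD_lt pp wP); rewrite ?absvalN // e.
have h2 := frob i1 (wX _ : w b <= 1) wa.
have : w ((b - a) ^+ (p ^ i1)) < 1.
  rewrite -[X in w X](subrK (b ^+ (p ^ i1) - a ^+ (p ^ i1))).
  exact: (padicD_lt pp wP).
rewrite absvalX // !ltNge; apply: contraNN => h; exact: exprn_ege1.
Qed.

Lemma residue_frobenius (E : set algC) y : subfield E -> E y -> w y <= 1 ->
  exists2 K, (0 < K)%N & w (y ^+ (p ^ K) - y) < 1.
Proof.
move=> sE Ey wy; have [s [_ As Ays ws]] := integral_denominator sE Ey wy.
have s0 : s != 0 by rewrite -(absval_gt0 wA) ws.
have [K K0 hK] := frob_Aint Ays; have [L L0 hL] := frob_Aint As.
have wa := padic_Aint pp wP Ays; have ws1 : w s <= 1 by rewrite ws.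
exists (K * L)%N; first by rewrite muln_gt0 K0.
set P := (p ^ (K * L))%N.
have h1 : w ((y * s) ^+ P - y * s) < 1.
  by rewrite /P expnM; apply: le_lt_trans hK; apply: (padic_pow_iter pp wP).
have h2 : w (s ^+ P - s) < 1.
  by rewrite /P mulnC expnM; apply: le_lt_trans hL; apply: (padic_pow_iter pp wP).
have : w ((y ^+ P - y) * (s ^+ P)) < 1.
  rewrite (_ : _ * _ = ((y * s) ^+ P - y * s) - y * (s ^+ P - s)); last by rewrite exprMn; ring.
  apply: (padicD_lt pp wP) => //; rewrite absvalN // absvalM //.
  by apply: le_lt_trans h2; rewrite ler_piMl ?absval_ge0.
by rewrite absvalM // absvalX // ws expr1n mulr1.
Qed.

(** Digit expansion: in b = s + p ^ m b', the element b' is replaced by a high power t of itself, a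
    representative modulo p ^ k with the same residue. Since values on [F] are powers of p, b' - t
    has value at most 1 / p and is divisible by p, which gives the next digit. *)
Lemma subfield_teich_closure (F : set algC) b : subfield F -> pvalues p w F -> F b ->
  w b <= 1 -> teich_closure p w b.
Proof.
move=> sF Fv Fb wb k.
suff step m : exists s b', [/\ teich_ring p w k s, F b', w b' <= 1 &
    b = s + p%:R ^+ m * b'].
  have [s [b' [Ss Fb' wb' Db]]] := step k; exists s => //.
  rewrite Db addrAC subrr add0r absvalM // absvalX // wp exprVn.
  by rewrite ler_piMr // invr_ge0 exprn_ge0 // ltW.
elim: m => [|m [s [c [Ss Fc wc Db]]]].
  by exists 0, b; rewrite expr0 mul1r add0r; split=> //; apply: teich_ring0.
have [K K0 hK] := residue_frobenius sF Fc wc.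
have Fq i : F (c ^+ i) by apply: subfieldX.
have gap z : F z -> w z < 1 -> w z <= p%:R^-1.
  move=> Fz wz; have [->|z0] := eqVneq z 0; first by rewrite absval0 // invr_ge0 ltW.
  have [i hi] := Fv _ Fz z0; move: wz; rewrite hi.
  case: i {hi} => i; first by rewrite -exprnP ltNge exprn_ege1 // ltW.
  by rewrite NegzE -exprnN => _; rewrite lef_pV2 ?posrE ?exprn_gt0 // exprS ler_peMr ?exprn_ege1 // ltW.
have hKp : w (c ^+ (p ^ K) - c) <= p%:R^-1 by apply: gap => //; apply: subfieldB.
pose t := c ^+ (p ^ (K * k)).
have wt : w t <= 1 by rewrite absvalX // exprn_ile1 ?absval_ge0.
have Tt : teich p w k t.
  split=> //; exists K => //.
  have -> : t ^+ (p ^ K) - t = (c ^+ (p ^ K)) ^+ (p ^ (K * k)) - c ^+ (p ^ (K * k)).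
    by rewrite /t exprAC.
  apply: (le_trans (padic_pow_lift pp wP (K * k) _ wc hKp)).
    by rewrite /= absvalX // exprn_ile1 ?absval_ge0.
  rewrite lef_pV2 ?posrE ?exprn_gt0 // ler_eXn2l // leqW //.
  by rewrite leq_pmull.
have htc : w (t - c) <= p%:R^-1.
  by rewrite /t expnM; apply: le_trans hKp; apply: (padic_pow_iter pp wP).
have pC0 : (p%:R : algC) != 0 by rewrite pnatr_eq0 -lt0n prime_gt0.
have Sp : teich_ring p w k p%:R by apply: (@teich_ring_nat R p w pp wP k 1 p); apply: teich_ring1.
have SpX j : teich_ring p w k (p%:R ^+ j).
  by elim: j => [|j IH]; [by apply: teich_ring1|rewrite exprS; apply: teich_mul].
exists (s + p%:R ^+ m * t), ((c - t) / p%:R); split.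
- by apply: teich_add => //; apply: teich_mul => //; apply: teich_gen.
- apply: (subfield_div sF); last exact: (subfield_nat sF).
  by apply: (subfieldB sF) => //; apply: Fq.
- by rewrite absvalM // absvalV // wp invrK absvalB // -ler_pdivlMr // mul1r.
- by rewrite Db exprSr -[p%:R ^+ m * p%:R * _]mulrA [p%:R * (_ / _)]mulrC divfK //; ring.
Qed.

Lemma subfield_sub_teich_field (F : set algC) : subfield F -> pvalues p w F ->
  F `<=` teich_field p w.
Proof.
move=> sF Fv y Fy.
have [N /(_ N (leqnn N)) hN] := pow_unbounded (w y) p1.
have pC0 : (p%:R : algC) != 0 by rewrite pnatr_eq0 -lt0n prime_gt0.
have FpN : F (p%:R ^+ N) by apply: subfieldX => //; apply: subfield_nat.
exists (p%:R ^+ N); rewrite expf_neq0 //; split=> //.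
  apply: (subfield_teich_closure sF Fv) => //.
  by rewrite absvalX // wp exprn_ile1 ?invr_ge0 ?(ltW p0) ?(ltW pV_lt1).
apply: (subfield_teich_closure sF Fv); first exact: subfieldM.
by rewrite absvalM // absvalX // wp exprVn ler_pdivrMr ?exprn_gt0 // mul1r ltW.
Qed.
End ResidueFrobenius.

(** * From unramified ideals to values in the powers of p *)

Lemma rat_common_denominator n (k : 'I_n -> rat) :
  exists2 D : rat, D != 0 & exists c : 'I_n -> int, forall i, k i * D = (c i)%:~R.
Proof.
exists (\prod_i (denq (k i))%:~R).
  by rewrite prodf_seq_neq0; apply/allP => i _; rewrite /= intr_eq0 denq_eq0.
exists (fun i => numq (k i) * \prod_(j | j != i) denq (k j)) => i.
rewrite (bigD1 i) //= mulrA -numqE rmorphM; congr (_ * _).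
by rewrite rmorph_prod.
Qed.

Section Unramified.
Variables (R : realType) (p : nat) (F : set algC) (n : nat) (g : 'I_n -> algC).
Hypotheses (pp : prime p) (sF : subfield F) (Fg : qspan F g).
Local Notation O := (ring_of_integers F).

Let pC0 : (p%:R : algC) != 0. Proof. by rewrite pnatr_eq0 -lt0n prime_gt0. Qed.

(** Elements independent modulo p O are independent over Q, so there are at most n of them, and a
    maximal family generates modulo p O. This replaces the finite generation of ideals. *)
Lemma ideal_generators_mod_p (P : set algC) : is_ideal O P ->
  exists r (b : 'I_r -> algC), (forall i, P (b i)) /\
    forall z, P z -> exists (c : 'I_r -> int) t, O t /\ z = \sum_i (c i)%:~R * b i + p%:R * t.
Proof.
move=> [PO P0 PD PM].
pose indep r (b : 'I_r -> algC) := forall c : 'I_r -> int,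
  (exists2 t, O t & \sum_i (c i)%:~R * b i = p%:R * t) -> forall i, (p%:Z %| c i)%Z.
pose S r := `[< exists b : 'I_r -> algC, (forall i, P (b i)) /\ indep r b >].
have S0 : exists r, S r by exists 0%N; apply/asboolP; exists (fun _ => 0); split=> [[]//|c _ []].
have Sn r : S r -> (r <= n)%N.
  move/asboolP => [b [Pb ib]]; rewrite leqNgt; apply/negP => nr.
  have [_ gs] := Fg.
  have [|k [j kj] k0] := @rat_dependence n r g b nr.
    by move=> j; apply: gs; case: (PO _ (Pb j)).
  have [D D0 [c cE]] := rat_common_denominator k.
  (* Infinite descent: an integral relation has all coefficients divisible by p, and dividing by p
     gives another relation; a nonzero coefficient cannot be divisible by every power of p. *)
  have all_dvd e : forall c : 'I_r -> int, \sum_i (c i)%:~R * b i = 0 ->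
      forall i, (p%:Z ^+ e %| c i)%Z.
    elim: e => [|e IH] c' c'0 i; first by rewrite expr0 dvd1z.
    have /choice[q qE] : forall i, exists q, c' i = q * p%:Z.
      move=> l; apply/dvdzP; apply: ib; exists 0; first exact: (ringO_int sF 0).
      by rewrite mulr0.
    have q0 : \sum_i (q i)%:~R * b i = 0.
      apply: (mulfI pC0); rewrite mulr0 -[RHS]c'0 mulr_sumr; apply: eq_bigr => l _.
      by rewrite qE intrM mulrA [p%:R * _]mulrC -pmulrn.
    by rewrite qE exprSr; apply: dvdz_mul => //; apply: IH.
  have c0 : \sum_i (c i)%:~R * b i = 0.
    have : ratr D * \sum_j ratr (k j) * b j = 0 by rewrite k0 mulr0.
    rewrite mulr_sumr => h; rewrite -[RHS]h; apply: eq_bigr => i _.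
    by rewrite mulrA -rmorphM /= [D * _]mulrC cE ratr_int.
  have cj : c j != 0.
    by rewrite -(intr_eq0 rat) -cE mulf_neq0.
  have := all_dvd `|c j|%N c c0 j; rewrite dvdzE abszX /= => /dvdn_leq.
  rewrite absz_gt0 => /(_ cj); rewrite leqNgt ltn_expl //.
  exact: prime_gt1.
have [r /asboolP[b [Pb ib]] rmax] : exists2 r, S r & forall l, S l -> (l <= r)%N.
  by case: (ex_maxnP S0 Sn) => r Sr rm; exists r.
exists r, b; split=> // z Pz; apply: contrapT => no.
have : (r.+1 <= r)%N; last by rewrite ltnn.
apply: rmax; apply/asboolP.
exists (fun i => if unlift ord0 i is Some j then b j else z).
split=> [i|c [t Ot]]; first by case: unlift => [j|].
rewrite big_ord_recl unlift_none; under eq_bigr do rewrite liftK.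
set c0 := c ord0; set c' := fun j => c (lift ord0 j).
rewrite -[X in _ + X]/(\sum_(j < r) (c' j)%:~R * b j) => E.
have Oz := PO _ Pz.
have [|nd] := boolP (p%:Z %| c0)%Z.
  case/dvdzP => q Dq i.
  have h := ib c' _; have [j ->|->] := unliftP ord0 i; last by rewrite -/c0 Dq dvdz_mull.
  rewrite -/(c' j); apply: h; exists (t + (- q)%:~R * z).
    by apply: ringO_D => //; apply: ringO_M => //; apply: ringO_int.
  rewrite mulrDr -E Dq intrM -pmulrn rmorphN /=; ring.
exfalso; apply: no.
(* A coefficient of [z] prime to p is inverted modulo p, which expresses [z] by the family. *)
have /coprimezP[[u v] /= uv] : coprimez c0 p%:Z.
  by rewrite coprimez_sym coprimezE absz_nat prime_coprime //; rewrite dvdzE in nd.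
exists (fun j => - u * c' j), (u%:~R * t + v%:~R * z); split.
  by apply: ringO_D => //; apply: ringO_M => //; apply: ringO_int.
have -> : \sum_i (- u * c' i)%:~R * b i = - u%:~R * \sum_i (c' i)%:~R * b i.
  by rewrite mulr_sumr; apply: eq_bigr => j _; rewrite intrM rmorphN /= mulrA.
have -> : \sum_i (c' i)%:~R * b i = p%:R * t - c0%:~R * z by rewrite -E; ring.
have uvC : u%:~R * c0%:~R + v%:~R * p%:R = 1 :> algC.
  by rewrite (_ : p%:R = (p%:Z)%:~R) -?intrM -?rmorphD /= ?uv // -pmulrn.
transitivity ((u%:~R * c0%:~R + v%:~R * p%:R) * z); first by rewrite uvC mul1r.
by ring.
Qed.

(** Contrapositive: a value that is not a power of p yields pi in P = {w < 1} with 1 / p < w pi and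
    w pi ^ 2 >= 1 / p. Near P the ideal is generated by pi, so P ^ 2 divides p there. The
    factorization p O = P ^ 2 J is then proved with an explicit J. *)
Lemma unramified_pvalues (w : algC -> R) : valof p w -> ~ ramifies p F -> pvalues p w F.
Proof.
move=> wP; have [wA _ _] := wP.
have p0 : 0 < (p%:R : R) by rewrite ltr0n prime_gt0.
have p1 : 1 < (p%:R : R) by rewrite ltr1n prime_gt1.
have wp : w p%:R = p%:R^-1 := padic_p pp wP.
have pV_lt1 : (p%:R : R)^-1 < 1 by rewrite invf_lt1.
apply: contra_notP => /existsNP[y /not_implyP[Fy /not_implyP[y0 ny]]].
(* Rescaling [y] by powers of p brings its value into the interval from 1 / p to 1; the endpoint 1
   is excluded because w y is not a power of p. *)
have [y1 [Fy1 y1l y1r]] : exists y1, [/\ F y1, p%:R^-1 < w y1 & w y1 < 1].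
  have wy : 0 < w y by rewrite absval_gt0.
  have [N /(_ N (leqnn N)) hN] := pow_unbounded (w y) p1.
  have [M /(_ M (leqnn M)) hM] := pow_unbounded (w y)^-1 p1.
  pose v := w y / p%:R ^+ N.
  have ex_k : exists k, 1 < v * p%:R ^+ k.
    exists (N + M)%N; rewrite exprD /v mulrA divfK ?gt_eqF ?exprn_gt0 //.
    by rewrite mulrC -ltr_pdivrMr // mul1r.
  pose k := ex_minn ex_k.
  have [hk kmin] : 1 < v * p%:R ^+ k /\ forall l, 1 < v * p%:R ^+ l -> (k <= l)%N.
    by rewrite /k; case: ex_minnP.
  have v1 : v < 1 by rewrite ltr_pdivrMr ?exprn_gt0 // mul1r.
  clearbody k; case: k hk kmin => [|k] hk kmin.
    by move: hk; rewrite expr0 mulr1 => /(lt_trans v1); rewrite ltxx.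
  have vk : v * p%:R ^+ k <= 1 by rewrite leNgt; apply/negP => /kmin; rewrite ltnn.
  have wE : w (y * p%:R ^+ N / p%:R ^+ k) = v * p%:R ^+ k.
    by rewrite !(absvalM wA) absvalV // !absvalX // wp !exprVn invrK.
  exists (y * p%:R ^+ N / p%:R ^+ k); rewrite wE; split.
  - have Fp j : F (p%:R ^+ j) by apply: (subfieldX sF); apply: subfield_nat.
    by apply: (subfield_div sF) => //; apply: (subfieldM sF).
  - by move: hk; rewrite exprSr mulrA -ltr_pdivrMr // mul1r.
  rewrite lt_neqAle vk andbT; apply/eqP => e; apply: ny.
  exists (N%:Z - k%:Z); rewrite expfzDr ?gt_eqF // -invr_expz -!exprnP.
  apply: (mulIf (_ : (p%:R : R) ^+ k / p%:R ^+ N != 0)).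
    by rewrite mulf_neq0 ?invr_eq0 ?expf_neq0 ?gt_eqF.
  rewrite (_ : w y * _ = v * p%:R ^+ k); last by rewrite /v; ring.
  by rewrite e mulrA divfK ?divff ?expf_neq0 ?gt_eqF.
pose P : set algC := [set z | O z /\ w z < 1].
have PO : P `<=` O by move=> z [].
have Pp : P p%:R by split; [exact: ringO_nat|rewrite wp].
have iP : is_ideal O P.
  split=> //; first by split; [exact: (ringO_int sF 0)|rewrite absval0].
    by move=> a b [Oa wa] [Ob wb]; split; [exact: ringO_D|exact: (padicD_lt pp wP)].
  move=> a x [Fa Aa] [Ox wx]; split; first exact: ringO_M.
  by rewrite absvalM //; apply: le_lt_trans wx; rewrite ler_piMl ?absval_ge0 // (padic_Aint pp wP).
have primeP : prime_ideal O P.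
  split=> //; first by move=> [_]; rewrite absval1 // ltxx.
  move=> a b Oa Ob [_ wab]; have [wa|wa] := ltP (w a) 1; first by left.
  right; split=> //; move: wab; rewrite absvalM //; apply: le_lt_trans.
  by rewrite ler_peMl ?absval_ge0.
exists P => //; rewrite /=.
have [r [b [Pb bgen]]] := ideal_generators_mod_p iP.
(* Adjoining p to the generators covers the remainder p t, so that the largest value among the [b']
   bounds all of P. *)
pose b' (i : 'I_r.+1) := if unlift ord0 i is Some j then b j else p%:R.
have Pb' i : P (b' i) by rewrite /b'; case: unlift.
have [i0 _ Hi0] := arg_maxP (fun i => w (b' i)) (isT : xpredT (ord0 : 'I_r.+1)).
set pi := b' i0 in Hi0 *; have Ppi : P pi := Pb' i0.
have [[Fpi Api] wpi1] := Ppi.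
have hpi i : w (b' i) <= w pi := Hi0 i isT.
have bE j : b' (lift ord0 j) = b j by rewrite /b' liftK.
have b0E : b' ord0 = p%:R by rewrite /b' unlift_none.
have pi_max z : P z -> w z <= w pi.
  move=> /bgen[c [t [[_ At] ->]]]; apply: (padicD_le pp wP).
    apply: (padic_sum_le pp wP) => [|j _]; first exact: absval_ge0.
    rewrite absvalM //; apply: le_trans (hpi (lift ord0 j)); rewrite bE.
    by rewrite ler_piMl ?absval_ge0 // (padic_int pp wP).
  rewrite absvalM //; apply: le_trans (hpi ord0); rewrite b0E.
  by rewrite ler_piMr ?absval_ge0 // (padic_Aint pp wP).
have pi_gt : p%:R^-1 < w pi.
  have [s [Fs As Ays ws]] := integral_denominator pp wP sF Fy1 (ltW y1r).
  have wys : w (y1 * s) = w y1 by rewrite absvalM // ws mulr1.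
  apply: (lt_le_trans y1l); rewrite -wys; apply: pi_max; split; last by rewrite wys.
  by split=> //; apply: subfieldM.
have pi0 : pi != 0 by rewrite -(absval_gt0 wA) (lt_trans _ pi_gt) // invr_gt0.
have wpi0 : 0 < w pi by rewrite absval_gt0.
have Fp : F p%:R := subfield_nat sF p.
(* p / pi has value less than 1, so up to a denominator of value 1 it belongs to P and [pi_max]
   applies. This is what makes p divisible by pi ^ 2 at [w]. *)
have ppi : w (p%:R / pi) <= w pi.
  have Fq : F (p%:R / pi) by apply: subfield_div.
  have w1 : w (p%:R / pi) < 1 by rewrite absvalM // absvalV // wp ltr_pdivrMr // mul1r.
  have [s [Fs As Ays ws]] := integral_denominator pp wP sF Fq (ltW w1).
  have wqs : w (p%:R / pi * s) = w (p%:R / pi) by rewrite absvalM // ws mulr1.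
  rewrite -wqs; apply: pi_max; split; last by rewrite wqs.
  by split=> //; apply: subfieldM.
(* A single denominator of value 1 for all quotients z / pi, obtained from the finitely many
   generators. *)
have [m [Om wm mP]] : exists m, [/\ O m, w m = 1 & forall z, P z -> O (m * (z / pi))].
  have /choice[s sP] : forall i, exists s, [/\ O s, w s = 1 & O (s * (b' i / pi))].
    move=> i; have [[Fb _] _] := Pb' i.
    have wle : w (b' i / pi) <= 1 by rewrite absvalM // absvalV // ler_pdivrMr // mul1r.
    have [s [Fs As Ays ws]] := integral_denominator pp wP sF (subfield_div sF Fb Fpi) wle.
    exists s; split=> //; rewrite mulrC; split=> //.
    by apply: (subfieldM sF) => //; apply: subfield_div.
  have Oprod (Q : pred 'I_r.+1) : O (\prod_(i | Q i) s i).
    by elim/big_ind: _ => [||i _]; [exact: ringO1|exact: ringO_M|case: (sP i)].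
  pose M := \prod_i s i; have OM : O M := Oprod xpredT.
  have wM : w M = 1 by rewrite absval_prod // big1 // => i _; case: (sP i).
  have Ob i : O (M * (b' i / pi)).
    by rewrite /M (bigD1 i) //= mulrAC; apply: ringO_M => //; case: (sP i).
  clearbody M; exists M; split=> //.
  move=> z /bgen[c [t [Ot ->]]].
  rewrite mulrDl mulrDr; apply: ringO_D => //.
    rewrite mulr_suml mulr_sumr; elim/big_ind: _ => [||j _]; [exact: (ringO_int sF 0)|exact: ringO_D|].
    rewrite -mulrA mulrCA -bE; apply: ringO_M => //; exact: ringO_int.
  by rewrite -b0E mulrAC mulrA; apply: ringO_M.
have [s' [Os' ws' Oq]] : exists s, [/\ O s, w s = 1 & O (s * (p%:R / pi ^+ 2))].
  have wle : w (p%:R / pi ^+ 2) <= 1.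
    rewrite expr2 invfM mulrA absvalM // absvalV // ler_pdivrMr // mul1r //.
  have Fq : F (p%:R / pi ^+ 2) by apply: (subfield_div sF) => //; apply: subfieldX.
  have [s [Fs As Ays ws]] := integral_denominator pp wP sF Fq wle.
  by exists s; split=> //; rewrite mulrC; split=> //; apply: subfieldM.
(* The colon ideal of p O by P ^ 2, tested on products of two elements of P. *)
pose J : set algC := [set z | O z /\ forall a a', P a -> P a' -> exists2 t, O t & z * a * a' = p%:R * t].
have iJ : is_ideal O J.
  split=> [z []//|||].
  - split; first exact: (ringO_int sF 0).
    by move=> a a' _ _; exists 0; [exact: (ringO_int sF 0)|rewrite !mul0r mulr0].
  - move=> x z [Ox hx] [Oz hz]; split; first exact: ringO_D.
    move=> a a' Pa Pa'; have [t Ot Dt] := hx a a' Pa Pa'; have [u Ou Du] := hz a a' Pa Pa'.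
    by exists (t + u); [exact: ringO_D|rewrite mulrDr -Dt -Du; ring].
  - move=> c x Oc [Ox hx]; split; first exact: ringO_M.
    move=> a a' Pa Pa'; have [t Ot Dt] := hx a a' Pa Pa'.
    by exists (c * t); [exact: ringO_M|rewrite [RHS]mulrCA -Dt; ring].
exists J => //.
set P2 := ideal_exp O P 2.
have P2J x z : P2 x -> J z -> exists2 t, O t & x * z = p%:R * t.
  move=> [k1 [a [c [Pa Pc ->]]]] [Oz Jz].
  have tmul i : exists2 t, O t & a i * c i * z = p%:R * t.
    have [k2 [a2 [c2 [Pa2 Oc2 ->]]]] := Pc i.
    have /choice[t tP] : forall j, exists t, O t /\ z * a i * a2 j = p%:R * t.
      by move=> j; have [t Ot Dt] := Jz _ _ (Pa i) (Pa2 j); exists t.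
    exists (\sum_j t j * c2 j).
      elim/big_ind: _ => [||j _]; [exact: (ringO_int sF 0)|exact: ringO_D|].
      by apply: ringO_M => //; case: (tP j).
    rewrite [a i * _]mulr_sumr mulr_suml [RHS]mulr_sumr; apply: eq_bigr => j _.
    by rewrite [RHS]mulrA -(proj2 (tP j)); ring.
  have /choice[t tP] : forall i, exists t, O t /\ a i * c i * z = p%:R * t.
    by move=> i; have [t Ot Dt] := tmul i; exists t.
  exists (\sum_i t i).
    elim/big_ind: _ => [||j _]; [exact: (ringO_int sF 0)|exact: ringO_D|].
    by case: (tP j).
  by rewrite mulr_suml mulr_sumr; apply: eq_bigr => i _; case: (tP i).
have one x z : P2 x -> J z -> ideal_mul P2 J (x * z).
  move=> Px Jz; exists 1%N, (fun=> x), (fun=> z); split=> //.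
  by rewrite big_ord_recl big_ord0 addr0.
have P2O := ideal_exp_sub (k := 2) sF iP; rewrite -/P2 in P2O.
have iI : is_ideal O (ideal_mul P2 J).
  split.
  - move=> _ [k [a [c [Pa Jc ->]]]]; elim/big_ind: _ => [||i _]; [exact: (ringO_int sF 0)|exact: ringO_D|].
    by apply: ringO_M => //; [exact/P2O/Pa|case: (Jc i)].
  - by exists 0%N, (fun=> 0), (fun=> 0); rewrite big_ord0; split=> // -[].
  - move=> _ _ [k [a [c [Pa Jc ->]]]] [l [a' [c' [Pa' Jc' ->]]]].
    exists (k + l)%N, (fun i => match fintype.split i with inl i => a i | inr i => a' i end),
      (fun i => match fintype.split i with inl i => c i | inr i => c' i end); split.
    + by move=> i; case: (fintype.split i).
    + by move=> i; case: (fintype.split i).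
    rewrite big_split_ord /=; congr (_ + _); apply: eq_bigr => i _.
      by rewrite (unsplitK (inl _ i)).
    by rewrite (unsplitK (inr _ i)).
  - move=> x _ Ox [k [a [c [Pa Jc ->]]]]; exists k, a, (fun i => x * c i); split=> //.
      by move=> i; case: iJ => _ _ _ JM; apply: JM.
    by rewrite mulr_sumr; apply: eq_bigr => i _; rewrite mulrCA.
apply/seteqP; split; last first.
  move=> _ [k [a [c [Pa Jc ->]]]].
  have /choice[t tP] : forall i, exists t, O t /\ a i * c i = p%:R * t.
    by move=> i; have [t Ot Dt] := P2J _ _ (Pa i) (Jc i); exists t.
  exists (\sum_i t i).
    elim/big_ind: _ => [||j _]; [exact: (ringO_int sF 0)|exact: ringO_D|by case: (tP j)].
  by rewrite mulr_sumr; apply: eq_bigr => i _; case: (tP i).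
suff pI : ideal_mul P2 J p%:R.
  by move=> _ [x Ox <-]; rewrite mulrC; case: iI => _ _ _; apply.
have [_ _ ID IM] := iI.
have sqI a : P a -> ideal_mul P2 J (p%:R * a ^+ 2).
  move=> Pa; rewrite mulrC; apply: one; first exact: ideal_exp_pow.
  split; first exact: ringO_nat.
  by move=> c c' Pc Pc'; exists (c * c'); [apply: ringO_M => //; exact: PO|rewrite mulrA].
(* [x0] has value 1 and clears all denominators in p x0 = pi ^ 2 (x0 p / pi ^ 2), placing p x0 in P
   ^ 2 J. On the other side p a ^ 2 is in P ^ 2 J for every a in P, and it remains to combine the
   two. *)
pose x0 := s' * m ^+ 2.
have Ox0 : O x0 by apply: ringO_M => //; apply: ringO_X.
have wx0 : w x0 = 1 by rewrite absvalM // ws' absvalX // wm expr1n mulr1.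
have xI : ideal_mul P2 J (p%:R * x0).
  have -> : p%:R * x0 = pi ^+ 2 * (s' * (p%:R / pi ^+ 2) * m ^+ 2).
    have E2 : p%:R = pi ^+ 2 * (p%:R / pi ^+ 2) by rewrite mulrCA divff ?mulr1 ?expf_neq0.
    by rewrite /x0 {1}E2; ring.
  apply: one; first exact: ideal_exp_pow.
  split; first by apply: ringO_M => //; apply: ringO_X.
  move=> a a' Pa Pa'; exists (s' * (m * (a / pi)) * (m * (a' / pi))).
    by apply: ringO_M; [|apply: ringO_M|exact: mP]; rewrite //; apply: mP.
  by rewrite !expr2 invfM; ring.
have wx0le : w x0 <= 1 by rewrite wx0.
have [K K0 hK] := residue_frobenius pp wP sF (proj1 Ox0) wx0le.
have q1 : (1 < p ^ K)%N by rewrite -(exp1n K) ltn_exp2r // prime_gt1.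
(* An inverse of [x0] modulo P, since x0 ^ (p ^ K) and x0 have the same residue and x0 has value
   1. *)
pose c := x0 ^+ (p ^ K).-2.
have Oc : O c by apply: ringO_X.
have Pc : P (1 - c * x0).
  have e : (p ^ K = (p ^ K).-2.+2)%N by case: (p ^ K)%N q1 => [|[]].
  split.
    apply: (ringO_D sF); first exact: ringO1.
    rewrite -mulN1r; apply: (ringO_M sF); first exact: (ringO_int sF (-1)).
    exact: ringO_M.
  have E : x0 ^+ (p ^ K) - x0 = x0 * (c * x0 - 1).
    by rewrite {1}e exprS exprSr -/c mulrBr mulr1.
  by rewrite absvalB //; move: hK; rewrite E absvalM // wx0 mul1r.
have -> : p%:R = p%:R * (1 - c * x0) ^+ 2 + (c *+ 2 - c ^+ 2 * x0) * (p%:R * x0) by ring.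
apply: ID; first exact: sqI.
apply: IM => //; apply: (ringO_D sF); first by rewrite mulr2n; apply: (ringO_D sF).
rewrite -mulN1r; apply: (ringO_M sF); first exact: (ringO_int sF (-1)).
by apply: (ringO_M sF) => //; apply: ringO_X.
Qed.
End Unramified.

(** * The height inequality from the product formula *)

Lemma valof_sub_le (R : realType) (q : nat) (w : algC -> R) (x y : algC) : valof q w ->
  w (x - y) <= kappa R q * (Num.max 1 (w x) * Num.max 1 (w y)).
Proof.
move=> [wA wU _]; apply: (le_trans (wU _ _)).
rewrite absvalN // ler_pM2l; last by rewrite (lt_le_trans ltr01) // kappa_ge1.
have h1 : 1 <= Num.max 1 (w x) by rewrite le_max lexx.
have h2 : 1 <= Num.max 1 (w y) by rewrite le_max lexx.
have h3 : w x <= Num.max 1 (w x) by rewrite le_max lexx orbT.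
have h4 : w y <= Num.max 1 (w y) by rewrite le_max lexx orbT.
rewrite ge_max; apply/andP; split.
  by apply: (le_trans h3); rewrite ler_peMr // (le_trans ler01).
by apply: (le_trans h4); rewrite ler_peMl // (le_trans ler01).
Qed.

Lemma adjoin_seq_sub (L : fieldExtType rat) (iota : {rmorphism L -> algC}) (s : seq L) (E : set algC) :
  subfield E -> (forall y, y \in s -> E (iota y)) ->
  forall y, y \in <<1 & s>>%VS -> E (iota y).
Proof.
move=> sE; elim/last_ind: s => [_ y|s z IH Es y].
  rewrite Fadjoin_nil => /vlineP[k ->]; rewrite alg_num_field fmorph_rat; exact: subfield_rat.
rewrite adjoin_rcons => /Fadjoin_polyP[f /polyOverP fs ->].
rewrite -horner_map; apply: (subfield_horner sE) => [|i].
  by apply: Es; rewrite mem_rcons mem_head.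
rewrite coef_map; apply: IH => // u us; apply: Es.
by rewrite mem_rcons inE us orbT.
Qed.

Lemma smallest_subfield_image (L : fieldExtType rat) (iota : {rmorphism L -> algC}) (S : set algC) :
  (forall y, S y -> exists z, iota z = y) ->
  forall y, smallest subfield S y -> exists z, iota z = y.
Proof.
move=> hS y Sy; apply: (Sy [set y | exists z, iota z = y]); split=> //.
apply: subfieldP => [|_ _ [a <-] [b <-]|_ _ [a <-] [b <-]].
- by exists 1; rewrite rmorph1.
- by exists (a - b); rewrite rmorphB.
- by exists (a / b); rewrite fmorph_div.
Qed.

Lemma minCpoly_size_bound (s : seq algC) :
  exists D, forall x, smallest subfield [set` s] x -> (size (minCpoly x) <= D.+1)%N.
Proof.
have [N [iota [_ hs]]] := normal_closure s; exists (\dim {:N}) => x.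
case/(smallest_subfield_image hs) => y <-.
have [q [Dq _] min_q] := minCpolyP (iota y).
have [f Df] := map_polyOver1 iota (minPolyOver 1 y).
have qf : (q %| f) by rewrite -min_q -Df fmorph_root root_minPoly.
have f0 : f != 0.
  by rewrite -(map_poly_eq0 (@ratr algC)) -Df map_poly_eq0 monic_neq0 // monic_minPoly.
rewrite Dq size_map_poly (leq_trans (dvdp_leq f0 qf)) //.
rewrite -(size_map_poly (@ratr algC)) -Df size_map_poly size_minPoly ltnS.
have := dim_Fadjoin 1 y; rewrite dimv1 muln1 => <-.
exact/dimvS/subvf.
Qed.

(* [G] is the Galois group of a normal closure of the field generated by [gens]
   and [x], and [nu] extends its elements to [algC]. *)
Lemma compositum_not_mem_aut (gens : seq algC) (x : algC) :
  ~ smallest subfield [set` gens] x ->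
  exists (G : finGroupType) (nu : G -> {rmorphism algC -> algC})
    (sigma : {rmorphism algC -> algC}),
  [/\ forall y, smallest subfield [set` gens] y -> sigma y = y,
      sigma x != x,
      forall r, root (minCpoly x) r -> exists g, nu g x = r /\ forall h, nu (g * h)%g x = nu h r,
      exists g, forall h, nu (g * h)%g x = nu h (sigma x) &
      exists c : rat, \prod_g nu g (x - sigma x) = ratr c].
Proof.
set E := smallest _ _ => nEx; have sE : subfield E := subfield_smallest _.
have [N [iota [galN hN]]] := normal_closure (x :: gens).
have [x' Dx] := hN x (mem_head _ _).
have /choice[pre preP] : forall y, exists z : N, y \in gens -> iota z = y.
  move=> y; have [yg|yg] := boolP (y \in gens); last by exists 0.
  by have [|z Dz] := hN y; [rewrite inE yg orbT|exists z].
pose E' := <<1 & map pre gens>>%AS.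
have xE' : x' \notin E'.
  apply/negP => xE; apply: nEx; rewrite -Dx; apply: (adjoin_seq_sub sE) xE => y.
  case/mapP => z zg ->; rewrite preP // => K [_]; apply; exact: zg.
have galE : galois E' {:N} by apply: galoisS galN; rewrite sub1v subvf.
have [g0 g0G g0x] : exists2 g, g \in 'Gal({:N} / E')%g & g x' != x'.
  apply: contrapT => no; move/negP: xE'; apply.
  rewrite -(galois_fixedField galE); apply/fixedFieldP; first exact: memvf.
  by move=> g gG; apply: contrapT => /eqP h; apply: no; exists g.
have /choice[nu nuE] : forall g : gal_of {:N}, exists nu : {rmorphism algC -> algC},
    forall a, nu (iota a) = iota (g a).
  by move=> g; have [nu h] := extend_algC_subfield_aut iota g; exists nu => a; rewrite -h.
have nuM g h a : nu (g * h)%g (iota a) = nu h (iota (g a)).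
  by rewrite !nuE galM ?memvf.
exists (gal_of {:N}), nu, (nu g0); split.
- move=> y Ey; apply: (Ey [set y | nu g0 y = y]); split.
    apply: subfieldP => [|a b /= ha hb|a b /= ha hb].
    + by rewrite /= rmorph1.
    + by rewrite /= rmorphB /= ha hb.
    + by rewrite /= fmorph_div /= ha hb.
  move=> z zg; rewrite /= -(preP z zg) nuE; congr (iota _).
  apply: (fixed_gal (subvf E') g0G).
  by apply: seqv_sub_adjoin; apply: map_f.
- by rewrite -Dx nuE (inj_eq (fmorph_inj iota)).
- move=> r xr; have [q [Dq _] min_q] := minCpolyP x.
  have [f Df] := map_polyOver1 iota (minPolyOver 1 x').
  have qf : (q %| f) by rewrite -min_q -Df -Dx fmorph_root root_minPoly.
  have rf : root (map_poly iota (minPoly 1 x')) r.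
    by rewrite Df; case/dvdpP: qf => h ->; rewrite rmorphM rootM /= -Dq xr orbT.
  have [rs [_ _ Drs]] := galois_factors (sub1v _) galN x' (memvf x').
  move: rf; rewrite Drs rmorph_prod /=; under eq_bigr do rewrite map_polyXsubC.
  rewrite -(big_map iota xpredT (fun y => 'X - y%:P)) root_prod_XsubC.
  case/mapP => _ /mapP[g _ ->] ->; exists g; rewrite -Dx nuE; split=> // h; exact: nuM.
- by exists g0 => h; rewrite -Dx nuM -[iota (g0 x')]nuE.
have : galNorm 1 {:N} (x' - g0 x') \in 1%VS.
  by rewrite -{2}(galois_fixedField galN) galNorm_fixedField ?memvf.
case/vlineP => c Dc; exists c.
rewrite -(fmorph_rat iota) -alg_num_field -Dc /galNorm rmorph_prod /=.
rewrite [RHS](eq_bigl xpredT); last first.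
  move=> g; rewrite gal_kHom ?sub1v //; apply/kHomP; split=> [a b _ _|a /vlineP[k ->]].
    by rewrite rmorphM.
  by rewrite alg_num_field fmorph_rat.
have -> : x - nu g0 x = iota (x' - g0 x') by rewrite rmorphB /= -nuE Dx.
by apply: eq_bigr => g _; apply: nuE.
Qed.

(** The double product over group elements and roots is computed in two ways: a left translation of
    the group replaces x by any root, and each group element permutes the roots. *)
Lemma prod_conjugates (R : realType) (G : finGroupType) (nu : G -> {rmorphism algC -> algC})
    (x : algC) (rs : seq algC) (f : algC -> R) :
  uniq rs -> minCpoly x = \prod_(r <- rs) ('X - r%:P) ->
  (forall r, root (minCpoly x) r -> exists g, nu g x = r /\ forall h, nu (g * h)%g x = nu h r) ->
  (\prod_g f (nu g x)) ^+ size rs = (\prod_(r <- rs) f r) ^+ #|G|.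
Proof.
move=> urs Drs tr; transitivity (\prod_(r <- rs) \prod_g f (nu g r)).
  have e r : r \in rs -> \prod_g f (nu g r) = \prod_g f (nu g x).
    move=> rrs; have /tr[g0 [_ Dg0]] : root (minCpoly x) r by rewrite Drs root_prod_XsubC.
    rewrite [RHS](reindex_inj (mulgI g0)) /=.
    by apply: eq_bigr => g _; rewrite Dg0.
  by rewrite (eq_big_seq _ e) big_const_seq count_predT iter_mulr_1.
rewrite exchange_big /= -prodr_const; apply: eq_bigr => g _.
rewrite -(big_map (nu g) xpredT f); apply: perm_big.
have umap : uniq (map (nu g) rs) by rewrite map_inj_uniq //; exact: fmorph_inj.
apply: uniq_perm => //.
have sub : {subset map (nu g) rs <= rs}.
  move=> _ /mapP[r rrs ->]; move: rrs; rewrite -!root_prod_XsubC -Drs.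
  have [q [-> _] _] := minCpolyP x; rewrite -(fmorph_root (nu g)) -map_poly_comp.
  by congr is_true; congr root; apply: eq_map_poly => a /=; rewrite fmorph_rat.
by apply: (uniq_min_size umap sub _).2; rewrite size_map.
Qed.

(* Product formula for the norm of [x - sigma x], where [sigma] fixes the base
   field: at [p], each conjugate contributes an additional factor
   [w pi = p ^ (- 1 / n)]. *)
Lemma ramified_height_bound (R : realType) (p n : nat) (gens : seq algC) (F : set algC) (pi x : algC) :
  prime p -> subfield F -> F pi -> has_degree rationals F n ->
  (forall w : algC -> R, valof p w -> w pi ^+ n = p%:R^-1) ->
  (forall w : algC -> R, valof p w -> pvalues p w (smallest subfield [set` gens])) ->
  uspan n (smallest subfield [set` gens]) pi x ->
  ~ smallest subfield [set` gens] x ->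
  p%:R <= (2 * height R x ^+ 2) ^+ n.
Proof.
move=> pp sF Fpi Fn wpi; set E := smallest _ _ => Ew ux nEx.
have sE : subfield E := subfield_smallest _.
have [G [nu [sigma [sigmaE sx tr [g0 Dg0] [c Dc]]]]] := compositum_not_mem_aut nEx.
have [rs [urs Drs xrs]] := minCpoly_roots x.
have /choice[W WP] : forall q, exists w : algC -> R, is_pl q -> valof q w.
  move=> q; have [/valof_exists-/(_ R)[w wP]|] := boolP (is_pl q); first by exists w.
  by exists (fun=> 0).
have plp : is_pl p by rewrite /is_pl pp orbT.
have wpA := WP p plp; have [wA _ _] := wpA.
have p0 : 0 < p%:R :> R by rewrite ltr0n prime_gt0.
have n0 : (0 < n)%N.
  rewrite lt0n; apply/eqP => nz; have := wpi _ wpA; rewrite nz expr0 => /eqP.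
  by rewrite eq_sym invr_eq1 pnatr_eq1 => /eqP p1; move: pp; rewrite p1.
pose rho := W p pi.
have rho0 : 0 <= rho by apply: absval_ge0.
have Drho g : W p (nu g pi) = rho.
  apply: (pexpIrn n0); rewrite ?nnegrE //; first by apply: absval_ge0.
  by rewrite (wpi _ wpA) (wpi _ (padic_valof_comp wpA (nu g))).
have c0 : c != 0.
  apply/eqP => cz; have /eqP := Dc; rewrite cz rmorph0; apply/negP/prodf_neq0 => g _.
  by rewrite fmorph_eq0 subr_eq0 eq_sym.
(* The constant paid per conjugate at the place q: the gain [rho] at p, the triangle inequality
   elsewhere. Over all places the product is [2 * rho]. *)
pose k q := if q == p then rho else kappa R q.
pose A q := \prod_g Num.max 1 (W q (nu g x)).
have max_ge0 q y : 0 <= Num.max 1 (W q y) by rewrite (le_trans ler01) // le_max lexx.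
have A_ge0 q : 0 <= A q by apply: prodr_ge0.
have k_ge0 q : 0 <= k q.
  by rewrite /k; case: ifP => // _; rewrite (le_trans ler01) // kappa_ge1.
have bound q : is_pl q -> uabs R q c <= k q ^+ #|G| * A q ^+ 2.
  move=> plq; have wqP := WP q plq; have [wqA _ <-] := wqP.
  have -> : A q ^+ 2 =
      \prod_g (Num.max 1 (W q (nu g x)) * Num.max 1 (W q (nu g (sigma x)))).
    rewrite big_split expr2; congr (_ * _); rewrite /A (reindex_inj (mulgI g0)) /=.
    by apply: eq_bigr => g _; rewrite Dg0.
  rewrite -Dc (absval_prod wqA) -prodr_const -big_split /=.
  apply: ler_prod => g _; rewrite absval_ge0 //=.
  have wnP := padic_valof_comp wqP (nu g).
  rewrite /k; case: eqP => [qp|_]; last exact: (valof_sub_le x (sigma x) wnP).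
  move: wnP; rewrite qp => wnP; rewrite -(Drho g).
  exact: (uspan_sub_sigma pp sE sF Fpi Fn wpi wnP (Ew _ wnP) sigmaE ux).
have [B [Bp Bn Bd]] : exists B : nat, [/\ (p < B)%N, (`|numq c| < B)%N & (`|denq c| < B)%N].
  by exists (p + `|numq c| + `|denq c|).+1%N; rewrite !ltnS leq_addl -addnA leq_addr addnCA leq_addr.
pose P := \prod_(0 <= q < B | is_pl q) A q.
have P_ge0 : 0 <= P by apply: prodr_ge0.
have H0 := height_ge0 R x.
have rs0 : (0 < size rs)%N by case: (rs) xrs.
(* Products over [G] and over the roots agree only after raising to the powers [size rs] and [#|G|],
   so the inequality is checked on [size rs]-th powers. *)
have PH : P <= height R x ^+ #|G|.
  rewrite -(@ler_pXn2r _ (size rs)) // ?nnegrE ?exprn_ge0 //.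
  rewrite -prodrXl; under eq_bigr do rewrite /A (prod_conjugates (fun y => Num.max 1 (W _ y)) urs Drs tr).
  rewrite prodrXl -exprM mulnC exprM lerXn2r ?nnegrE ?exprn_ge0 //.
    by apply: prodr_ge0 => q _; apply: prodr_ge0.
  exact: height_lower_bound.
have : 1 <= (2 * rho) ^+ #|G| * P ^+ 2.
  have B0 : (0 < B)%N by apply: leq_ltn_trans Bp.
  have one : \prod_(0 <= q < B | is_pl q) uabs R q c = 1.
    by rewrite (prod_is_pl _ B0) product_formula.
  rewrite -[leLHS]one; have -> : 2 * rho = \prod_(0 <= q < B | is_pl q) k q.
    rewrite (prod_is_pl _ B0) /k; have -> : (0%N == p) = false by case: (p) pp.
    congr (_ * _); rewrite -big_filter (bigD1_seq p) /= ?filter_uniq ?iota_uniq //; last first.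
      by rewrite mem_filter pp mem_index_iota.
    rewrite eqxx big_filter_cond big1 ?mulr1 // => q /andP[pq /negPf ->].
    by rewrite /kappa; case: q pq.
  rewrite /P -!prodrXl -big_split /=; apply: ler_prod => q plq.
  by rewrite bound // andbT; case: (WP q plq) => wqA _ <-; apply: absval_ge0.
move=> le1; have {le1}: 1 <= (2 * rho * height R x ^+ 2) ^+ #|G|.
  apply: (le_trans le1); rewrite [leRHS]exprMn; apply: ler_wpM2l.
    by rewrite exprn_ge0 // mulr_ge0.
  by rewrite -exprM mulnC exprM lerXn2r ?nnegrE ?exprn_ge0.
have G0 : (0 < #|G|)%N by apply/card_gt0P; exists g0.
have b0 : 0 <= 2 * rho * height R x ^+ 2 by rewrite !mulr_ge0 ?exprn_ge0.
(* Once the exponent [#|G|] is removed, taking n-th powers turns [rho] into 1 / p. *)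
rewrite expr_ge1 // => le1.
have := exprn_ege1 n le1; rewrite mulrAC exprMn (wpi _ wpA).
by rewrite ler_pdivlMr ?mul1r.
Qed.

(** * The tower of composita and the conclusion *)

Lemma qspan_tower (K E : set algC) (n m : nat) (b : 'I_n -> algC) (c : 'I_m -> algC) :
  subfield E -> K `<=` E -> is_basis K E b -> qspan K c ->
  exists e : 'I_(n * m) -> algC, qspan E e.
Proof.
move=> sE KE [bE bspan _] [cK cspan].
have <- : #|{: 'I_n * 'I_m}| = (n * m)%N by rewrite card_prod !card_ord.
exists (fun k => b (enum_val k).1 * c (enum_val k).2); split=> [k|y Ey].
  by apply: (subfieldM sE) => //; exact: KE.
have [a aK ->] := bspan y Ey.
have /choice[q Dq] : forall i, exists q : 'I_m -> rat, a i = \sum_j ratr (q j) * c j.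
  by move=> i; exact: cspan.
exists (fun k => q (enum_val k).1 (enum_val k).2).
rewrite -(big_enum_val (fun ij : 'I_n * 'I_m => ratr (q ij.1 ij.2) * (b ij.1 * c ij.2))) /=.
rewrite -(pair_big xpredT xpredT (fun i j => ratr (q i j) * (b i * c j))) /=.
apply: eq_bigr => i _; rewrite Dq mulr_suml; apply: eq_bigr => j _.
by rewrite mulrAC mulrA.
Qed.

Lemma subfield_bigcup (K : nat -> set algC) :
  (forall i, subfield (K i)) -> (forall i j, (i <= j)%N -> K i `<=` K j) ->
  subfield (\bigcup_i K i).
Proof.
move=> sK mK; apply: subfieldP => [|x y [i _ xi] [j _ yj]|x y [i _ xi] [j _ yj]].
- by exists 0%N => //; exact: subfield1.
- exists (maxn i j) => //; apply: (subfieldB (sK _)).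
    exact: mK (leq_maxl _ _) _ xi.
  exact: mK (leq_maxr _ _) _ yj.
- exists (maxn i j) => //; apply: (subfield_div (sK _)).
    exact: mK (leq_maxl _ _) _ xi.
  exact: mK (leq_maxr _ _) _ yj.
Qed.

Lemma qspan_generated (E : set algC) (n : nat) (b : 'I_n -> algC) :
  qspan E b -> E `<=` smallest subfield [set` codom b].
Proof.
move=> [_ bspan] y /bspan[c ->]; have sS := subfield_smallest [set` codom b].
apply: (subfield_sum sS) => i _; apply: (subfieldM sS); first exact: subfield_rat.
by move=> K [_]; apply; exact: codom_f.
Qed.

(** A value p ^ z of [pi] gives z * n = -1. This excludes that a prime is unramified and totally
    ramified in the same field of degree greater than 1. *)
Lemma pvalues_root_exponent (R : realType) (p n : nat) (w : algC -> R) (E : set algC) (pi : algC) :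
  prime p -> absval w -> pvalues p w E -> E pi -> w pi ^+ n = p%:R^-1 -> n = 1%N.
Proof.
move=> pp wA Ew Epi wpi; have p1 : 1 < p%:R :> R by rewrite ltr1n prime_gt1.
have n0 : (0 < n)%N.
  rewrite lt0n; apply/eqP => nz; move: wpi; rewrite nz expr0 => /eqP.
  by rewrite eq_sym invr_eq1 gt_eqF.
have pi0 : pi != 0.
  apply: contra_eq_neq wpi => ->; rewrite (absval0 wA) expr0n gtn_eqF // eq_sym invr_neq0 //.
  by rewrite gt_eqF // (lt_trans ltr01).
have [z Dz] := Ew _ Epi pi0; move: wpi; rewrite Dz exprnP exprz_exp -exprN1.
move/(ieexprIz (lt_trans ltr01 p1) (negbT (gt_eqF p1))).
by case: z Dz => k; lia.
Qed.

Theorem corollary3 (R : realType) (d : nat) (F : nat -> set algC)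
    (p : nat -> nat)
    (d_gt0 : (0 < d)%N)
    (F0_number_field : number_field (F 0%N))
    (F_ext : forall i : nat, (1 <= i)%N -> finite_extension (F 0%N) (F i))
    (F_deg : forall i : nat, (1 <= i)%N -> (degree (F 0%N) (F i) <= d)%N)
    (p_prime : forall i : nat, (1 <= i)%N -> prime (p i))
    (p_ramified : forall i : nat, (1 <= i)%N -> ramifies_totally (p i) (F i))
    (p_unramified : forall i j : nat, (1 <= j)%N -> (j < i)%N ->
      ~ ramifies (p i) (F j)) :
  northcott R (compositum F).
Proof.
move=> X X0.
have [_ sF0 _ [m [c cF0]]] := F0_number_field.
have sF i : subfield (F i) by case: i => // i; case: (F_ext i.+1 isT).
have F0sub i : F 0%N `<=` F i by case: i => // i; case: (F_ext i.+1 isT).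
have F0span := basis_qspan cF0.
have /choice[nb nbP] : forall i, exists nb : {n : nat & 'I_n -> algC},
    qspan (F i) (projT2 nb) /\ (tag nb <= d * m)%N.
  (* F_0 itself is spanned by m elements, and m <= d m because d is positive. For the other fields
     [F_ext] ensures that [degree] is a genuine degree and not its default value. *)
  case=> [|i]; first by exists (existT _ m c); rewrite leq_pmull.
  have [_ _ _ /(xgetPex 0%N)[b bP]] := F_ext i.+1 isT.
  have [e eP] := qspan_tower (sF _) (F0sub i.+1) bP F0span.
  by exists (existT _ _ e); rewrite leq_mul2r F_deg ?orbT.
pose n i := degree rationals (F i).
have nD i : (n i <= d * m)%N.
  by have [h1 h2] := nbP i; exact: leq_trans (degree_qspan h1).1 h2.
have degF i : has_degree rationals (F i) (n i) by case: (nbP i) => /degree_qspan[].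
pose gens i := flatten [seq codom (projT2 (nb j)) | j <- iota 0 i.+1].
pose K i := smallest subfield [set` gens i].
have sK i : subfield (K i) := subfield_smallest _.
have FK i j : (j <= i)%N -> F j `<=` K i.
  move=> ji y /(qspan_generated (nbP j).1) h S [sS gS]; apply: h; split=> // z zj; apply: gS.
  apply/flattenP; exists (codom (projT2 (nb j))) => //.
  by apply: (map_f (fun j => codom (projT2 (nb j)))); rewrite mem_iota.
have Kmin i E : subfield E -> (forall j, (j <= i)%N -> F j `<=` E) -> K i `<=` E.
  move=> sE FE y; apply; split=> // z /flattenP[_ /mapP[j ji ->] /codomP[k ->]].
  by apply: (FE j); [move: ji; rewrite mem_iota|exact: (nbP j).1.1].
have Kmono i j : (i <= j)%N -> K i `<=` K j.
  by move=> ij; apply: Kmin => // k ki; apply: FK; exact: leq_trans ij.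
have compK : compositum F `<=` \bigcup_i K i.
  move=> y; apply; split; first exact: subfield_bigcup.
  by move=> z [i _ Fz]; exists i => //; exact: (FK i i).
have /choice[pi piP] : forall i, exists pi, (1 <= i)%N -> F i pi /\
    forall w : algC -> R, valof (p i) w -> w pi ^+ n i = (p i)%:R^-1.
  move=> i; have [i1|_] := boolP (1 <= i)%N; last by exists 0.
  have [|pi [Fpi _] piw] := totally_ramified_uniformizer R (p_prime i i1) (sF i) _ (p_ramified i i1).
    by case: (nbP i); exists (tag (nb i)), (projT2 (nb i)).
  by exists pi.
have unramF i j (w : algC -> R) : (1 <= j < i)%N -> valof (p i) w -> pvalues (p i) w (F j).
  move=> /andP[j1 ji] wP.
  exact: (unramified_pvalues (p_prime i (leq_ltn_trans (leq0n j) ji)) (sF j) (nbP j).1 wP (p_unramified i j j1 ji)).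
(* The index starts at 2, so that K_(i-1) contains F_1, through which F_0 is known to be unramified
   at p_i. *)
pose new i x := [/\ (1 < i)%N, K i x & ~ K i.-1 x].
have Kuspan i : (1 < i)%N -> K i `<=` uspan (n i) (K i.-1) (pi i).
  move=> i1; have [Fpi wpi] := piP i (ltnW i1); have pp := p_prime i (ltnW i1).
  apply: Kmin => [|j ji]; first exact: (subfield_uspan pp (sK _) (sF i) Fpi (degF i) wpi).
  move: ji; rewrite leq_eqVlt => /predU1P[->|ji].
    exact: (uspan_extension pp (sK _) (sF i) Fpi (degF i) wpi).
  apply: (subset_trans _ (uspan_base pp (sK _) (sF i) Fpi (degF i) wpi)).
  by apply: FK; rewrite -ltnS prednK // ltnW.
(* With a single power of [pi], the span of K_(i-1) is K_(i-1) itself and contains nothing new. *)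
have new_degree i x : new i x -> (1 < n i)%N.
  move=> [i1 Kx nKx]; rewrite ltnNge; apply/negP => n1; apply: nKx.
  have [a aK ->] := Kuspan i i1 x Kx.
  apply: (subfield_sum (sK _)) => k _; have -> : k = 0%N :> nat by have := ltn_ord k; lia.
  by rewrite expr0 mulr1.
have new_bound i x : new i x -> (p i)%:R <= Num.max 1 (2 * height R x ^+ 2) ^+ (d * m).
  move=> [i1 Kx nKx]; have [Fpi wpi] := piP i (ltnW i1); have pp := p_prime i (ltnW i1).
  (* All F_j with j < i lie in the field [teich_field], hence so does their compositum. *)
  have Kw (w : algC -> R) : valof (p i) w -> pvalues (p i) w (K i.-1).
    move=> wP y Ky; apply: (pvalues_teich_field pp wP).
    move: y Ky; apply: Kmin => [|j ji]; first exact: subfield_teich_field.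
    have F_teich k : (1 <= k < i)%N -> F k `<=` teich_field (p i) w.
      by move=> ki; apply: subfield_sub_teich_field => //; exact: unramF.
    case: j ji => [_|j ji]; last by apply: F_teich; lia.
    by apply: (subset_trans (F0sub 1%N)); exact: F_teich.
  apply: (le_trans (ramified_height_bound pp (sF i) Fpi (degF i) wpi Kw (Kuspan i i1 x Kx) nKx)).
  apply: (@le_trans _ _ (Num.max 1 (2 * height R x ^+ 2) ^+ n i)).
    apply: lerXn2r; rewrite ?nnegrE ?le_max ?lexx ?orbT ?ler01 //.
    by rewrite mulr_ge0 // exprn_ge0 // height_ge0.
  by apply: ler_weXn2l => //; rewrite le_max lexx.
(* For i < j the prime p_j does not ramify in F_i; were it equal to p_i, the uniformizer of F_i
   would have an integral power of p_i as value, forcing [F_i : Q] = 1 against [new_degree]. *)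
have new_inj i j x y : new i x -> new j y -> p i = p j -> i = j.
  wlog ij : i j x y / (i < j)%N => [hw nx ny pij|nx ny pij].
    case: (ltngtP i j) => // h; first exact: (hw i j x y).
    by apply/esym; exact: (hw j i y x).
  have [i1 _ _] := nx; have [Fpi wpi] := piP i (ltnW i1); have pp := p_prime i (ltnW i1).
  have [w wP] := valof_exists R (q := p i) (introT orP (or_intror pp)).
  have [wA _ _] := wP; have := new_degree i x nx.
  rewrite (pvalues_root_exponent pp wA _ Fpi (wpi w wP)) //.
  by move: wP; rewrite pij => wP; apply: unramF => //; rewrite ij ltnW.
pose M := Num.max 1 (2 * X ^+ 2) ^+ (d * m).
(* By [new_inj] each prime belongs to at most one enlarging index, so the finitely many primes up to
   [M] bound these indices. *)
have [i0 i0P] : exists i0, forall i x, new i x -> (p i)%:R <= M -> (i <= i0)%N.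
  have /choice[h hP] : forall q, exists i, forall j y, new j y -> p j = q -> j = i.
    move=> q; have [[i [x [nx <-]]]|no] := pselect (exists i x, new i x /\ p i = q).
      by exists i => j y ny pj; exact: new_inj ny nx pj.
    by exists 0%N => j y ny pj; case: no; exists j, y.
  exists (\max_(q < (Num.bound M).+1) h q)%N => i x nx piM.
  have pb : (p i < (Num.bound M).+1)%N.
    have M0 : 0 <= M by rewrite exprn_ge0 // le_max ler01.
    by rewrite ltnS -(ler_nat R); exact: ltW (le_lt_trans piM (archi_boundP M0)).
  by rewrite (hP (p i) i x nx erefl); exact: (leq_bigmax (Ordinal pb)).
(* The maximum with 1 includes the elements of K_0 and K_1, to which the ramification argument does
   not apply. *)
have [D DP] := minCpoly_size_bound (gens (maxn i0 1)).
apply: (sub_finite_set _ (northcott_bounded_degree D X)) => x [/compK[i1 _ Ki1] Hx].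
split=> //; apply: DP.
have exi : exists i, `[< K i x >] by exists i1; apply/asboolP.
(* For the least [i] with x in K_i, either i <= 1 or x is outside K_(i-1), and then its height
   bounds p_i. *)
case: (ex_minnP exi) => i /asboolP Kix imin.
have [i_le1|i_gt1] := leqP i 1.
  by apply: (Kmono i) Kix; rewrite leq_max i_le1 orbT.
have nx : new i x.
  split=> // /asboolP /imin; lia.
apply: (Kmono i) Kix; rewrite leq_max (i0P i x nx) // (le_trans (new_bound i x nx)) //.
have H0 := height_ge0 R x.
apply: lerXn2r; [by rewrite nnegrE le_max ler01|by rewrite nnegrE le_max ler01|].
rewrite ge_max; apply/andP; split; first by rewrite le_max lexx.
rewrite le_max; apply/orP; right.
by rewrite ler_pM2l // lerXn2r // nnegrE // ltW.
Qed.
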